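(* For every $\alpha>0$ and every admissible $\Sigma_z$, $\mathcal{C}_{MCC}\subseteq\mathcal{R}_{out}^{\alpha,\Sigma_z}$. Consequently $\mathcal{C}_{MCC}\subseteq\mathcal{R}_{out}:=\bigcap_{\Sigma_z}\bigcap_{\alpha>0}\mathcal{R}_{out}^{\alpha,\Sigma_z}$.
   Context: Gaussian MIMO cognitive channel (MCC): a primary transmitter with $n_{p,t}$ antennas, a cognitive transmitter with $n_{c,t}$ antennas, a primary receiver with $n_{p,r}$ antennas and a cognitive receiver with $n_{c,r}$ antennas. Fixed complex matrices $H_{p,p}\in\mathbb{C}^{n_{p,r}\times n_{p,t}}$, $H_{c,p}\in\mathbb{C}^{n_{p,r}\times n_{c,t}}$, $H_{p,c}\in\mathbb{C}^{n_{c,r}\times n_{p,t}}$, $H_{c,c}\in\mathbb{C}^{n_{c,r}\times n_{c,t}}$. At time $i$: $Y_p(i)=H_{p,p}X_p(i)+H_{c,p}X_c(i)+Z_p(i)$, $Y_c(i)=H_{p,c}X_p(i)+H_{c,c}X_c(i)+Z_c(i)$, with $Z_p(i)\sim\mathcal{N}(0,I)$, $Z_c(i)\sim\mathcal{N}(0,I)$ Gaussian, i.i.d. over time, arbitrarily correlated with each other. A code of length $n$: messages $m_p\in\{1,\dots,2^{nR_p}\}$, $m_c\in\{1,\dots,2^{nR_c}\}$; encoders $X_p^n=E_p^n(m_p)$, $X_c^n=E_c^n(m_p,m_c)$ with $\sum_{i}\mathrm{Tr}(\Sigma_p(i))\le nP_p$, $\sum_i\mathrm{Tr}(\Sigma_c(i))\le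 nP_c$ ($\Sigma_p(i),\Sigma_c(i)$ covariances of $X_p(i),X_c(i)$); decoders $\hat m_p=D_p^n(Y_p^n)$, $\hat m_c=D_c^n(Y_c^n)$. $(R_p,R_c)$ is achievable if for all $\epsilon>0$ and large $n$ there is a code with both error probabilities $\le\epsilon$; $\mathcal{C}_{MCC}$ is the set of achievable pairs. For $\alpha>0$ let $G_\alpha=[H_{p,p}\ \ H_{c,p}/\sqrt\alpha]$ and $\overline K=\begin{pmatrix}H_{p,p}&H_{c,p}/\sqrt\alpha\\0&H_{c,c}/\sqrt\alpha\end{pmatrix}$. An admissible $\Sigma_z$ is a positive semidefinite matrix of the form $\Sigma_z=\begin{pmatrix}I_{n_{p,r}}&Q_z\\Q_z^\dagger&I_{n_{c,r}}\end{pmatrix}$ (with $|\Sigma_z|>0$ so the expressions below are finite). $\mathcal{R}_{out}^{\alpha,\Sigma_z}$ is the closure of the convex hull of the set of $(R_p,R_c)$, $R_p,R_c\ge0$, for which there exist $Q_p,Q_c\succeq0$ of size $(n_{p,t}+n_{c,t})$ with $\mathrm{Tr}(Q_p)+\mathrm{Tr}(Q_c)\le P_p+\alpha P_c$, $R_p\le\log|I+G_\alpha Q_pG_\alpha^\dagger+G_\alpha Q_cG_\alpha^\dagger|-\log|I+G_\alpha Q_cG_\alpha^\dagger|$, and $R_c\le\log|\Sigma_z+\overline KQ_c\overline K^\dagger|-\log|\Sigma_z|$. *)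

(* Defs.v *)
From HB Require Import structures.
From mathcomp Require Import all_boot all_order all_algebra.
From mathcomp Require Import all_classical all_reals all_analysis.
From mathcomp Require Import complex.

Set Implicit Arguments.
Unset Strict Implicit.
Unset Printing Implicit Defensive.

Import Order.TTheory GRing.Theory Num.Theory.
Import numFieldNormedType.Exports.

Local Open Scope classical_set_scope.
Local Open Scope ring_scope.

Definition ctr (R : rcfType) (m n : nat) (A : 'M[R[i]]_(m, n)) : 'M[R[i]]_(n, m) :=
  (map_mx (@conjc R) A)^T.

(* positive semidefinite (Hermitian and x^dagger Q x >= 0 for all x; the
   order on R[i] is: 0 <= z iff z is real and nonnegative) *)
Definition psd (R : rcfType) (n : nat) (Q : 'M[R[i]]_n) : Prop :=
  ctr Q = Q /\ forall x : 'cV[R[i]]_n, 0 <= (ctr x *m Q *m x) 0 0.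

(* logarithm in base 2 (rates are in bits: 2^(nR) messages) *)
Definition log2 (R : realType) (x : R) : R := ln x / ln 2.

(* log |M| for a Hermitian positive-definite M (its determinant is real) *)
Definition logdet (R : realType) (n : nat) (M : 'M[R[i]]_n) : R :=
  log2 (complex.Re (\det M)).

Definition rc (R : rcfType) (x : R) : R[i] := (x%:C)%C.

Definition Galpha (R : realType) (npt nct npr : nat)
  (Hpp : 'M[R[i]]_(npr, npt)) (Hcp : 'M[R[i]]_(npr, nct)) (alpha : R)
  : 'M[R[i]]_(npr, npt + nct) :=
  row_mx Hpp (rc (Num.sqrt alpha)^-1 *: Hcp).

Definition Kbar (R : realType) (npt nct npr ncr : nat)
  (Hpp : 'M[R[i]]_(npr, npt)) (Hcp : 'M[R[i]]_(npr, nct))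
  (Hcc : 'M[R[i]]_(ncr, nct)) (alpha : R)
  : 'M[R[i]]_(npr + ncr, npt + nct) :=
  block_mx Hpp (rc (Num.sqrt alpha)^-1 *: Hcp) 0 (rc (Num.sqrt alpha)^-1 *: Hcc).

Definition Sigmaz (R : rcfType) (npr ncr : nat) (Qz : 'M[R[i]]_(npr, ncr))
  : 'M[R[i]]_(npr + ncr) :=
  block_mx 1%:M Qz (ctr Qz) 1%:M.

Definition admissible (R : rcfType) (npr ncr : nat) (Qz : 'M[R[i]]_(npr, ncr))
  : Prop :=
  psd (Sigmaz Qz) /\ 0 < \det (Sigmaz Qz).

Definition conv2 (R : realType) (S : set (R * R)) : set (R * R) :=
  [set p | exists (k : nat) (w : 'I_k -> R) (x : 'I_k -> R * R),
     (forall i, 0 <= w i) /\ \sum_(i < k) w i = 1 /\ (forall i, S (x i)) /\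
     p = (\sum_(i < k) w i * (x i).1, \sum_(i < k) w i * (x i).2)].

Definition Rout_pre (R : realType) (npt nct npr ncr : nat)
  (Hpp : 'M[R[i]]_(npr, npt)) (Hcp : 'M[R[i]]_(npr, nct))
  (Hcc : 'M[R[i]]_(ncr, nct)) (Pp Pc alpha : R) (Qz : 'M[R[i]]_(npr, ncr))
  : set (R * R) :=
  let G := Galpha Hpp Hcp alpha in
  let K := Kbar Hpp Hcp Hcc alpha in
  [set r | 0 <= r.1 /\ 0 <= r.2 /\
     exists Qp Qc : 'M[R[i]]_(npt + nct),
       psd Qp /\ psd Qc /\
       complex.Re (\tr Qp + \tr Qc) <= Pp + alpha * Pc /\
       r.1 <= logdet (1%:M + G *m Qp *m ctr G + G *m Qc *m ctr G)
              - logdet (1%:M + G *m Qc *m ctr G) /\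
       r.2 <= logdet (Sigmaz Qz + K *m Qc *m ctr K) - logdet (Sigmaz Qz)].

Definition Rout (R : realType) (npt nct npr ncr : nat)
  (Hpp : 'M[R[i]]_(npr, npt)) (Hcp : 'M[R[i]]_(npr, nct))
  (Hcc : 'M[R[i]]_(ncr, nct)) (Pp Pc alpha : R) (Qz : 'M[R[i]]_(npr, ncr))
  : set (R * R) :=
  closure (conv2 (Rout_pre Hpp Hcp Hcc Pp Pc alpha Qz)).

Definition Rout_all (R : realType) (npt nct npr ncr : nat)
  (Hpp : 'M[R[i]]_(npr, npt)) (Hcp : 'M[R[i]]_(npr, nct))
  (Hcc : 'M[R[i]]_(ncr, nct)) (Pp Pc : R) : set (R * R) :=
  [set r | forall (alpha : R) (Qz : 'M[R[i]]_(npr, ncr)),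
     0 < alpha -> admissible Qz -> Rout Hpp Hcp Hcc Pp Pc alpha Qz r].

Definition cpart (R : rcfType) (b : bool) (z : R[i]) : R :=
  if b then complex.Re z else complex.Im z.

(* Z : nat -> Omega -> C^k is an i.i.d. (over time) sequence of standard
   circularly-symmetric complex Gaussian vectors CN(0, I_k): all real and
   imaginary parts of all coordinates at all times are mutually independent
   N(0, 1/2) real random variables. *)
Definition cn_iid (R : realType) (d : measure_display) (Omega : measurableType d)
  (P : probability Omega R) (k : nat) (Z : nat -> Omega -> 'cV[R[i]]_k) : Prop :=
  (forall (i : nat) (j : 'I_k) (b : bool),
     measurable_fun setT (fun w => cpart b (Z i w j 0))) /\
  forall (n : nat) (B : 'I_n -> 'I_k -> bool -> set R),
    (forall i j b, measurable (B i j b)) ->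
    P [set w | forall (i : 'I_n) (j : 'I_k) (b : bool),
                 B i j b (cpart b (Z i w j 0))] =
    (\prod_(i < n) \prod_(j < k) \prod_(b : bool)
        fine (normal_prob 0 (Num.sqrt (2^-1)) (B i j b)))%:E.

Definition blk_gen (R : realType) (n k : nat) : set (set ('I_n -> 'cV[R[i]]_k)) :=
  [set A | exists (i : 'I_n) (j : 'I_k) (b : bool) (r : R),
     A = [set y : 'I_n -> 'cV[R[i]]_k | cpart b (y i j 0) < r]].

Definition borel_decoder (R : realType) (n k M : nat)
  (D : ('I_n -> 'cV[R[i]]_k) -> 'I_M) : Prop :=
  forall m : 'I_M, <<s @blk_gen R n k >> (D @^-1` [set m]).

(* covariance matrix of x(t), t uniform over the finite type T *)
Definition mean_vec (R : rcfType) (T : finType) (k : nat) (x : T -> 'cV[R[i]]_k)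
  : 'cV[R[i]]_k :=
  (#|T|%:R)^-1 *: \sum_(t : T) x t.

Definition cov_mx (R : rcfType) (T : finType) (k : nat) (x : T -> 'cV[R[i]]_k)
  : 'M[R[i]]_k :=
  (#|T|%:R)^-1 *: \sum_(t : T) ((x t - mean_vec x) *m ctr (x t - mean_vec x)).

Definition err_prob (R : realType) (d : measure_display) (Omega : measurableType d)
  (P : probability Omega R) (Mp Mc : nat) (n k : nat)
  (Y : 'I_Mp -> 'I_Mc -> Omega -> 'I_n -> 'cV[R[i]]_k)
  (wrong : 'I_Mp -> 'I_Mc -> ('I_n -> 'cV[R[i]]_k) -> bool) : R :=
  ((Mp * Mc)%:R)^-1 *
    \sum_(mp < Mp) \sum_(mc < Mc)
       fine (P [set w | wrong mp mc (Y mp mc w)]).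

Definition achievable (R : realType) (npt nct npr ncr : nat)
  (Hpp : 'M[R[i]]_(npr, npt)) (Hcp : 'M[R[i]]_(npr, nct))
  (Hpc : 'M[R[i]]_(ncr, npt)) (Hcc : 'M[R[i]]_(ncr, nct)) (Pp Pc : R)
  (d : measure_display) (Omega : measurableType d) (P : probability Omega R)
  (Zp : nat -> Omega -> 'cV[R[i]]_npr) (Zc : nat -> Omega -> 'cV[R[i]]_ncr)
  (rp rc : R) : Prop :=
  0 <= rp /\ 0 <= rc /\
  forall eps : R, 0 < eps -> exists N : nat, forall n : nat, (N <= n)%N ->
    exists (Mp Mc : nat)
           (Ep : 'I_Mp -> 'I_n -> 'cV[R[i]]_npt)
           (Ec : 'I_Mp -> 'I_Mc -> 'I_n -> 'cV[R[i]]_nct)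
           (Dp : ('I_n -> 'cV[R[i]]_npr) -> 'I_Mp)
           (Dc : ('I_n -> 'cV[R[i]]_ncr) -> 'I_Mc),
      2 `^ (n%:R * rp) <= Mp%:R /\ 2 `^ (n%:R * rc) <= Mc%:R /\
      \sum_(i < n) complex.Re (\tr (cov_mx (fun mp : 'I_Mp => Ep mp i)))
         <= n%:R * Pp /\
      \sum_(i < n) complex.Re
          (\tr (cov_mx (fun m : 'I_Mp * 'I_Mc => Ec m.1 m.2 i)))
         <= n%:R * Pc /\
      borel_decoder Dp /\ borel_decoder Dc /\
      err_prob P
        (fun mp mc w i => Hpp *m Ep mp i + Hcp *m Ec mp mc i + Zp i w)
        (fun mp _ y => Dp y != mp) <= eps /\
      err_prob P
        (fun mp mc w i => Hpc *m Ep mp i + Hcc *m Ec mp mc i + Zc i w)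
        (fun _ mc y => Dc y != mc) <= eps.

Definition C_MCC (R : realType) (npt nct npr ncr : nat)
  (Hpp : 'M[R[i]]_(npr, npt)) (Hcp : 'M[R[i]]_(npr, nct))
  (Hpc : 'M[R[i]]_(ncr, npt)) (Hcc : 'M[R[i]]_(ncr, nct)) (Pp Pc : R)
  (d : measure_display) (Omega : measurableType d) (P : probability Omega R)
  (Zp : nat -> Omega -> 'cV[R[i]]_npr) (Zc : nat -> Omega -> 'cV[R[i]]_ncr)
  : set (R * R) :=
  [set r | achievable Hpp Hcp Hpc Hcc Pp Pc P Zp Zc r.1 r.2].

(* Main.v *)
Require Import Defs.
From HB Require Import structures.
From mathcomp Require Import all_boot all_order all_algebra.
From mathcomp Require Import all_classical all_reals all_analysis.
From mathcomp Require Import measurable_realfun complex sesquilinear spectral ring lra.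

(** Fix a code and condition on the primary message [u]. Put all codewords on the common scale
    [X = (X_p, sqrt alpha X_c)], so that the primary output is [G X] plus noise and, once [u] is
    known, the cognitive output is the second block of [Kbar X] plus noise. Fano's inequality
    bounds the primary rate by [I_tot - I_c] and the cognitive rate by the information in the
    pair (primary output, cognitive output), with noise correlation [Sigmaz] at no cost: only the
    marginal noise laws matter for the error probabilities. After whitening, the latter equals
    [I_c] plus the information about [X] in [D X] given [G X].

    Let [S] be the time-averaged covariance of [X] and [E] its time-averaged conditional
    estimation error from [G X]. Gaussian maximum entropy gives [I_tot <= n ln|1 + G S G'|] and
    bounds the extra information by [n ln|1 + D E D'|]. In the other direction
    [I_c >= - n ln|1 - G E G'|], by cutting the channel into many weak ones and following the
    decay of the error (the I-MMSE relation). Optimality of the linear estimator gives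
    [E <= (1 - A G) S (1 - A G)' + A A'] for every [A], so the Gaussian covariance
    [Q = E + E G' (1 - G E G')^-1 G E], whose error is exactly [E], satisfies [Q <= S]. As
    [I_c / n] lies between the Gaussian informations of [Q] and [S], the rate pair is dominated
    by a convex combination of the pairs obtained from [(Q_p, Q_c) = (S - Q, Q)] and [(0, S)].

    Gaussian vectors are handled through log-weights on the finite message set, which avoids
    differential entropy: every information quantity is an expected posterior entropy. *)

Set Implicit Arguments.
Unset Strict Implicit.
Unset Printing Implicit Defensive.

Import Order.TTheory GRing.Theory Num.Theory.
Import numFieldNormedType.Exports.

Local Open Scope classical_set_scope.
Local Open Scope ring_scope.

(** * Gaussian measures *)

Section gamma1.
Context {R : realType}.
Local Notation mu := (@lebesgue_measure R).

(** Given the primary message the codeword is not Gaussian, so in general no single covariance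
    matches both its information through [G] and its estimation error. The error [E] serves as the
    anchor: the extra information is bounded from above and [I_c] from below in terms of [E], and
    both bounds are attained by the Gaussian input whose error is [E]. What stays free is the excess
    of [I_c] over that Gaussian value. Each unit of excess takes one unit from the bound on the
    primary rate and adds one to the bound on the cognitive rate, and the segment between the two
    Gaussian pairs trades the rates at least as favourably. This is where the convex hull in the
    region enters. A code of fixed length thus yields a point of the convex hull itself; the closure
    only absorbs the loss in Fano's inequality. Constants: each real component of the noise has
    variance 1/2, with density [expR (- z ^+ 2) / Num.sqrt pi]. Hence the exponent
    [2 * a * z - a ^+ 2] of likelihood ratios and the halves in second moments; the real and
    imaginary parts together restore unit noise. *)

Lemma integral_normal_prob (m s : R) (f : R -> \bar R) :
  measurable_fun setT f -> (forall x, 0 <= f x)%E ->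
  (\int[normal_prob m s]_x f x = \int[mu]_x (f x * (normal_pdf m s x)%:E))%E.
Proof.
move=> mf f0.
have dom := normal_prob_dominates m s.
rewrite -(Radon_Nikodym_SigmaFinite.change_of_variables dom)//.
apply: ae_eq_integral => //.
- apply: emeasurable_funM => //.
  exact: measurable_int (Radon_Nikodym_SigmaFinite.f_integrable _).
- apply: emeasurable_funM => //.
  by apply/measurable_EFinP; exact: measurable_normal_pdf.
- apply: ae_eqe_mul2l; apply: integral_ae_eq => //.
  + exact: Radon_Nikodym_SigmaFinite.f_integrable.
  + by apply/measurable_EFinP; exact: measurable_normal_pdf.
  + by move=> E _ mE; rewrite -Radon_Nikodym_SigmaFinite.f_integral.
Qed.

Lemma lebesgue_measure_translation (a : R) (A : set R) : measurable A ->
  pushforward mu ((fun x => x + a) : _ -> measurableTypeR R) A = mu A.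
Proof.
move=> mA.
have mt : measurable_fun setT ((fun x => x + a) : measurableTypeR R -> measurableTypeR R).
  exact: measurable_funD.
pose tr : {mfun measurableTypeR R >-> measurableTypeR R} :=
  HB.pack (fun x : measurableTypeR R => (x + a : measurableTypeR R)) (isMeasurableFun.Build _ _ _ _ _ mt).
rewrite -[LHS]/(pushforward mu tr A).
apply/esym/lebesgue_measure_unique => //= _ [[u v]] _ <-.
rewrite /pushforward /=.
have -> : (fun x : R => x + a) @^-1` `]u, v]%classic = `]u - a, v - a]%classic.
  apply/seteqP; split => x /=; rewrite !in_itv/= => /andP[h1 h2];
   by apply/andP; split; lra.
rewrite !lebesgue_measure_itv/= !lte_fin ltrD2r.
by case: ifP => // _; rewrite -!EFinD; congr (_%:E); lra.
Qed.

Lemma ge0_integral_translation (a : R) (f : R -> \bar R) :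
  measurable_fun setT f -> (forall x, 0 <= f x)%E ->
  (\int[mu]_x f (x + a)%R = \int[mu]_x f x)%E.
Proof.
move=> mf f0.
have mt : measurable_fun setT ((fun x => x + a) : measurableTypeR R -> measurableTypeR R).
  exact: measurable_funD.
rewrite -[LHS](@ge0_integral_pushforward _ _ _ _ _ _ mt mu setT f)//.
by apply: eq_measure_integral => //= A mA AS; exact: lebesgue_measure_translation.
Qed.

Lemma ge0_integral_opp (f : R -> \bar R) :
  measurable_fun setT f -> (forall x, 0 <= f x)%E ->
  (\int[mu]_x f (- x)%R = \int[mu]_x f x)%E.
Proof.
move=> mf f0.
have mt : measurable_fun setT ((fun x => - x) : measurableTypeR R -> measurableTypeR R).
  exact: measurableT_comp.
rewrite -[LHS](@ge0_integral_pushforward _ _ _ _ _ _ mt mu setT f)//.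
by apply: eq_measure_integral => //= A mA AS; exact: lebesgue_measureN.
Qed.

(* N(0, 1/2), the law of the real part of a CN(0, 1) variable *)
Definition gam : probability (measurableTypeR R) R := normal_prob 0 (Num.sqrt (2^-1)).

Lemma normal_pdf_inv2 (m c x : R) : 0 < c ->
  normal_pdf m (Num.sqrt ((2 * c)^-1)) x =
  Num.sqrt c / Num.sqrt pi * expR (- c * (x - m) ^+ 2).
Proof.
move=> c0; have c2 : 0 < (2 * c)^-1 by rewrite invr_gt0 mulr_gt0.
rewrite normal_pdfE ?gt_eqF ?sqrtr_gt0//.
rewrite /normal_peak /normal_fun sqr_sqrtr ?ltW//; congr (_ * expR _).
  rewrite -invf_div; congr (_^-1).
  rewrite -sqrtrV ?ltW// -[RHS]sqrtrM ?pi_ge0//.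
  by congr (Num.sqrt _); rewrite -mulr_natl; field; rewrite gt_eqF.
by field; rewrite gt_eqF.
Qed.

Lemma gam_pdf (x : R) : normal_pdf 0 (Num.sqrt (2^-1)) x = (Num.sqrt pi)^-1 * expR (- x ^+ 2).
Proof.
by have := @normal_pdf_inv2 0 1 x ltr01; rewrite mulr1 sqrtr1 mul1r subr0 mulN1r.
Qed.

Lemma integral_gam (f : R -> \bar R) :
  measurable_fun setT f -> (forall x, 0 <= f x)%E ->
  (\int[gam]_x f x = \int[mu]_x (f x * ((Num.sqrt pi)^-1 * expR (- x ^+ 2))%:E))%E.
Proof.
move=> mf f0; rewrite /gam integral_normal_prob//.
by apply: eq_integral => x _; rewrite gam_pdf.
Qed.

(** The Cameron-Martin formula on the line. It allows a channel output to be replaced by pure noise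
    weighted with a likelihood ratio. *)
Lemma gam_shift (a : R) (f : R -> \bar R) :
  measurable_fun setT f -> (forall x, 0 <= f x)%E ->
  (\int[gam]_z f (z + a)%R = \int[gam]_z (f z * (expR (2 * a * z - a ^+ 2))%:E))%E.
Proof.
move=> mf f0.
have mE : measurable_fun setT (fun z : R => expR (2 * a * z - a ^+ 2)).
  by apply: measurableT_comp => //; apply: measurable_funB => //; exact: measurable_funM.
have mp : measurable_fun setT (fun z : R => (Num.sqrt pi)^-1 * expR (- z ^+ 2) : R).
  apply: measurable_funM => //; apply: measurableT_comp => //.
  by apply: measurableT_comp => //; exact: measurable_funX.
rewrite !integral_gam//; last 3 first.
- by apply: emeasurable_funM => //; exact/measurable_EFinP.
- by move=> x; rewrite mule_ge0// lee_fin expR_ge0.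
- by apply: measurableT_comp => //; exact: measurable_funD.
rewrite -[RHS](@ge0_integral_translation a (fun z => f z * (expR (2 * a * z - a ^+ 2))%:E *
  ((Num.sqrt pi)^-1 * expR (- z ^+ 2))%:E)%E); last 2 first.
- by apply: emeasurable_funM => //; [apply: emeasurable_funM => //|]; exact/measurable_EFinP.
- by move=> x; rewrite !mule_ge0// lee_fin ?mulr_ge0 ?expR_ge0 ?invr_ge0.
apply: eq_integral => x _; rewrite -muleA -EFinM; congr (_ * _%:E)%E.
by rewrite mulrCA -expRD; congr (_ * expR _); ring.
Qed.

Lemma gam_opp (f : R -> \bar R) :
  measurable_fun setT f -> (forall x, 0 <= f x)%E ->
  (\int[gam]_z f (- z)%R = \int[gam]_z f z)%E.
Proof.
move=> mf f0.
have mp : measurable_fun setT (fun z : R => (Num.sqrt pi)^-1 * expR (- z ^+ 2) : R).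
  apply: measurable_funM => //; apply: measurableT_comp => //.
  by apply: measurableT_comp => //; exact: measurable_funX.
rewrite !integral_gam//; last exact: measurableT_comp.
rewrite -[RHS](@ge0_integral_opp (fun z => f z * ((Num.sqrt pi)^-1 * expR (- z ^+ 2))%:E)%E); last 2 first.
- by apply: emeasurable_funM => //; exact/measurable_EFinP.
- by move=> x; rewrite !mule_ge0// lee_fin ?mulr_ge0 ?expR_ge0 ?invr_ge0.
by apply: eq_integral => x _; rewrite sqrrN.
Qed.

(** The integrand is the density of N(m, 1/(2c)) relative to [gam]. *)
Lemma gam_gauss (c m : R) : 0 < c ->
  (\int[gam]_z (Num.sqrt c * expR (z ^+ 2 - c * (z - m) ^+ 2))%:E = 1)%E.
Proof.
move=> c0.
rewrite integral_gam; last 2 first.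
- apply/measurable_EFinP; apply: measurable_funM => //; apply: measurableT_comp => //.
  apply: measurable_funB => //.
  by apply: measurable_funM => //; apply: measurable_funX; exact: measurable_funB.
- by move=> x; rewrite lee_fin mulr_ge0// expR_ge0.
rewrite -[RHS](integral_normal_pdf m (Num.sqrt ((2 * c)^-1))).
apply: eq_integral => x _; rewrite normal_pdf_inv2// -EFinM; congr (_%:E).
rewrite mulrACA -expRD; congr (_ * expR _); ring.
Qed.

(* Comparing [1 + u <= expR u] with the closed form of [E expR ((1 - r^2) z^2)]
   squeezes the second moment as [r] tends to 1 from either side. *)
Lemma gam_sqr : (\int[gam]_z (z ^+ 2)%:E = (2^-1 : R)%:E)%E.
Proof.
have msq : measurable_fun setT (fun z : R => z ^+ 2) by exact: measurable_funX.
have key (r : R) : 0 < r ->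
    (\int[gam]_z (expR ((1 - r ^+ 2) * z ^+ 2))%:E = (r^-1)%:E)%E.
  move=> r0; have := @gam_gauss (r ^+ 2) 0 (exprn_gt0 _ r0).
  under eq_integral do rewrite EFinM.
  have mE : measurable_fun setT (fun z : R => (expR (z ^+ 2 - r ^+ 2 * (z - 0) ^+ 2))%:E).
    apply/measurable_EFinP; apply: measurableT_comp => //; apply: measurable_funB => //.
    by apply: measurable_funM => //; apply: measurable_funX; exact: measurable_funB.
  rewrite ge0_integralZl//.
  rewrite sqrtr_sqr gtr0_norm// => h.
  rewrite -[RHS]mule1 -h muleA -EFinM mulVf ?gt_eqF// mul1e.
  by apply: eq_integral => z _; rewrite subr0; congr (expR _)%:E; ring.
have M0 : (0 <= \int[gam]_z (z ^+ 2)%:E)%E.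
  by apply: integral_ge0 => z _; rewrite lee_fin sqr_ge0.
have up (r : R) : 0 < r -> r < 1 ->
    (1 + (1 - r ^+ 2)%:E * (\int[gam]_z (z ^+ 2)%:E) <= (r^-1)%:E)%E.
  move=> r0 r1; rewrite -key//.
  have r2 : 0 <= 1 - r ^+ 2 by nra.
  rewrite -ge0_integralZl//; last 2 first.
  - exact/measurable_EFinP.
  - by move=> x _; rewrite lee_fin sqr_ge0.
  have -> : (1 = \int[gam]_z (1 : R)%:E)%E.
    by rewrite integral_cst//= [X in (_ * X)%E]probability_setT mule1.
  rewrite -ge0_integralD//; last 2 first.
  - by move=> x _; rewrite mule_ge0// lee_fin// sqr_ge0.
  - by apply/measurable_EFinP; apply: measurable_funM.
  apply: ge0_le_integral => //.
  - by move=> x _; rewrite adde_ge0// mule_ge0// lee_fin// sqr_ge0.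
  - by apply/measurable_EFinP; apply: measurable_funD => //; apply: measurable_funM.
  - by apply/measurable_EFinP; apply: measurableT_comp => //; apply: measurable_funM.
  - by move=> x _; rewrite lee_fin; exact: expR_ge1Dx.
have Mfin : (\int[gam]_z (z ^+ 2)%:E)%E \is a fin_num.
  rewrite ge0_fin_numE//.
  have := @up (1/2) ltac:(lra) ltac:(lra).
  move: M0; case: (integral _ _ _) => [x| |]//= _.
    by rewrite ltry.
  by rewrite gt0_muley ?lte_fin; [rewrite addey|lra].
have dn (r : R) : 1 < r ->
    (1 <= (r^-1)%:E + (r ^+ 2 - 1)%:E * (\int[gam]_z (z ^+ 2)%:E))%E.
  move=> r1; rewrite -key//; last by lra.
  have r2 : 0 <= r ^+ 2 - 1 by nra.
  have -> : (1 = \int[gam]_z (1 : R)%:E)%E.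
    by rewrite integral_cst//= [X in (_ * X)%E]probability_setT mule1.
  have m1 : measurable_fun [set: R] (fun x : R => (expR ((1 - r ^+ 2) * x ^+ 2))%:E).
    by apply/measurable_EFinP; apply: measurableT_comp => //; apply: measurable_funM.
  rewrite -ge0_integralZl//; last 2 first.
  - exact/measurable_EFinP.
  - by move=> x _; rewrite lee_fin sqr_ge0.
  rewrite -ge0_integralD//; last 2 first.
  - by move=> x _; rewrite mule_ge0// lee_fin// sqr_ge0.
  - by apply/measurable_EFinP; apply: measurable_funM.
  apply: ge0_le_integral => //.
  - by apply: emeasurable_funD => //; apply/measurable_EFinP; apply: measurable_funM.
  - move=> x _; rewrite -EFinM -EFinD lee_fin.
    by have := expR_ge1Dx ((1 - r ^+ 2) * x ^+ 2); lra.
rewrite -(fineK Mfin); move: Mfin up dn; case: (integral _ _ _) => [M| |]//= _ up dn.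
congr (_%:E).
have {}up r : 0 < r -> r < 1 -> r * (r + 1) * M <= 1.
  move=> r0 r1; have := up r r0 r1; rewrite -EFinM -EFinD lee_fin => h.
  have : r * (1 + (1 - r ^+ 2) * M) <= 1.
    by rewrite -ler_pdivlMl// mulr1.
  by move=> h2; rewrite -(@ler_pM2l _ (1 - r)) ?subr_gt0//; lra.
have {}dn r : 1 < r -> 1 <= r * (r + 1) * M.
  move=> r1; have := dn r r1; rewrite -EFinM -EFinD lee_fin => h.
  have r0 : 0 < r by lra.
  have : r * 1 <= r * (r^-1 + (r ^+ 2 - 1) * M) by rewrite ler_pM2l.
  rewrite mulrDr mulfV ?gt_eqF// => h2.
  by rewrite -(@ler_pM2l _ (r - 1)) ?subr_gt0//; lra.
have M0' : 0 <= M by have := dn 2 ltac:(lra); lra.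
(* If [M] exceeds 1/2, this crude bound keeps the step [(M - 2^-1) / 3] used below so small that its
   linear effect beats the higher-order terms. *)
have M1 : M <= 4 / 3 by have := up (2^-1) ltac:(lra) ltac:(lra); lra.
apply/eqP; rewrite eq_le; apply/andP; split; rewrite leNgt; apply/negP => h.
  have := up (1 - (M - 2^-1) / 3) ltac:(lra) ltac:(lra).
  by nra.
have := dn (1 + (2^-1 - M) / 3) ltac:(lra).
by nra.
Qed.

(** Adding the integrals over [z] and [- z] cancels the cross term, so only nonnegative integrands
    occur. *)
Lemma gam_sqrD (c : R) : (\int[gam]_z ((c + z) ^+ 2)%:E = (c ^+ 2 + 2^-1)%:E)%E.
Proof.
have m1 (c' : R) : measurable_fun [set: R] (fun x : R => ((c' + x) ^+ 2)%:E).
  by apply/measurable_EFinP; apply: measurable_funX; exact: measurable_funD.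
have p1 (c' x : R) : (0 <= ((c' + x) ^+ 2)%:E)%E by rewrite lee_fin sqr_ge0.
set I := (LHS).
have I2 : (I + I = (2 * (c ^+ 2 + 2^-1))%:E)%E.
  rewrite /I -{2}gam_opp//.
  rewrite -ge0_integralD//; last 2 first.
  - exact: m1.
  - by apply/measurable_EFinP; apply: measurable_funX; exact: measurable_funB.
  under eq_integral => x _.
    rewrite -EFinD (_ : _ + _ = 2 * c ^+ 2 + 2 * x ^+ 2); last by ring.
    rewrite EFinD; over.
  rewrite ge0_integralD//; last 3 first.
  - by move=> x _; rewrite lee_fin; nra.
  - by move=> x _; rewrite lee_fin; nra.
  - by apply/measurable_EFinP; apply: measurable_funM => //; exact: measurable_funX.
  under [X in (_ + X)%E]eq_integral do rewrite EFinM.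
  rewrite ge0_integralZl//; last 2 first.
  - by apply/measurable_EFinP; exact: measurable_funX.
  - by move=> x _; rewrite lee_fin sqr_ge0.
  rewrite gam_sqr integral_cst//= [X in (_ * X)%E]probability_setT mule1.
  by rewrite -EFinM -EFinD; congr (_%:E); ring.
move: I2; case: I => [x| |]//; rewrite -EFinD => -[]; move=> h; congr (_%:E); lra.
Qed.

End gamma1.

(** * Standard Gaussian vectors indexed by a finite type *)

Section vecspace.
Context {R : realType}.

Definition cylinder (I : finType) : set (set (I -> R)) :=
  [set A | exists i (B : set R), measurable B /\ A = (fun f => f i) @^-1` B].

(** An arbitrary finite index type lets a sum type index a pair of outputs, and lets log-weights on
    messages share the measurable structure of noise vectors. *)
Definition vec (I : finType) := g_sigma_algebraType (@cylinder I).
HB.instance Definition _ (I : finType) := Measurable.on (vec I).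

Lemma measurable_coord (I : finType) (i : I) :
  measurable_fun setT (fun f : vec I => f i : R).
Proof.
move=> _ B mB; rewrite setTI; apply: sub_sigma_algebra; by exists i, B.
Qed.

Lemma measurable_vec d (T : measurableType d) (I : finType) (f : T -> vec I) :
  (forall i, measurable_fun setT (fun x => f x i : R)) -> measurable_fun setT f.
Proof.
move=> mf; apply: (measurability (@cylinder I : set (set (vec I)))) => //.
move=> _ [_ [i [B [mB ->]]] <-].
rewrite setTI -[X in measurable X]setTI; exact: mf.
Qed.

Definition box (I : finType) (B : I -> set R) : set (vec I) :=
  [set f | forall i, B i (f i)].

Lemma measurable_box (I : finType) (B : I -> set R) :
  (forall i, measurable (B i)) -> measurable (box B).
Proof.
move=> mB; have -> : box B = \bigcap_(i in [set: I]) ((fun f : vec I => f i) @^-1` (B i)).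
  by apply/seteqP; split => [f h i _|f h i]; exact: h.
apply: fin_bigcap_measurable => [|i _]; first exact: finite_finset.
by rewrite -[X in measurable X]setTI; exact: measurable_coord.
Qed.

Lemma vec_measure_unique (I : finType) (m1 m2 : probability (vec I) R) :
  (forall B, (forall i, measurable (B i)) -> m1 (box B) = m2 (box B)) ->
  forall A, measurable A -> m1 A = m2 A.
Proof.
move=> h A mA.
pose G : set (set (vec I)) := [set A | exists2 B, (forall i, measurable (B i)) & A = box B].
apply: (measure_unique G (fun=> setT)) => //.
- apply/seteqP; split; last first.
    apply: smallest_sub; first exact: sigma_algebra_measurable.
    by move=> _ [B mB ->]; exact: measurable_box.
  apply: smallest_sub; first exact: smallest_sigma_algebra.
  move=> _ [i [B [mB ->]]]; apply: sub_sigma_algebra.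
  exists (fun j => if j == i then B else setT); first by move=> j; case: ifP.
  apply/seteqP; split => f /= hf; last by have := hf i; rewrite eqxx.
  by move=> j; case: eqP => // ->.
- move=> _ _ [B mB ->] [C mC ->]; exists (fun i => B i `&` C i).
    by move=> i; exact: measurableI.
  by apply/seteqP; split => [f [h1 h2] i|f hf]; split => // i; have [] := hf i.
- move=> _; exists (fun=> setT) => //.
  by apply/seteqP; split.
- by rewrite bigcup_const.
- by move=> _ [B mB ->]; exact: h.
- by move=> _; rewrite [X in (X < _)%E](_ : _ = 1%E) ?ltry//; exact: probability_setT.
Qed.

(** A property of a random vector on any space rather than of a measure on [vec I]: the channel
    noise on its abstract space, joins and reindexings of Gaussian vectors all fit. *)
Definition is_gauss d (T : measurableType d) (P : probability T R) (I : finType)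
    (g : T -> vec I) : Prop :=
  measurable_fun setT g /\ forall B : I -> set R, (forall i, measurable (B i)) ->
    P (g @^-1` box B) = (\prod_(i : I) fine (gam (B i)))%:E.

Lemma gauss_ord_exists (n : nat) :
  exists P : probability (vec 'I_n) R, is_gauss P id.
Proof.
elim: n => [|n [P [_ hP]]].
  exists (\d_(point : vec 'I_0)); split; first exact: measurable_id.
  move=> B mB; rewrite big_ord0 /= diracE mem_set//.
  by case.
pose psi (p : vec 'I_n * measurableTypeR R) : vec 'I_n.+1 :=
  fun i => oapp p.1 p.2 (unlift ord0 i).
have mpsi : measurable_fun setT psi.
  apply: measurable_vec => i; rewrite /psi.
  case: (unlift ord0 i) => [j|] /=; last exact: measurable_snd.
  by apply: (measurableT_comp (measurable_coord j)); exact: measurable_fst.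
pose m : {mfun (vec 'I_n * measurableTypeR R)%type >-> vec 'I_n.+1} :=
  HB.pack psi (isMeasurableFun.Build _ _ _ _ _ mpsi).
exists (distribution (P \x gam)%E m); split; first exact: measurable_id.
move=> B mB; rewrite preimage_id /= /distribution /pushforward.
have -> : m @^-1` box B = box (fun i => B (lift ord0 i)) `*` B ord0.
  apply/seteqP; split => -[f z] /= h.
    split; [move=> i|]; [have := h (lift ord0 i)|have := h ord0];
    by rewrite /psi ?liftK ?unlift_none.
  case: h => h1 h2 i; rewrite /psi/=; case: unliftP => [j ->|->] //=; exact: h1.
rewrite product_measure1E; last 2 first.
- by apply: measurable_box => i; exact: mB.
- exact: mB.
rewrite [X in (X * _)%E](_ : _ = (\prod_i fine (gam (B (lift ord0 i))))%:E); last first.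
  exact: hP.
rewrite big_ord_recl EFinM muleC; congr (_ * _)%E.
exact: (esym (fineK (fin_num_measure gam _ (mB ord0)))).

Qed.

Lemma gauss_exists (I : finType) : exists P : probability (vec I) R, is_gauss P id.
Proof.
have [P [_ hP]] := gauss_ord_exists #|I|.
pose psi (f : vec 'I_#|I|) : vec I := fun i => f (enum_rank i).
have mpsi : measurable_fun setT psi.
  by apply: measurable_vec => i; exact: measurable_coord.
pose m : {mfun vec 'I_#|I| >-> vec I} := HB.pack psi (isMeasurableFun.Build _ _ _ _ _ mpsi).
exists (distribution P m); split; first exact: measurable_id.
move=> B mB; rewrite preimage_id /= /distribution /pushforward.
have -> : m @^-1` box B = box (fun i => B (enum_val i)).
  apply/seteqP; split => f /= h i.
    by have := h (enum_val i); rewrite /psi enum_valK.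
  by have := h (enum_rank i); rewrite enum_rankK.
have := hP (fun i => B (enum_val i)); rewrite preimage_id => -> //.
congr (_%:E); rewrite [RHS](reindex (@enum_val I I))//.
by exists (@enum_rank I) => i _; rewrite ?enum_valK ?enum_rankK.
Qed.

Definition gauss (I : finType) : probability (vec I) R := projT1 (cid (gauss_exists I)).

Lemma gaussP (I : finType) : is_gauss (gauss I) id.
Proof. exact: (projT2 (cid (gauss_exists I))). Qed.

Lemma is_gauss_preimage d (T : measurableType d) (P : probability T R) (I : finType)
    (g : T -> vec I) (A : set (vec I)) :
  is_gauss P g -> measurable A -> P (g @^-1` A) = gauss I A.
Proof.
move=> [mg hg] mA.
pose m : {mfun T >-> vec I} := HB.pack g (isMeasurableFun.Build _ _ _ _ _ mg).
apply: (@vec_measure_unique I (distribution P m)) => // B mB.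
have [_ h] := gaussP I.
by rewrite /= /distribution /pushforward (hg _ mB) -h// preimage_id.
Qed.

Lemma is_gauss_integral d (T : measurableType d) (P : probability T R) (I : finType)
    (g : T -> vec I) (F : vec I -> \bar R) :
  is_gauss P g -> measurable_fun setT F -> (forall x, 0 <= F x)%E ->
  (\int[P]_x F (g x) = \int[gauss I]_x F x)%E.
Proof.
move=> Pg mF F0; have [mg _] := Pg.
rewrite -[LHS](@ge0_integral_pushforward _ _ _ _ _ _ mg P setT F)//.
by apply: eq_measure_integral => A mA _; exact: is_gauss_preimage.
Qed.

End vecspace.

(** * Resampling, shifts and rotations of Gaussian vectors *)

Section gausscalc.
Context {R : realType}.
Local Notation vec := (@vec R).

Definition vjoin (I J : finType) (f : vec I) (h : vec J) : vec (I + J)%type :=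
  fun k => match k with inl i => f i | inr j => h j end.

Definition upd (I : finType) (f : vec I) (k : I) (z : R) : vec I :=
  fun i => if i == k then z else f i.

Lemma measurable_vjoin (I J : finType) :
  measurable_fun setT (fun p : vec I * vec J => vjoin p.1 p.2).
Proof.
apply: measurable_vec => -[i|j] /=.
  by apply: (measurableT_comp (measurable_coord i)); exact: measurable_fst.
by apply: (measurableT_comp (measurable_coord j)); exact: measurable_snd.
Qed.

Lemma measurable_upd (I : finType) (k : I) :
  measurable_fun setT (fun p : vec I * measurableTypeR R => upd p.1 k p.2).
Proof.
apply: measurable_vec => i /=; rewrite /upd; case: eqP => _.
  exact: measurable_snd.
by apply: (measurableT_comp (measurable_coord i)); exact: measurable_fst.
Qed.

Lemma is_gauss_join (I J : finType) :
  is_gauss ((@gauss R I) \x (@gauss R J))%E (fun p : vec I * vec J => vjoin p.1 p.2).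
Proof.
split; first exact: measurable_vjoin.
move=> B mB.
have -> : (fun p : vec I * vec J => vjoin p.1 p.2) @^-1` box B =
   box (fun i => B (inl i)) `*` box (fun j => B (inr j)).
  apply/seteqP; split => -[f h] /= H.
    by split => i; [exact: (H (inl i))|exact: (H (inr i))].
  by case: H => h1 h2 [i|j]; [exact: h1|exact: h2].
apply: (etrans (product_measure1E (gauss I) (gauss J) _ _)).
- by apply: measurable_box => i; exact: mB.
- by apply: measurable_box => i; exact: mB.
rewrite big_sumType/= EFinM; congr (_ * _)%E.
- by apply: (proj2 (gaussP I)) => i; exact: mB.
- by apply: (proj2 (gaussP J)) => i; exact: mB.
Qed.

Lemma is_gauss_upd (I : finType) (k : I) :
  is_gauss ((@gauss R I) \x (@gam R))%E
    (fun p : vec I * measurableTypeR R => upd p.1 k p.2).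
Proof.
split; first exact: measurable_upd.
move=> B mB.
have -> : (fun p : vec I * measurableTypeR R => upd p.1 k p.2) @^-1` box B =
   box (fun i => if i == k then setT else B i) `*` B k.
  apply/seteqP; split => -[f z] /= H.
    split; last by have := H k; rewrite /upd eqxx.
    by move=> i; have := H i; rewrite /upd; case: eqP.
  by case: H => h1 h2 i; have := h1 i; rewrite /upd; case: eqP => [->|].
apply: (etrans (product_measure1E (gauss I) gam _ _)).
- by apply: measurable_box => i; case: ifP => // _; exact: mB.
- exact: mB.
rewrite [X in (X * _)%E](_ : _ =
    (\prod_i fine (gam (if i == k then setT else B i)))%:E); last first.
  by apply: (proj2 (gaussP I)) => i; case: ifP => // _; exact: mB.
rewrite (bigD1 k)//= eqxx probability_setT mul1r [in RHS](bigD1 k)//= EFinM muleC.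
congr (_ * _)%E; first exact: (esym (fineK (fin_num_measure gam _ (mB k)))).
by congr (_%:E); apply: eq_bigr => i /negbTE ->.
Qed.

Lemma gauss_sum (I J : finType) (F : vec (I + J)%type -> \bar R) :
  measurable_fun setT F -> (forall x, 0 <= F x)%E ->
  (\int[gauss (I + J)%type]_x F x = \int[gauss I]_f \int[gauss J]_h F (vjoin f h))%E.
Proof.
move=> mF F0; rewrite -(is_gauss_integral (is_gauss_join I J))//.
have mJ := measurableT_comp mF (@measurable_vjoin I J).
exact: (@fubini_tonelli1 _ _ _ _ _ (gauss I) (gauss J) _ mJ (fun=> F0 _)).
Qed.

(** Replacing one coordinate by fresh noise keeps the law, which permits induction over a list of
    coordinates while the index type stays fixed. *)
Lemma gauss_resample (I : finType) (k : I) (F : vec I -> \bar R) :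
  measurable_fun setT F -> (forall x, 0 <= F x)%E ->
  (\int[gauss I]_x F x = \int[gauss I]_f \int[gam]_z F (upd f k z))%E.
Proof.
move=> mF F0; rewrite -(is_gauss_integral (is_gauss_upd k))//.
have mJ := measurableT_comp mF (measurable_upd k).
exact: (@fubini_tonelli1 _ _ _ _ _ (gauss I) gam _ mJ (fun=> F0 _)).
Qed.

Lemma measurable_updr (I : finType) (f : vec I) (k : I) :
  measurable_fun setT (fun z : R => upd f k z).
Proof.
apply: measurable_vec => i /=; rewrite /upd; case: eqP => _; last exact: measurable_cst.
exact: measurable_id.
Qed.

Definition vaff (I : finType) (s : seq I) (x f : vec I) : vec I :=
  fun i => if i \in s then f i + x i else f i.

Lemma measurable_vaff (I : finType) (s : seq I) (x : vec I) :
  measurable_fun setT (vaff s x).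
Proof.
apply: measurable_vec => i; rewrite /vaff; case: (i \in s); last exact: measurable_coord.
by apply: measurable_funD => //; exact: measurable_coord.
Qed.

Lemma gauss_shift_seq (I : finType) (x : vec I) (s : seq I) (F : vec I -> \bar R) :
  uniq s -> measurable_fun setT F -> (forall x, 0 <= F x)%E ->
  (\int[gauss I]_g F (vaff s x g) =
   \int[gauss I]_g (F g * (expR (\sum_(i <- s) (2 * x i * g i - x i ^+ 2)))%:E))%E.
Proof.
elim: s F => [|k s IH] F.
  move=> _ mF F0; apply: eq_integral => g _; rewrite big_nil expR0 mule1.
  by congr F; apply/funext => i; rewrite /vaff.
move=> /= /andP[ks us] mF F0.
pose F' g := F (vaff s x g).
have mF' : measurable_fun setT F' by exact: measurableT_comp mF (measurable_vaff s x).
pose Lk (z : R) := expR (2 * x k * z - x k ^+ 2).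
have mLk : measurable_fun setT Lk.
  by apply: measurableT_comp => //; apply: measurable_funB => //; exact: measurable_funM.
transitivity (\int[gauss I]_g (F' g * (Lk (g k))%:E))%E.
  pose G (g : vec I) := F' (upd g k (g k + x k)).
  have mG : measurable_fun setT G.
    apply: measurableT_comp mF' _; apply: measurable_vec => i; rewrite /upd.
    case: eqP => _; last exact: measurable_coord.
    by apply: measurable_funD => //; exact: measurable_coord.
  transitivity (\int[gauss I]_g G g)%E.
    apply: eq_integral => g _; rewrite /G /F'; congr F; apply/funext => i.
    rewrite /vaff /upd inE; case: eqP => [->|] //=.
    by rewrite (negbTE ks).
  have mFL : measurable_fun setT (fun g : vec I => (F' g * (Lk (g k))%:E)%E).
    apply: emeasurable_funM => //; apply/measurable_EFinP.
    exact: measurableT_comp mLk (measurable_coord k).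
  rewrite (gauss_resample k mG)//; last by move=> ?; exact: F0.
  rewrite (gauss_resample k mFL); last first.
    by move=> g; rewrite mule_ge0// ?lee_fin ?expR_ge0//; exact: F0.
  apply: eq_integral => g _.
  have := @gam_shift R (x k) (fun z => F' (upd g k z)).
  move=> /(_ (measurableT_comp mF' (measurable_updr g k)) (fun _ => F0 _)) h.
  transitivity (\int[gam]_z F' (upd g k (z + x k)%R))%E.
    apply: eq_integral => z _; rewrite /G; congr F'; apply/funext => i.
    by rewrite /upd; case: eqP => //; rewrite eqxx.
  by rewrite h; apply: eq_integral => z _; rewrite /Lk /upd eqxx.
pose FL (g : vec I) := (F g * (Lk (g k))%:E)%E.
transitivity (\int[gauss I]_g FL (vaff s x g))%E.
  by apply: eq_integral => g _; rewrite /F' /FL {3}/vaff (negbTE ks).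
rewrite (IH _ us); last 2 first.
- apply: emeasurable_funM => //; apply/measurable_EFinP.
  exact: measurableT_comp mLk (measurable_coord k).
- by move=> g; rewrite mule_ge0// lee_fin expR_ge0.
by apply: eq_integral => g _; rewrite /FL -muleA -EFinM /Lk -expRD big_cons.
Qed.

Lemma gauss_shift (I : finType) (x : vec I) (F : vec I -> \bar R) :
  measurable_fun setT F -> (forall x, 0 <= F x)%E ->
  (\int[gauss I]_g F (fun i => g i + x i)%R =
   \int[gauss I]_g (F g * (expR (\sum_i (2 * x i * g i - x i ^+ 2)))%:E))%E.
Proof.
move=> mF F0; rewrite -gauss_shift_seq ?index_enum_uniq//.
apply: eq_integral => g _; congr F; apply/funext => i.
by rewrite /vaff mem_index_enum.
Qed.

Section rotation.
Variable I : finType.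
Local Notation P2 := ((@gauss R I) \x (@gauss R I))%E.

Definition sqn (J : finType) (f : vec J) : R := \sum_j f j ^+ 2.

Let nrm (p : vec I * vec I) : R := sqn p.1 + sqn p.2.

Lemma measurable_sqn (J : finType) : measurable_fun setT (@sqn J).
Proof.
apply: measurable_sum => j.
exact: (measurableT_comp (@exprn_measurable _ setT 2) (measurable_coord j)).
Qed.

Let mnrm : measurable_fun setT nrm.
Proof.
apply: measurable_funD.
  exact: (measurableT_comp (@measurable_sqn I) measurable_fst).
exact: (measurableT_comp (@measurable_sqn I) measurable_snd).
Qed.

(* The Gaussian density is proportional to [expR (- nrm p)]: [phi] preserves Lebesgue measure. *)
Let good (phi : vec I * vec I -> vec I * vec I) :=
  measurable_fun setT phi /\
  forall F : vec I * vec I -> \bar R, measurable_fun setT F -> (forall p, 0 <= F p)%E ->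
  (\int[P2]_p F p = \int[P2]_p (F (phi p) * (expR (nrm p - nrm (phi p)))%:E))%E.

Let good_comp phi psi : good phi -> good psi -> good (phi \o psi).
Proof.
move=> [mphi hphi] [mpsi hpsi]; split; first exact: measurableT_comp.
move=> F mF F0; rewrite (hphi _ mF F0) hpsi; last 2 first.
- apply: emeasurable_funM; first exact: measurableT_comp mF mphi.
  apply/measurable_EFinP; apply: measurableT_comp => //.
  by apply: measurable_funB => //; exact: (measurableT_comp mnrm mphi).
- by move=> p; apply: mule_ge0; [exact: F0|rewrite lee_fin expR_ge0].
apply: eq_integral => p _; rewrite -muleA -EFinM -expRD /=.
by congr (_ * (expR _)%:E)%E; ring.
Qed.

Let shift_cancel (a : vec I) (F : vec I -> \bar R) :
  measurable_fun setT F -> (forall p, 0 <= F p)%E ->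
  (\int[gauss I]_f F f =
   \int[gauss I]_f (F (fun i => f i + a i)%R *
      (expR (sqn f - sqn (fun i => f i + a i)%R))%:E))%E.
Proof.
move=> mF F0.
pose F' (f : vec I) := (F f * (expR (sqn (fun i => f i - a i)%R - sqn f))%:E)%E.
have mF' : measurable_fun setT F'.
  apply: emeasurable_funM => //; apply/measurable_EFinP; apply: measurableT_comp => //.
  apply: measurable_funB; last exact: measurable_sqn.
  apply: (measurableT_comp (@measurable_sqn I)); apply: measurable_vec => i.
  by apply: measurable_funB => //; exact: measurable_coord.
transitivity (\int[gauss I]_f F' (fun i => f i + a i)%R)%E; last first.
  apply: eq_integral => f _; rewrite /F'.
  by have -> : (fun i => f i + a i - a i) = f by apply/funext => i; rewrite addrK.
rewrite (gauss_shift a mF'); last by move=> f; rewrite mule_ge0// lee_fin expR_ge0.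
apply: eq_integral => f _; rewrite /F' -muleA -EFinM -expRD.
rewrite [X in expR X](_ : _ = 0) ?expR0 ?mule1// /sqn.
by rewrite -sumrB -big_split/= big1// => i _; ring.
Qed.

Let swap (p : vec I * vec I) := (p.2, p.1).

Let swap_good phi : good phi -> good (fun p => swap (phi (swap p))).
Proof.
move=> [mphi hphi].
have msw : measurable_fun setT swap.
  by apply: measurable_fun_pair; [exact: measurable_snd|exact: measurable_fst].
have sw (F : vec I * vec I -> \bar R) : measurable_fun setT F -> (forall p, 0 <= F p)%E ->
    (\int[P2]_p F (swap p) = \int[P2]_p F p)%E.
  move=> mF F0.
  have mFs : measurable_fun setT (F \o swap) by exact: measurableT_comp.
  rewrite (@fubini_tonelli1 _ _ _ _ _ (gauss I) (gauss I) _ mFs (fun=> F0 _)).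
  exact: (esym (@fubini_tonelli2 _ _ _ _ _ (gauss I) (gauss I) _ mF F0)).
split; first by apply: measurableT_comp => //; exact: measurableT_comp.
move=> F mF F0.
have mFs := measurableT_comp mF msw.
rewrite -[LHS](sw _ mF F0) (hphi _ mFs (fun=> F0 _)).
rewrite -[LHS]sw; last 2 first.
- apply: emeasurable_funM; first exact: measurableT_comp (measurableT_comp mF msw) mphi.
  apply/measurable_EFinP; apply: measurableT_comp => //.
  by apply: measurable_funB => //; exact: (measurableT_comp mnrm mphi).
- by move=> p; apply: mule_ge0; [exact: F0|rewrite lee_fin expR_ge0].
apply: eq_integral => p _; congr (_ * (expR _)%:E)%E.
by rewrite /nrm /swap /=; congr (_ - _); rewrite addrC.
Qed.

(** With the second component fixed, the shear translates the first one, so Tonelli reduces it to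
    [shift_cancel]; this works for nonlinear [A] as well. *)
Let good_shear1 (A : vec I -> vec I) : measurable_fun setT A ->
  good (fun p => ((fun i => p.1 i + A p.2 i) : vec I, p.2)).
Proof.
move=> mA; set phi := (X in good X).
have mphi : measurable_fun setT phi.
  apply: measurable_fun_pair; last exact: measurable_snd.
  apply: measurable_vec => i; apply: measurable_funD.
    exact: (measurableT_comp (measurable_coord i) measurable_fst).
  exact: (measurableT_comp (measurable_coord i) (measurableT_comp mA measurable_snd)).
split => // F mF F0.
have mG : measurable_fun setT (fun p => F (phi p) * (expR (nrm p - nrm (phi p)))%:E)%E.
  apply: emeasurable_funM; first exact: measurableT_comp mF mphi.
  apply/measurable_EFinP; apply: measurableT_comp => //.
  by apply: measurable_funB => //; exact: (measurableT_comp mnrm mphi).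
have G0 p : (0 <= F (phi p) * (expR (nrm p - nrm (phi p)))%:E)%E.
  by apply: mule_ge0; [exact: F0|rewrite lee_fin expR_ge0].
rewrite (@fubini_tonelli2 _ _ _ _ _ (gauss I) (gauss I) _ mF F0).
rewrite (@fubini_tonelli2 _ _ _ _ _ (gauss I) (gauss I) _ mG G0).
apply: eq_integral => h _; rewrite /fubini_G.
rewrite (shift_cancel (A h)); last 2 first.
- exact: (measurableT_comp mF (measurable_pair2 h)).
- by move=> f.
apply: eq_integral => f _; congr (_ * (expR _)%:E)%E.
by rewrite /nrm/=; ring.
Qed.

Let good_shear2 (A : vec I -> vec I) : measurable_fun setT A ->
  good (fun p => (p.1, (fun i => p.2 i + A p.1 i) : vec I)).
Proof. by move=> mA; exact: swap_good (good_shear1 mA). Qed.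

(* Whitehead's lemma: diag(O, O^-1) is a product of six block shears. *)
Lemma gauss_rotation (O O' : vec I -> vec I) (F : vec I -> \bar R) :
  measurable_fun setT O -> measurable_fun setT O' ->
  (forall f g, O (fun i => f i - g i) = fun i => O f i - O g i) ->
  (forall f g, O' (fun i => f i - g i) = fun i => O' f i - O' g i) ->
  cancel O' O -> cancel O O' -> (forall f, sqn (O f) = sqn f) ->
  measurable_fun setT F -> (forall f, 0 <= F f)%E ->
  (\int[gauss I]_f F (O f) = \int[gauss I]_f F f)%E.
Proof.
move=> mO mO' OB O'B O'K OK On mF F0.
have On' f : sqn (O' f) = sqn f by rewrite -[in RHS](O'K f) On.
have mN (f : vec I -> vec I) : measurable_fun setT f ->
    measurable_fun setT (fun h : vec I => (fun i => - f h i) : vec I).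
  move=> mf; apply: measurable_vec => i; apply: measurableT_comp => //.
  exact: (measurableT_comp (measurable_coord i) mf).
pose S1 (p : vec I * vec I) : vec I * vec I := (fun i => p.1 i - p.2 i, p.2).
pose S2 (p : vec I * vec I) : vec I * vec I := (p.1, fun i => p.2 i + p.1 i).
pose S4 (p : vec I * vec I) : vec I * vec I := (fun i => p.1 i + O p.2 i, p.2).
pose S5 (p : vec I * vec I) : vec I * vec I := (p.1, fun i => p.2 i - O' p.1 i).
have s1 : good S1 := good_shear1 (mN _ (@measurable_id _ _ setT)).
have s2 : good S2 := good_shear2 (@measurable_id _ (vec I) setT).
have s4 : good S4 := good_shear1 mO.
have s5 : good S5 := good_shear2 (mN _ mO').
(* The inner triple [S1], [S2], [S1] is the quarter turn sending [(f, h)] to [(- h, f)]; the outer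
   triple [S4], [S5], [S4] sends this to [(O f, O' h)]. *)
have [mphi hphi] := good_comp s4 (good_comp s5 (good_comp s4 (good_comp s1 (good_comp s2 s1)))).
have phiE p : (S4 \o (S5 \o (S4 \o (S1 \o (S2 \o S1))))) p = (O p.1, O' p.2).
  case: p => f h.
  have t2 : S2 (S1 (f, h)) = (fun i => f i - h i, f).
    by congr pair; apply/funext => i /=; ring.
  have t3 : S1 (fun i => f i - h i, f) = (fun i => - h i, f).
    by congr pair; apply/funext => i /=; ring.
  have t4 : S4 (fun i => - h i, f) = (fun i => O f i - h i, f).
    by congr pair; apply/funext => i /=; ring.
  have t5 : S5 (fun i => O f i - h i, f) = (fun i => O f i - h i, O' h).
    by congr pair; apply/funext => i /=; rewrite O'B OK; ring.
  have t6 : S4 (fun i => O f i - h i, O' h) = (O f, O' h).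
    by congr pair; apply/funext => i /=; rewrite O'K; ring.
  by rewrite /comp t2 t3 t4 t5 t6.
have mF1 : measurable_fun setT (fun p : vec I * vec I => F p.1).
  exact: measurableT_comp mF measurable_fst.
have fst_int (G : vec I -> \bar R) : measurable_fun setT G -> (forall f, 0 <= G f)%E ->
    (\int[P2]_p G p.1 = \int[gauss I]_f G f)%E.
  move=> mG G0.
  have mG1 : measurable_fun setT (fun p : vec I * vec I => G p.1).
    exact: measurableT_comp mG measurable_fst.
  rewrite (@fubini_tonelli1 _ _ _ _ _ (gauss I) (gauss I) _ mG1 (fun=> G0 _)).
  apply: eq_integral => f _.
  rewrite -[LHS]/(\int[gauss I]_y (cst (G f) y))%E integral_cst//=.
  by rewrite probability_setT mule1.
rewrite -(fst_int (F \o O) (measurableT_comp mF mO) (fun=> F0 _)).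
rewrite -(fst_int _ mF F0) (hphi _ mF1 (fun=> F0 _)); apply: eq_integral => p _.
by rewrite phiE /nrm /= On On' subrr expR0 mule1.
Qed.

End rotation.

End gausscalc.

(** * Expectations under Gaussian noise and likelihood ratios *)

Section expectation.
Context {R : realType}.
Local Notation vec := (@vec R).
Implicit Types I : finType.

Definition Ex I (F : vec I -> R) : R := \int[gauss I]_g F g.
Definition gintegrable I (F : vec I -> R) : Prop := (gauss I).-integrable setT (EFin \o F).
(** Bundling integrability with the value lets linear combinations be evaluated without separate
    integrability conditions. *)
Definition hasE I (F : vec I -> R) (c : R) : Prop := gintegrable F /\ Ex F = c.

Lemma ExE I (F : vec I -> R) : gintegrable F -> (\int[gauss I]_g (F g)%:E = (Ex F)%:E)%E.
Proof. by move=> h; rewrite /Ex /Rintegral fineK//; exact: integrable_fin_num. Qed.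

Lemma hasE_ext I (F G : vec I -> R) c : F =1 G -> hasE F c -> hasE G c.
Proof. by move=> /funext ->. Qed.

Lemma hasE_ge0 I (F : vec I -> R) c : measurable_fun setT F -> (forall g, 0 <= F g) ->
  (\int[gauss I]_g (F g)%:E = c%:E)%E -> hasE F c.
Proof.
move=> mF F0 h; split; last by rewrite /Ex /Rintegral h.
apply/integrableP; split; first exact/measurable_EFinP.
under eq_integral => x _ do rewrite /= ger0_norm//.
by rewrite h ltry.
Qed.

Lemma hasED I (F G : vec I -> R) a b : hasE F a -> hasE G b ->
  hasE (fun g => F g + G g) (a + b).
Proof.
move=> [h1 e1] [h2 e2]; split; last by rewrite /Ex RintegralD// -/(Ex F) -/(Ex G) e1 e2.
by have := @integrableD _ _ _ _ _ measurableT _ _ h1 h2.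
Qed.

Lemma hasEZ I (F : vec I -> R) a k : hasE F a -> hasE (fun g => k * F g) (k * a).
Proof.
move=> [h1 e1]; split; last by rewrite /Ex RintegralZl// -/(Ex F) e1.
by have := @integrableZl _ _ _ _ _ measurableT k _ h1.
Qed.

Lemma hasE_cst I (k : R) : hasE (fun _ : vec I => k) k.
Proof.
split; last by rewrite /Ex Rintegral_cst//= probability_setT mulr1.
exact: finite_measure_integrable_cst.
Qed.

Lemma hasE_sum I (J : Type) (s : seq J) (F : J -> vec I -> R) (a : J -> R) :
  (forall j, hasE (F j) (a j)) ->
  hasE (fun g => \sum_(j <- s) F j g) (\sum_(j <- s) a j).
Proof.
move=> h; elim: s => [|j s IH].
  by rewrite big_nil; apply: hasE_ext (hasE_cst I 0) => g; rewrite big_nil.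
rewrite big_cons; apply: hasE_ext (hasED (h j) IH) => g; by rewrite big_cons.
Qed.

Lemma hasE_le I (F G : vec I -> R) a b : hasE F a -> hasE G b ->
  (forall g, F g <= G g) -> a <= b.
Proof. by move=> [h1 <-] [h2 <-] le; apply: le_Rintegral. Qed.

Lemma hasE_Ex I (F : vec I -> R) : gintegrable F -> hasE F (Ex F).
Proof. by []. Qed.

Lemma gintegrable_dom I (F G : vec I -> R) : measurable_fun setT F -> gintegrable G ->
  (forall g, `|F g| <= G g) -> gintegrable F.
Proof.
move=> mF iG le; apply: (@le_integrable _ _ _ _ _ measurableT _ (EFin \o G)) => //.
- exact/measurable_EFinP.
- move=> g _ /=; rewrite lee_fin; apply: le_trans (le g) _; exact: ler_norm.
Qed.

(* log-likelihood ratio of N(x, I/2) against N(0, I/2) *)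
Definition llr I (x g : vec I) : R := \sum_i (2 * x i * g i - x i ^+ 2).

Lemma measurable_llr I (x : vec I) : measurable_fun setT (llr x).
Proof.
apply: measurable_sum => i; apply: measurable_funB => //.
by apply: measurable_funM => //; exact: measurable_coord.
Qed.

Lemma measurable_lin I (s : seq I) (a : R) (k : vec I) :
  measurable_fun setT (fun g : vec I => a + \sum_(i <- s) k i * g i).
Proof.
apply: measurable_funD => //; apply: measurable_sum => i.
by apply: measurable_funM => //; exact: measurable_coord.
Qed.

Lemma gauss_lin_sqr_seq I (s : seq I) (a : R) (k : vec I) : uniq s ->
  (\int[gauss I]_g ((a + \sum_(i <- s) k i * g i) ^+ 2)%:E =
   (a ^+ 2 + \sum_(i <- s) k i ^+ 2 / 2)%:E)%E.
Proof.
have mq s' (c : R) : measurable_fun setT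
    (fun g : vec I => ((c + \sum_(i <- s') k i * g i) ^+ 2)%:E).
  by apply/measurable_EFinP; apply: measurable_funX; exact: measurable_lin.
elim: s => [|j s IH] /=.
  move=> _; under eq_integral do rewrite big_nil addr0.
  by rewrite big_nil addr0 integral_cst//= probability_setT mule1.
move=> /andP[js us].
rewrite (gauss_resample j (mq (j :: s) a)); last by move=> g; rewrite lee_fin sqr_ge0.
transitivity (\int[gauss I]_g (((a + \sum_(i <- s) k i * g i) ^+ 2)%:E
    + (k j ^+ 2 / 2)%:E))%E.
  apply: eq_integral => g _.
  set c := a + \sum_(i <- s) k i * g i.
  have e z : a + \sum_(i <- (j :: s)) k i * upd g j z i = c + k j * z.
    rewrite big_cons /upd eqxx /c [RHS]addrC addrCA; congr (_ + (_ + _)).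
    apply: eq_big_seq => i is_; case: eqP => // ij; by rewrite -ij is_ in js.
  under eq_integral do rewrite e.
  have [k0|k0] := eqVneq (k j) 0.
    rewrite k0; under eq_integral do rewrite mul0r addr0.
    by rewrite integral_cst//= probability_setT mule1 expr0n/= mul0r addr0.
  have := gam_sqrD (c / k j).
  have -> : (\int[gam]_z ((c + k j * z) ^+ 2)%:E =
     \int[gam]_z ((k j ^+ 2)%:E * ((c / k j + z) ^+ 2)%:E))%E.
    by apply: eq_integral => z _; rewrite -EFinM; congr (_%:E); field.
  move=> h; rewrite ge0_integralZl ?h//=.
  - by rewrite -EFinM -EFinD; congr (_%:E); field.
  - by apply/measurable_EFinP; apply: measurable_funX; exact: measurable_funD.
  - by move=> z _; rewrite lee_fin sqr_ge0.
  - by rewrite lee_fin sqr_ge0.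
rewrite ge0_integralD//; last 2 first.
- by move=> g _; rewrite lee_fin sqr_ge0.
- by move=> g _; rewrite lee_fin divr_ge0 ?sqr_ge0.
rewrite IH// integral_cst//= probability_setT mule1 -EFinD big_cons.
by congr (_%:E); ring.
Qed.

(** The likelihood ratio turns the pure noise [g] into [x] plus noise; the last sum is the variance
    of the linear form, 1/2 per real coordinate. *)
Lemma hasE_Lsqr I (x : vec I) (a : R) (k : vec I) :
  hasE (fun g => expR (llr x g) * (a + \sum_i k i * g i) ^+ 2)
       ((a + \sum_i k i * x i) ^+ 2 + \sum_i k i ^+ 2 / 2).
Proof.
have mq (c : R) : measurable_fun setT
    (fun g : vec I => ((c + \sum_i k i * g i) ^+ 2)%:E).
  by apply/measurable_EFinP; apply: measurable_funX; exact: measurable_lin.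
apply: hasE_ge0.
- apply: measurable_funM; last by apply: measurable_funX; exact: measurable_lin.
  by apply: measurableT_comp => //; exact: measurable_llr.
- by move=> g; rewrite mulr_ge0 ?expR_ge0 ?sqr_ge0.
have := gauss_shift x (mq a) (fun g => eq_ind_r is_true (sqr_ge0 _) (lee_fin _ _)).
under [X in _ = X -> _]eq_integral do rewrite -EFinM mulrC.
move=> <-; rewrite -gauss_lin_sqr_seq ?index_enum_uniq//.
apply: eq_integral => g _; congr ((_ ^+ 2)%:E).
rewrite -addrA -big_split/=; congr (_ + _); apply: eq_bigr => i _; ring.
Qed.

Lemma hasE_L I (x : vec I) : hasE (fun g => expR (llr x g)) 1.
Proof.
have := hasE_Lsqr x 1 (fun=> 0).
rewrite [X in hasE _ X -> _](_ : _ = 1); last first.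
  by rewrite big1 ?big1 ?addr0 ?expr1n// => i _; rewrite ?mul0r// expr0n mul0r.
by apply: hasE_ext => g; rewrite big1 ?addr0 ?expr1n ?mulr1// => i _; rewrite mul0r.
Qed.

(** Polarisation, [4 t = (t + 1)^2 - (t - 1)^2], derives the signed integrand from two squares,
    whose noise variances cancel. *)
Lemma hasE_Llin I (x : vec I) (a : R) (k : vec I) :
  hasE (fun g => expR (llr x g) * (a + \sum_i k i * g i)) (a + \sum_i k i * x i).
Proof.
have := hasED (hasEZ (4^-1) (hasE_Lsqr x (a + 1) k)) (hasEZ (-4^-1) (hasE_Lsqr x (a - 1) k)).
rewrite [X in hasE _ X -> _](_ : _ = a + \sum_i k i * x i); last by field.
by apply: hasE_ext => g; field.
Qed.

Lemma hasE_exp I (x : vec I) : hasE (fun g => expR (2 * \sum_i x i * g i)) (expR (sqn x)).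
Proof.
have := hasEZ (expR (sqn x)) (hasE_L x); rewrite mulr1.
apply: hasE_ext => g; rewrite -expRD; congr expR.
rewrite /sqn /llr -big_split/= mulr_sumr; apply: eq_bigr => i _; ring.
Qed.

(* density, relative to the Gaussian measure, of independent coordinates N(m_i, 1/(2 c_i)) *)
Lemma hasE_gauss I (c m : vec I) : (forall i, 0 < c i) ->
  hasE (fun g => \prod_i (Num.sqrt (c i) * expR (g i ^+ 2 - c i * (g i - m i) ^+ 2))) 1.
Proof.
move=> c0.
pose q i (z : R) := Num.sqrt (c i) * expR (z ^+ 2 - c i * (z - m i) ^+ 2).
have mq i : measurable_fun setT (q i).
  apply: measurable_funM => //; apply: measurableT_comp => //.
  apply: measurable_funB => //; apply: measurable_funM => //.
  by apply: measurable_funX; exact: measurable_funB.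
have q0 i z : 0 <= q i z by rewrite mulr_ge0 ?expR_ge0.
have mp (s : seq I) : measurable_fun setT (fun g : vec I => \prod_(i <- s) q i (g i)).
  by apply: measurable_prod => i _; exact: (measurableT_comp (mq i) (measurable_coord i)).
apply: hasE_ge0 => [|g|].
- exact: mp.
- by apply: prodr_ge0 => i _; exact: q0.
have : uniq (index_enum I) by rewrite index_enum_uniq.
elim: (index_enum I) => [_|j s IH /= /andP[js us]].
  by under eq_integral do rewrite big_nil; rewrite integral_cst//= probability_setT mule1.
rewrite (gauss_resample j); last 2 first.
- apply/measurable_EFinP; exact: (mp (j :: s)).
- by move=> g; rewrite lee_fin; apply: prodr_ge0 => i _; exact: q0.
rewrite -(IH us); apply: eq_integral => g _.
transitivity (\int[gam]_z ((\prod_(i <- s) q i (g i))%:E * (q j z)%:E))%E.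
  apply: eq_integral => z _; rewrite -EFinM; congr (_%:E).
  rewrite big_cons /upd eqxx mulrC; congr (_ * _).
  apply: eq_big_seq => i is_; case: eqP => // ij; by rewrite -ij is_ in js.
have p0 : (0 <= (\prod_(i <- s) q i (g i))%:E)%E.
  by rewrite lee_fin; apply: prodr_ge0 => i _; exact: q0.
have mqj : measurable_fun setT (fun z : measurableTypeR R => (q j z)%:E).
  by apply/measurable_EFinP; exact: mq.
have qj0 (z : R) : [set: R] z -> (0 <= (q j z)%:E)%E by move=> _; rewrite lee_fin q0.
by rewrite (ge0_integralZl _ measurableT mqj qj0 p0) gam_gauss// mule1.
Qed.

End expectation.

(** * Posterior weights and the Gaussian channel *)

Section channel.
Context {R : realType}.
Local Notation vec := (@vec R).
Implicit Types I J T : finType.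

(* A vector [b] of log-weights on a finite set of messages encodes the unnormalised
   posterior [expR \o b]; [entr] and [pcov] are the entropy and the covariance of the
   normalised posterior, multiplied by [mass b]. *)
Definition mass T (b : vec T) : R := \sum_t expR (b t).

Definition entr T (b : vec T) : R := \sum_t expR (b t) * (ln (mass b) - b t).

Definition pcov T (u v : T -> R) (b : vec T) : R :=
  \sum_t expR (b t) * (u t * v t)
  - (\sum_t expR (b t) * u t) * (\sum_t expR (b t) * v t) / mass b.

(* Bayes update on receiving [g] when message [t] is sent as [x t]. [Op] averages over
   pure noise [g]: the weights already carry the likelihood ratios, so this is the
   expectation over the true channel output. *)
Definition obs T I (x : T -> vec I) (b : vec T) (g : vec I) : vec T :=
  fun t => b t + llr (x t) g.

Definition Op T I (x : T -> vec I) (Phi : vec T -> R) (b : vec T) : R :=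
  Ex (fun g => Phi (obs x b g)).

(* [Op x] preserves [mass], hence this bound is stable under [Op]. *)
Definition tame T (Phi : vec T -> R) : Prop :=
  measurable_fun setT Phi /\ exists C, forall b, `|Phi b| <= C * mass b.

(** Nonnegativity makes Tonelli available, which gives the measurability of [Op x Phi] and the
    exchange of two observations. *)
Definition ntame T (Phi : vec T -> R) : Prop := tame Phi /\ forall b, 0 <= Phi b.

Lemma mass_ge0 T (b : vec T) : 0 <= mass b.
Proof. by apply: sumr_ge0 => t _; exact: expR_ge0. Qed.

Lemma mass_gt0 T (t0 : T) (b : vec T) : 0 < mass b.
Proof.
rewrite /mass (bigD1 t0)//= ltr_pwDl ?expR_gt0//.
by apply: sumr_ge0 => t _; exact: expR_ge0.
Qed.

Lemma expR_le_mass T (b : vec T) t : expR (b t) <= mass b.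
Proof. by rewrite /mass (bigD1 t)//= lerDl; apply: sumr_ge0 => s _; exact: expR_ge0. Qed.

Lemma measurable_expcoord T (t : T) : measurable_fun setT (fun b : vec T => expR (b t)).
Proof. by apply: measurableT_comp => //; exact: measurable_coord. Qed.

Lemma measurable_wsum T (c : T -> R) :
  measurable_fun setT (fun b : vec T => \sum_t expR (b t) * c t).
Proof.
by apply: measurable_sum => t; apply: measurable_funM => //; exact: measurable_expcoord.
Qed.

Lemma measurable_mass T : measurable_fun setT (@mass T).
Proof. by apply: measurable_sum => t; exact: measurable_expcoord. Qed.

Lemma measurable_invmass T : measurable_fun setT (fun b : vec T => (mass b)^-1).
Proof.
case: (pickP (@predT T)) => [t0 _|T0]; last first.
  have -> : (fun b : vec T => (mass b)^-1) = (fun=> 0).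
    by apply/funext => b; rewrite /mass big_pred0 ?invr0// => t; have := T0 t.
  exact: measurable_cst.
have -> : (fun b : vec T => (mass b)^-1) = (fun b => expR (- ln (mass b))).
  by apply/funext => b; rewrite expRN lnK// posrE (mass_gt0 t0).
apply: measurableT_comp => //; apply: measurableT_comp => //.
by apply: measurableT_comp => //; exact: measurable_mass.
Qed.

Lemma measurable_entr T : measurable_fun setT (@entr T).
Proof.
apply: measurable_sum => t; apply: measurable_funM; first exact: measurable_expcoord.
apply: measurable_funB; last exact: measurable_coord.
by apply: measurableT_comp => //; exact: measurable_mass.
Qed.

Lemma measurable_pcov T (u v : T -> R) : measurable_fun setT (pcov u v).
Proof.
apply: measurable_funB; first exact: measurable_wsum.
apply: measurable_funM; last exact: measurable_invmass.
by apply: measurable_funM; exact: measurable_wsum.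
Qed.

Lemma ln_le_sub1 (y : R) : 0 < y -> ln y <= y - 1.
Proof.
move=> y0; have := le_ln1Dx (x := y - 1).
by rewrite addrCA subrr addr0; apply; lra.
Qed.

(** Gibbs' inequality, from [ln y <= y - 1] at [y = mass b * q t / expR (b t)]. The choice of [q]
    decides the use: the uniform law bounds the entropy by the message count, the prior shows that
    observing reduces entropy, and a mixture with a point mass gives Fano's inequality. *)
Lemma entr_gibbs T (q : T -> R) (b : vec T) :
  (forall t, 0 < q t) -> \sum_t q t <= 1 ->
  entr b <= \sum_t expR (b t) * - ln (q t).
Proof.
move=> q0 q1.
case: (pickP (@predT T)) => [t0 _|T0]; last first.
  by rewrite /entr !big_pred0// => t; have := T0 t.
have S0 := mass_gt0 t0 b.
rewrite -subr_ge0 /entr -sumrB.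
suff h t : expR (b t) - mass b * q t <= expR (b t) * - ln (q t) - expR (b t) * (ln (mass b) - b t).
  apply: le_trans (ler_sum _ (fun t _ => h t)).
  rewrite sumrB -/(mass b) -mulr_sumr subr_ge0.
  by rewrite -[leRHS]mulr1 ler_wpM2l// ltW.
have e0 := expR_gt0 (b t).
have y0 : 0 < mass b * q t / expR (b t) by rewrite divr_gt0// mulr_gt0.
have := ln_le_sub1 y0.
rewrite ln_div ?posrE ?mulr_gt0// lnM ?posrE// expRK => h.
have : expR (b t) * (ln (mass b) + ln (q t) - b t) <= expR (b t) * (mass b * q t / expR (b t) - 1).
  by rewrite ler_pM2l.
have -> : expR (b t) * (mass b * q t / expR (b t) - 1) = mass b * q t - expR (b t).
  by field; rewrite gt_eqF.
by move=> h'; rewrite -subr_ge0; move: h'; rewrite -subr_ge0 => h'; apply: le_trans h' _; lra.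
Qed.

Lemma entr_ge0 T (b : vec T) : 0 <= entr b.
Proof.
apply: sumr_ge0 => t _; rewrite mulr_ge0 ?expR_ge0// subr_ge0.
by rewrite -[leLHS]expRK ler_ln ?posrE ?expR_gt0 ?(mass_gt0 t)// expR_le_mass.
Qed.

Lemma entr_le T (b : vec T) : entr b <= ln #|T|%:R * mass b.
Proof.
case: (pickP (@predT T)) => [t0 _|T0]; last first.
  by rewrite /entr /mass !big_pred0 ?mulr0// => t; have := T0 t.
have n0 : 0 < #|T|%:R :> R by rewrite ltr0n; apply/card_gt0P; exists t0.
apply: le_trans (@entr_gibbs T (fun=> #|T|%:R^-1) b _ _) _.
- by move=> t; rewrite invr_gt0.
- by rewrite sumr_const -[X in X <= _]mulr_natr mulVf// gt_eqF.
- by rewrite -mulr_suml lnV ?posrE// opprK mulrC.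
Qed.

Lemma entr_ntame T : ntame (@entr T).
Proof.
split; last exact: entr_ge0.
split; first exact: measurable_entr.
by exists (ln #|T|%:R) => b; rewrite ger0_norm ?entr_ge0// entr_le.
Qed.

Lemma wsum_le T (c : T -> R) (b : vec T) :
  `|\sum_t expR (b t) * c t| <= (\sum_t `|c t|) * mass b.
Proof.
apply: le_trans (ler_norm_sum _ _ _) _.
rewrite mulr_suml; apply: ler_sum => t _.
by rewrite normrM (ger0_norm (expR_ge0 _)) mulrC ler_wpM2l// expR_le_mass.
Qed.

Lemma pcov_tame T (u v : T -> R) : tame (pcov u v).
Proof.
split; first exact: measurable_pcov.
exists (\sum_t `|u t * v t| + (\sum_t `|u t|) * (\sum_t `|v t|)) => b.
case: (pickP (@predT T)) => [t0 _|T0]; last first.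
  by rewrite /pcov /mass !big_pred0 ?mulr0 ?mul0r ?subrr ?normr0 ?mulr0// => t; have := T0 t.
have S0 := mass_gt0 t0 b.
apply: le_trans (ler_normB _ _) _; rewrite mulrDl; apply: lerD; first exact: wsum_le.
rewrite !normrM normfV (gtr0_norm S0) ler_pdivrMr// -mulrA mulrACA.
apply: le_trans (ler_pM _ _ (wsum_le u b) (wsum_le v b)) _ => //.
Qed.

Definition wmean T (v : T -> R) (b : vec T) : R := (\sum_t expR (b t) * v t) / mass b.

Lemma pcov_sqrE T (t0 : T) (v : T -> R) (b : vec T) (c : R) :
  \sum_t expR (b t) * (v t - c) ^+ 2 = pcov v v b + mass b * (wmean v b - c) ^+ 2.
Proof.
have S0 := mass_gt0 t0 b.
transitivity (\sum_t expR (b t) * (v t * v t) - 2 * c * (\sum_t expR (b t) * v t) + c ^+ 2 * mass b).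
  rewrite /mass !mulr_sumr -sumrB -big_split/=; apply: eq_bigr => t _; ring.
rewrite /pcov /wmean; field; by rewrite gt_eqF.
Qed.

Lemma pvar_ge0 T (v : T -> R) (b : vec T) : 0 <= pcov v v b.
Proof.
case: (pickP (@predT T)) => [t0 _|T0]; last first.
  by rewrite /pcov !big_pred0 ?mul0r ?subrr// => t; have := T0 t.
have := @pcov_sqrE T t0 v b (wmean v b); rewrite subrr expr0n mulr0 addr0 => <-.
by apply: sumr_ge0 => t _; rewrite mulr_ge0 ?expR_ge0 ?sqr_ge0.
Qed.

Lemma pvar_le T (v : T -> R) (b : vec T) (c : R) :
  pcov v v b <= \sum_t expR (b t) * (v t - c) ^+ 2.
Proof.
case: (pickP (@predT T)) => [t0 _|T0]; last first.
  by rewrite /pcov !big_pred0 ?mul0r ?subrr// => t; have := T0 t.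
by rewrite (@pcov_sqrE T t0) lerDl mulr_ge0 ?mass_ge0 ?sqr_ge0.
Qed.

Lemma pvar_ntame T (v : T -> R) : ntame (pcov v v).
Proof. by split; [exact: pcov_tame|exact: pvar_ge0]. Qed.

Lemma mass_ntame T : ntame (@mass T).
Proof.
split; last exact: mass_ge0.
split; first exact: measurable_mass.
by exists 1 => b; rewrite mul1r ger0_norm ?mass_ge0.
Qed.

Lemma tameD T (Phi Psi : vec T -> R) : tame Phi -> tame Psi -> tame (fun b => Phi b + Psi b).
Proof.
move=> [m1 [C1 h1]] [m2 [C2 h2]]; split; first exact: measurable_funD.
exists (C1 + C2) => b; rewrite mulrDl; apply: le_trans (ler_normD _ _) _.
by apply: lerD.
Qed.

Lemma tameZ T (Phi : vec T -> R) k : tame Phi -> tame (fun b => k * Phi b).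
Proof.
move=> [m1 [C1 h1]]; split; first exact: measurable_funM.
by exists (`|k| * C1) => b; rewrite normrM -mulrA ler_wpM2l.
Qed.

Lemma tame_sum T (K : finType) (Phi : K -> vec T -> R) : (forall k, tame (Phi k)) ->
  tame (fun b => \sum_k Phi k b).
Proof.
move=> h; split; first by apply: measurable_sum => k; case: (h k).
exists (\sum_k projT1 (cid (h k).2)) => b; rewrite mulr_suml.
apply: le_trans (ler_norm_sum _ _ _) _; apply: ler_sum => k _.
exact: (projT2 (cid (h k).2)).
Qed.

Section op.
Variables (T I : finType) (x : T -> vec I).

Lemma measurable_obs2 : measurable_fun setT (fun p : vec T * vec I => obs x p.1 p.2).
Proof.
apply: measurable_vec => t; apply: measurable_funD.
  exact: (measurableT_comp (measurable_coord t) measurable_fst).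
exact: (measurableT_comp (measurable_llr (x t)) measurable_snd).
Qed.

Lemma measurable_obs b : measurable_fun setT (obs x b).
Proof.
by apply: measurable_vec => t; apply: measurable_funD => //; exact: measurable_llr.
Qed.

Lemma hasE_wexp (c : T -> R) b :
  hasE (fun g => \sum_t expR (obs x b g t) * c t) (\sum_t expR (b t) * c t).
Proof.
have h t : hasE (fun g => expR (obs x b g t) * c t) (expR (b t) * c t).
  have := hasEZ (expR (b t) * c t) (hasE_L (x t)); rewrite mulr1.
  by apply: hasE_ext => g; rewrite /obs expRD mulrAC.
exact: (hasE_sum (index_enum T) h).
Qed.

Lemma hasE_mass b : hasE (fun g => mass (obs x b g)) (mass b).
Proof.
have := hasE_wexp (fun=> 1) b.
under [X in hasE _ X -> _]eq_bigr do rewrite mulr1.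
by apply: hasE_ext => g; apply: eq_bigr => t _; rewrite mulr1.
Qed.

Lemma tame_hasE Phi b : tame Phi -> hasE (fun g => Phi (obs x b g)) (Op x Phi b).
Proof.
move=> [mP [C hC]]; apply: hasE_Ex.
apply: (gintegrable_dom _ (hasEZ C (hasE_mass b)).1) => //.
exact: measurableT_comp mP (measurable_obs b).
Qed.

Lemma Op_mass b : Op x (@mass T) b = mass b.
Proof. exact: (hasE_mass b).2. Qed.

Lemma OpD Phi Psi b : tame Phi -> tame Psi ->
  Op x (fun b => Phi b + Psi b) b = Op x Phi b + Op x Psi b.
Proof. by move=> h1 h2; exact: (hasED (tame_hasE b h1) (tame_hasE b h2)).2. Qed.

Lemma OpZ k Phi b : tame Phi -> Op x (fun b => k * Phi b) b = k * Op x Phi b.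
Proof. by move=> h1; exact: (hasEZ k (tame_hasE b h1)).2. Qed.

Lemma Op_sum (K : finType) (Phi : K -> vec T -> R) b : (forall k, tame (Phi k)) ->
  Op x (fun b => \sum_k Phi k b) b = \sum_k Op x (Phi k) b.
Proof. by move=> h; exact: (hasE_sum (index_enum K) (fun k => tame_hasE b (h k))).2. Qed.

Lemma Op_le Phi Psi b : tame Phi -> tame Psi -> (forall b, Phi b <= Psi b) ->
  Op x Phi b <= Op x Psi b.
Proof. by move=> h1 h2 le; exact: (hasE_le (tame_hasE b h1) (tame_hasE b h2)). Qed.

Lemma OpE Phi b : tame Phi ->
  (\int[gauss I]_g (Phi (obs x b g))%:E = (Op x Phi b)%:E)%E.
Proof. by move=> h; apply: ExE; exact: (tame_hasE b h).1. Qed.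

Lemma Op_ntame Phi : ntame Phi -> ntame (Op x Phi).
Proof.
move=> [cP P0]; have [mP [C hC]] := cP.
have O0 b : 0 <= Op x Phi b.
  by apply: (hasE_le (hasE_cst I 0) (tame_hasE b cP)).
split => //; split; last first.
  exists C => b; rewrite ger0_norm//.
  apply: (hasE_le (tame_hasE b cP) (hasEZ C (hasE_mass b))) => g.
  exact: le_trans (ler_norm _) (hC _).
have m2 : measurable_fun setT (fun p : vec T * vec I => (Phi (obs x p.1 p.2))%:E).
  by apply/measurable_EFinP; exact: measurableT_comp mP measurable_obs2.
have := @measurable_fun_fubini_tonelli_F _ _ _ _ _ (gauss I) _ m2
  (fun p => eq_ind_r is_true (P0 _) (lee_fin _ _)).
move=> h; apply/measurable_EFinP.
rewrite (_ : EFin \o Op x Phi = fubini_F (gauss I) (fun p => (Phi (obs x p.1 p.2))%:E))//.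
by apply/funext => b; rewrite /fubini_F /= OpE.
Qed.

End op.

Lemma Op_comm T I J (x : T -> vec I) (y : T -> vec J) Phi b : ntame Phi ->
  Op x (Op y Phi) b = Op y (Op x Phi) b.
Proof.
move=> nP; have [cP P0] := nP; have [mP _] := cP.
apply: EFin_inj; rewrite -(OpE x b (Op_ntame y nP).1) -(OpE y b (Op_ntame x nP).1).
transitivity (\int[gauss I]_g \int[gauss J]_h (Phi (obs y (obs x b g) h))%:E)%E.
  by apply: eq_integral => g _; rewrite OpE.
transitivity (\int[gauss J]_h \int[gauss I]_g (Phi (obs x (obs y b h) g))%:E)%E; last first.
  by apply: eq_integral => h _; rewrite OpE.
have m2 : measurable_fun setT (fun p : vec I * vec J => (Phi (obs y (obs x b p.1) p.2))%:E).
  apply/measurable_EFinP; apply: measurableT_comp mP _; apply: measurable_vec => t.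
  apply: measurable_funD.
    exact: (measurableT_comp (measurable_coord t) (measurableT_comp (measurable_obs x b) measurable_fst)).
  exact: (measurableT_comp (measurable_llr (y t)) measurable_snd).
have := @fubini_tonelli _ _ _ _ _ (gauss I) (gauss J) _ m2
  (fun p => eq_ind_r is_true (P0 _) (lee_fin _ _)).
move=> ->; apply: eq_integral => h _; apply: eq_integral => g _; congr (Phi _)%:E.
by apply/funext => t; rewrite /obs addrAC.
Qed.

(** Log-likelihood ratios for independent noises add, so a joint observation amounts to two
    successive Bayes updates. *)
Lemma Op_join T I J (x : T -> vec I) (y : T -> vec J) Phi b : ntame Phi ->
  Op (fun t => vjoin (x t) (y t)) Phi b = Op x (Op y Phi) b.
Proof.
move=> nP; have [cP P0] := nP; have [mP _] := cP.
apply: EFin_inj; rewrite -(OpE x b (Op_ntame y nP).1) -(OpE _ b cP).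
rewrite gauss_sum; last 2 first.
- by apply/measurable_EFinP; exact: measurableT_comp mP (measurable_obs _ b).
- by move=> f; rewrite lee_fin.
apply: eq_integral => g _; rewrite -OpE//; apply: eq_integral => h _.
congr (Phi _)%:E; apply/funext => t; rewrite /obs -addrA; congr (_ + _).
by rewrite /llr big_sumType.
Qed.

(** The noise law is invariant under isometries, and [llr u h] is a difference of squared norms,
    [|h|^2 - |u - h|^2], hence invariant too. *)
Lemma Op_rot T I (x : T -> vec I) (O O' : vec I -> vec I) Phi b :
  measurable_fun setT O -> measurable_fun setT O' ->
  (forall f g, O (fun i => f i - g i) = fun i => O f i - O g i) ->
  (forall f g, O' (fun i => f i - g i) = fun i => O' f i - O' g i) ->
  cancel O' O -> cancel O O' -> (forall f, sqn (O f) = sqn f) -> ntame Phi ->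
  Op (fun t => O (x t)) Phi b = Op x Phi b.
Proof.
move=> mO mO' OB O'B O'K OK On nP; have [cP P0] := nP; have [mP _] := cP.
apply: EFin_inj; rewrite -!OpE//.
rewrite -(gauss_rotation mO mO' OB O'B O'K OK On); last 2 first.
- by apply/measurable_EFinP; exact: measurableT_comp mP (measurable_obs _ b).
- by move=> f; rewrite lee_fin.
apply: eq_integral => g _; congr (Phi _)%:E; apply/funext => t; rewrite /obs.
have lgE (u h : vec I) : llr u h = sqn h - sqn (fun i => u i - h i).
  by rewrite /llr /sqn -sumrB; apply: eq_bigr => i _; ring.
by rewrite !lgE -OB !On.
Qed.

(** A rotation by 45 degrees carries the signal [(x, 0)], whose second half is pure noise and tells
    nothing, to two copies of [x] divided by the square root of 2. *)
Lemma Op_half T I (x : T -> vec I) Phi b : ntame Phi ->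
  Op x Phi b =
  Op (fun t i => x t i / Num.sqrt 2) (Op (fun t i => x t i / Num.sqrt 2) Phi) b.
Proof.
move=> nP; rewrite -Op_join//.
pose s2 : R := (Num.sqrt 2)^-1.
have s22 : s2 * s2 = 2^-1 by rewrite -expr2 exprVn sqr_sqrtr.
pose O (f : vec (I + I)%type) : vec (I + I)%type := fun k => match k with
  | inl i => (f (inl i) + f (inr i)) * s2 | inr i => (f (inl i) - f (inr i)) * s2 end.
have mO : measurable_fun setT O.
  apply: measurable_vec => -[i|i] /=; apply: measurable_funM => //.
    by apply: measurable_funD; exact: measurable_coord.
  by apply: measurable_funB; exact: measurable_coord.
have OB f g : O (fun i => f i - g i) = fun i => O f i - O g i.
  by apply/funext => -[i|i] /=; ring.
have OK : cancel O O.
  move=> f; apply/funext => -[i|i] /=.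
    rewrite -mulrDl -mulrA s22; lra.
  rewrite -mulrBl -mulrA s22; lra.
have On f : sqn (O f) = sqn f.
  rewrite /sqn !big_sumType/= -!big_split/=; apply: eq_bigr => i _.
  have -> a c : (a * s2) ^+ 2 + (c * s2) ^+ 2 = (a ^+ 2 + c ^+ 2) * (s2 * s2) by ring.
  rewrite s22; lra.
pose z : T -> vec I := fun _ _ => 0.
have -> : Op (fun t => vjoin (fun i => x t i / Num.sqrt 2) (fun i => x t i / Num.sqrt 2)) Phi b
   = Op (fun t => O (vjoin (x t) (z t))) Phi b.
  congr (Op _ Phi b); apply/funext => t; apply/funext => -[i|i] /=;
  by rewrite /z ?addr0 ?subr0.
rewrite (Op_rot _ _ mO mO OB OB OK OK On nP) Op_join//.
have -> // : Op z Phi = Phi.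
apply/funext => c; rewrite /Op (_ : (fun g => _) = fun=> Phi c); first exact: (hasE_cst I _).2.
apply/funext => g; congr Phi; apply/funext => t; rewrite /obs /llr big1 ?addr0// => i _.
by rewrite /z; ring.
Qed.

End channel.

(** * Entropy and variance bounds for one observation *)

Section information.
Context {R : realType}.
Local Notation vec := (@vec R).
Implicit Types I J T : finType.

(** The cross-entropy against the prior is linear in the posterior weights, and these average to the
    prior weights. *)
Lemma Op_entr_le T I (x : T -> vec I) b : Op x (@entr R T) b <= entr b.
Proof.
case: (pickP (@predT T)) => [t0 _|T0]; last first.
  apply: (hasE_le (tame_hasE x b (@entr_ntame R T).1) (hasE_cst I _)) => g.
  by rewrite /entr !big_pred0// => t; have := T0 t.
have S0 := mass_gt0 t0 b.
apply: (hasE_le (tame_hasE x b (@entr_ntame R T).1) (hasE_wexp x (fun t => ln (mass b) - b t) b)) => g.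
apply: le_trans (@entr_gibbs R T (fun t => expR (b t) / mass b) _ _ _) _.
- by move=> t; rewrite divr_gt0// expR_gt0.
- by rewrite -mulr_suml -/(mass b) divff// gt_eqF.
- apply: ler_sum => t _; rewrite ler_wpM2l ?expR_ge0//.
  by rewrite ln_div ?posrE ?expR_gt0// expRK; lra.
Qed.

(** Gibbs' inequality against the even mixture of the point mass at [d] and the uniform law. The
    bound holds for every posterior and every guess, so Fano's inequality for a decoder is its
    average. *)
Lemma entr_fano T (d : T) (b : vec T) :
  entr b <= mass b * ln 2 + (mass b - expR (b d)) * ln #|T|%:R.
Proof.
have n0 : 0 < #|T|%:R :> R by rewrite ltr0n; apply/card_gt0P; exists d.
pose q t : R := (2 * #|T|%:R)^-1 + if t == d then 2^-1 else 0.
have k0 : 0 < (2 * #|T|%:R)^-1 :> R by rewrite invr_gt0 mulr_gt0.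
apply: le_trans (@entr_gibbs R T q b _ _) _.
- by move=> t; rewrite /q; case: ifP => _; lra.
- rewrite /q big_split/= sumr_const -big_mkcond/= big_pred1_eq.
  rewrite -[X in X + _]mulr_natr invfM -mulrA mulVf ?gt_eqF//; lra.
rewrite (bigD1 d)//= [X in _ <= X * _ + _](_ : _ = expR (b d) + \sum_(t | t != d) expR (b t)); last first.
  by rewrite /mass (bigD1 d).
rewrite [X in _ <= _ + X * _](_ : _ = \sum_(t | t != d) expR (b t)); last first.
  by rewrite /mass (bigD1 d)//= addrAC subrr add0r.
rewrite mulrDl -addrA; apply: lerD.
  rewrite ler_wpM2l ?expR_ge0// /q eqxx lerNl -lnV ?posrE//.
  by rewrite ler_ln ?posrE; lra.
rewrite -mulrDr mulr_suml; apply: ler_sum => t td.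
rewrite ler_wpM2l ?expR_ge0// /q (negbTE td) addr0 lnV ?posrE ?mulr_gt0//.
by rewrite opprK lnM ?posrE.
Qed.

Lemma hasE_Lcoord I (x : vec I) (i : I) (m : R) :
  hasE (fun g => expR (llr x g) * (g i - m) ^+ 2) ((x i - m) ^+ 2 + 2^-1).
Proof.
have pick (f : I -> R) : \sum_j (if j == i then 1 else 0) * f j = f i.
  by rewrite (bigD1 i)//= eqxx mul1r big1 ?addr0// => j /negbTE ->; rewrite mul0r.
have := hasE_Lsqr x (- m) (fun j => if j == i then 1 else 0).
rewrite [X in hasE _ X -> _](_ : _ = (x i - m) ^+ 2 + 2^-1).
  by apply: hasE_ext => g; rewrite pick addrC.
rewrite pick (addrC (- m)); congr (_ ^+ 2 + _).
rewrite (bigD1 i)//= eqxx expr1n mul1r big1 ?addr0// => j /negbTE ->.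
by rewrite expr0n mul0r.
Qed.

(* Gibbs' inequality against the Gaussian output law of variances [1/2 + l i]. *)
Lemma entr_gauss_bound T I (x : T -> vec I) (l : I -> R) b :
  (forall i, 0 <= l i) ->
  entr b <= Op x (@entr R T) b +
    \sum_i (mass b / 2 * ln (1 + 2 * l i) +
            (pcov (x^~ i) (x^~ i) b - l i * mass b) / (1 + 2 * l i)).
Proof.
move=> l0.
case: (pickP (@predT T)) => [t0 _|T0]; last first.
  have HT (c : vec T) : entr c = 0 by rewrite /entr big_pred0// => t; have := T0 t.
  rewrite HT [X in _ <= _ + X]big1; first by rewrite addr0; exact: (Op_ntame x (@entr_ntame R T)).2.
  move=> i _; rewrite /mass /pcov !big_pred0 ?mul0r ?mulr0 ?subrr ?mul0r ?addr0//;
  by move=> t; have := T0 t.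
have S0 := mass_gt0 t0 b.
pose c i := (1 + 2 * l i)^-1.
have c0 i : 0 < c i by rewrite invr_gt0; have := l0 i; lra.
pose m i := wmean (x^~ i) b.
pose q (g : vec I) := \prod_i (Num.sqrt (c i) * expR (g i ^+ 2 - c i * (g i - m i) ^+ 2)).
have lnq g : q g = expR (\sum_i (ln (c i) / 2 + (g i ^+ 2 - c i * (g i - m i) ^+ 2))).
  rewrite expR_sum; apply: eq_bigr => i _; rewrite [RHS]expRD; congr (_ * _).
  by rewrite -[RHS]ger0_norm ?expR_ge0// -sqrtr_sqr expr2 -expRD -splitr lnK// posrE c0.
have qE : hasE q 1 := hasE_gauss m c0.
pose w i := ln (c i) / 2 + 2^-1.
have Et t : hasE (fun g => expR (obs x b g t) *
    (ln (mass b) - b t - llr (x t) g + ln (q g)))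
  (expR (b t) * (ln (mass b) - b t + \sum_i (w i - c i * ((x t i - m i) ^+ 2 + 2^-1)))).
  have hi i := hasED (hasEZ (ln (c i) / 2) (hasE_L (x t)))
    (hasED (hasE_Lcoord (x t) i (x t i)) (hasEZ (- c i) (hasE_Lcoord (x t) i (m i)))).
  have := hasEZ (expR (b t)) (hasED (hasEZ (ln (mass b) - b t) (hasE_L (x t)))
    (hasE_sum (index_enum I) hi)).
  rewrite [X in hasE _ X -> _](_ : _ =
     expR (b t) * (ln (mass b) - b t + \sum_i (w i - c i * ((x t i - m i) ^+ 2 + 2^-1)))); last first.
    rewrite mulr1; congr (_ * (_ + _)); apply: eq_bigr => i _; rewrite /w subrr expr0n/=; ring.
  apply: hasE_ext => g; rewrite /obs expRD -mulrA; congr (_ * _).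
  rewrite lnq expRK /llr -addrA [- _ + _]addrC -sumrB mulrDr [_ * expR _]mulrC; congr (_ + _).
  by rewrite mulr_sumr; apply: eq_bigr => i _; ring.
have := hasED (hasED (hasE_sum (index_enum T) Et) (hasEZ (- mass b) qE)) (hasE_mass x b).
move=> /hasE_le/(_ (tame_hasE x b (@entr_ntame R T).1)) key.
rewrite -lerBlDr; apply: le_trans (key _) => {key}.
- rewrite mulr1 addrNK.
  have -> : \sum_t expR (b t) * (ln (mass b) - b t + \sum_i (w i - c i * ((x t i - m i) ^+ 2 + 2^-1)))
     = entr b + \sum_i (mass b * w i - c i * (pcov (x^~ i) (x^~ i) b + mass b / 2)).
    under eq_bigr do rewrite mulrDr; rewrite big_split/= -/(entr b); congr (_ + _).
    under eq_bigr do rewrite mulr_sumr; rewrite exchange_big/=; apply: eq_bigr => i _.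
    transitivity (\sum_t (expR (b t) * (w i - c i / 2) - c i * (expR (b t) * (x t i - m i) ^+ 2))).
      by apply: eq_bigr => t _; ring.
    rewrite sumrB -mulr_suml -/(mass b) -mulr_sumr (@pcov_sqrE R T t0) subrr expr0n mulr0 addr0.
    by ring.
  rewrite lerD2l -sumrN; apply: ler_sum => i _; rewrite /w.
  have -> : ln (c i) = - ln (1 + 2 * l i).
    by rewrite /c lnV// posrE; have := l0 i; lra.
  have l1 : 1 + 2 * l i != 0 by rewrite gt_eqF//; have := l0 i; lra.
  have -> : c i = (1 + 2 * l i)^-1 by [].
  rewrite le_eqVlt; apply/orP; left; apply/eqP; field.
  exact: l1.
- move=> g; set b' := obs x b g.
  have S'0 : 0 < mass b' := mass_gt0 t0 b'.
  have q0 : 0 < q g by rewrite lnq expR_gt0.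
  have := ln_le_sub1 (divr_gt0 (mulr_gt0 S0 q0) S'0).
  rewrite ln_div ?posrE ?mulr_gt0// lnM ?posrE// => h.
  have {}h : mass b' * (ln (mass b) + ln (q g) - ln (mass b')) <= mass b * q g - mass b'.
    have -> : mass b * q g - mass b' = mass b' * (mass b * q g / mass b' - 1) by field; rewrite gt_eqF.
    by rewrite ler_pM2l.
  have -> : \sum_t expR (b' t) * (ln (mass b) - b t - llr (x t) g + ln (q g)) =
     entr b' + mass b' * (ln (mass b) + ln (q g) - ln (mass b')).
    rewrite /entr {2}/mass mulr_suml -big_split/=; apply: eq_bigr => t _.
    by rewrite /b' /obs; ring.
  lra.
Qed.

Lemma expR_le_quad (v : R) : `|v| <= 2^-1 -> expR v <= 1 + v + 2 * v ^+ 2.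
Proof.
rewrite ler_norml => /andP[v1 v2].
have := expR_ge1Dx (- v); rewrite expRN => h.
have e0 := expR_gt0 v.
have : expR v * (1 - v) <= expR v * (expR v)^-1 by rewrite ler_pM2l.
rewrite divff ?gt_eqF// => h1.
have : 1 <= (1 + v + 2 * v ^+ 2) * (1 - v) by nra.
move=> /(le_trans h1); rewrite ler_pM2r//; lra.
Qed.

(** The information equals the posterior variance of the signal minus the divergence of the output
    law from the noise centred at the posterior mean [m]. That divergence is at most the chi-square
    distance, whose second moment is [Q]. Its first-order term vanishes because [m] is the mean,
    which leaves a loss of order [beta ^+ 2]. *)
Lemma entr_small_snr T I (y : T -> vec I) b (beta : R) :
  beta <= 2^-1 ->
  (forall t s, `|2 * \sum_i (y t i - wmean (y^~ i) b) * (y s i - wmean (y^~ i) b)| <= beta) ->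
  Op y (@entr R T) b + \sum_i pcov (y^~ i) (y^~ i) b <= entr b + 2 * beta ^+ 2 * mass b.
Proof.
move=> b1 hb.
case: (pickP (@predT T)) => [t0 _|T0]; last first.
  rewrite [X in _ + X <= _]big1; last first.
    by move=> i _; rewrite /pcov !big_pred0 ?mul0r ?subrr// => t; have := T0 t.
  rewrite addr0; apply: le_trans (Op_entr_le y b) _.
  by rewrite lerDl mulr_ge0 ?mass_ge0// mulr_ge0 ?sqr_ge0.
have S0 := mass_gt0 t0 b.
have beta0 : 0 <= beta by apply: le_trans (hb t0 t0).
pose m : vec I := fun i => wmean (y^~ i) b.
have Et t : hasE (fun g => expR (obs y b g t) *
    (ln (mass b) - b t + (llr m g - llr (y t) g)))
  (expR (b t) * (ln (mass b) - b t - \sum_i (y t i - m i) ^+ 2)).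
  pose k : vec I := fun i => 2 * (m i - y t i).
  pose a := ln (mass b) - b t + \sum_i (y t i ^+ 2 - m i ^+ 2).
  have := hasEZ (expR (b t)) (hasE_Llin (y t) a k).
  rewrite [X in hasE _ X -> _](_ : _ = expR (b t) * (ln (mass b) - b t - \sum_i (y t i - m i) ^+ 2)); last first.
    congr (_ * _); rewrite /a -addrA; congr (_ + _); rewrite -big_split/= -sumrN.
    by apply: eq_bigr => i _; rewrite /k; ring.
  apply: hasE_ext => g; rewrite /obs expRD -mulrA; congr (_ * (_ * _)).
  rewrite /a -addrA; congr (_ + _); rewrite /llr -sumrB -big_split/=.
  by apply: eq_bigr => i _; rewrite /k; ring.
have Es t s : hasE (fun g => expR (b t + b s) * expR (llr (y t) g + llr (y s) g - llr m g))
    (expR (b t + b s) * expR (2 * \sum_i (y t i - m i) * (y s i - m i))).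
  apply: hasEZ.
  have := hasEZ (expR (\sum_i (m i ^+ 2 - y t i ^+ 2 - y s i ^+ 2)))
    (hasE_exp (fun i => y t i + y s i - m i)).
  rewrite -expRD [X in hasE _ X -> _](_ : _ = expR (2 * \sum_i (y t i - m i) * (y s i - m i))); last first.
    congr expR; rewrite /sqn -big_split/= mulr_sumr; apply: eq_bigr => i _; ring.
  apply: hasE_ext => g; rewrite -expRD; congr expR.
  rewrite /llr mulr_sumr -!big_split/= -sumrB; apply: eq_bigr => i _; ring.
pose Q := \sum_t \sum_s expR (b t + b s) * expR (2 * \sum_i (y t i - m i) * (y s i - m i)).
have EQ : hasE (fun g => (mass (obs y b g)) ^+ 2 / expR (llr m g)) Q.
  have := hasE_sum (index_enum T) (fun t => hasE_sum (index_enum T) (Es t)).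
  apply: hasE_ext => g; rewrite expr2 {1}/mass !mulr_suml; apply: eq_bigr => t _.
  rewrite /mass mulr_sumr mulr_suml; apply: eq_bigr => s _.
  by rewrite -expRN -!expRD /obs; congr expR; ring.
have QB : Q <= mass b ^+ 2 * (1 + 2 * beta ^+ 2).
  have -> : mass b ^+ 2 * (1 + 2 * beta ^+ 2) = \sum_t \sum_s expR (b t + b s) *
      (1 + (2 * \sum_i (y t i - m i) * (y s i - m i)) + 2 * beta ^+ 2).
    have z : \sum_t \sum_s expR (b t + b s) * (2 * \sum_i (y t i - m i) * (y s i - m i)) = 0.
      transitivity (2 * \sum_i (\sum_t expR (b t) * (y t i - m i)) * (\sum_s expR (b s) * (y s i - m i))).
        transitivity (\sum_t \sum_s \sum_i 2 * ((expR (b t) * (y t i - m i)) * (expR (b s) * (y s i - m i)))).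
          apply: eq_bigr => t _; apply: eq_bigr => s _; rewrite mulrA mulr_sumr.
          by apply: eq_bigr => i _; rewrite expRD; ring.
        under eq_bigr do rewrite exchange_big/=.
        rewrite exchange_big/= mulr_sumr; apply: eq_bigr => i _.
        rewrite mulr_suml mulr_sumr; apply: eq_bigr => t _.
        by rewrite mulr_sumr mulr_sumr.
      rewrite big1 ?mulr0// => i _.
      suff -> : \sum_t expR (b t) * (y t i - m i) = 0 by rewrite mul0r.
      under eq_bigr do rewrite mulrBr.
      by rewrite sumrB -mulr_suml -/(mass b) /m /wmean mulrC divfK ?subrr// gt_eqF.
    under eq_bigr do under eq_bigr do rewrite mulrDr mulrDr mulr1.
    under eq_bigr do rewrite !big_split/=.
    rewrite !big_split/= z addr0.
    have e1 : \sum_t \sum_s expR (b t + b s) = mass b ^+ 2.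
      rewrite expr2 {1}/mass mulr_suml; apply: eq_bigr => t _.
      by rewrite /mass mulr_sumr; apply: eq_bigr => s _; rewrite expRD.
    by rewrite -e1 mulrDr mulr1 mulr_suml; congr (_ + _); apply: eq_bigr => t _; rewrite mulr_suml.
  apply: ler_sum => t _; apply: ler_sum => s _; rewrite ler_wpM2l ?expR_ge0//.
  have := hb t s; rewrite -/(m _); move: (2 * _) => v hv.
  have v1 : `|v| <= 2^-1 by exact: le_trans hv b1.
  apply: le_trans (expR_le_quad v1) _; rewrite lerD2l ler_wpM2l// -real_normK ?num_real//.
  by rewrite ler_pXn2r ?nnegrE.
have := hasED (hasE_sum (index_enum T) Et) (hasED (hasEZ ((mass b)^-1) EQ) (hasEZ (-1) (hasE_mass y b))).
move=> h; have := hasE_le (tame_hasE y b (@entr_ntame R T).1) h => {h} key.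
rewrite -lerBrDr; apply: le_trans (key _) _ => {key}.
- move=> g; set b' := obs y b g.
  have S'0 : 0 < mass b' := mass_gt0 t0 b'.
  have e0 := expR_gt0 (llr m g).
  have := ln_le_sub1 (divr_gt0 S'0 (mulr_gt0 S0 e0)).
  rewrite ln_div ?posrE ?mulr_gt0// lnM ?posrE// expRK => h.
  have {}h : mass b' * (ln (mass b') - (ln (mass b) + llr m g)) <=
      (mass b)^-1 * (mass b' ^+ 2 / expR (llr m g)) - mass b'.
    have -> : (mass b)^-1 * (mass b' ^+ 2 / expR (llr m g)) - mass b' =
       mass b' * (mass b' / (mass b * expR (llr m g)) - 1) by field; rewrite !gt_eqF.
    by rewrite ler_pM2l.
  have -> : \sum_t expR (b' t) * (ln (mass b) - b t + (llr m g - llr (y t) g)) =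
     entr b' - mass b' * (ln (mass b') - (ln (mass b) + llr m g)).
    rewrite /entr {2}/mass mulr_suml -sumrB; apply: eq_bigr => t _.
    by rewrite /b' /obs; ring.
  lra.
- have -> : \sum_t expR (b t) * (ln (mass b) - b t - \sum_i (y t i - m i) ^+ 2) =
     entr b - \sum_i pcov (y^~ i) (y^~ i) b.
    under eq_bigr do rewrite mulrBr; rewrite sumrB -/(entr b); congr (_ - _).
    under eq_bigr do rewrite mulr_sumr; rewrite exchange_big/=; apply: eq_bigr => i _.
    by rewrite (@pcov_sqrE R T t0 (y^~ i)) subrr expr0n mulr0 addr0.
  have : (mass b)^-1 * Q <= (mass b)^-1 * (mass b ^+ 2 * (1 + 2 * beta ^+ 2)).
    by rewrite ler_pM2l// invr_gt0.
  have -> : (mass b)^-1 * (mass b ^+ 2 * (1 + 2 * beta ^+ 2)) = mass b + 2 * beta ^+ 2 * mass b.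
    by field; rewrite gt_eqF.
  lra.
Qed.

(** The posterior mean errs no more than the affine estimator of slope [k]. The intercept is chosen
    so that the estimator is unbiased; the noise enters with variance 1/2 per coordinate. *)
Lemma Op_pvar_le T I (x : T -> vec I) (v : T -> R) (k : vec I) b :
  Op x (pcov v v) b <=
  pcov (fun t => v t - \sum_i k i * x t i) (fun t => v t - \sum_i k i * x t i) b
  + mass b * (\sum_i k i ^+ 2 / 2).
Proof.
case: (pickP (@predT T)) => [t0 _|T0]; last first.
  have CT (w : T -> R) (c : vec T) : pcov w w c = 0.
    by rewrite /pcov !big_pred0 ?mul0r ?subrr// => t; have := T0 t.
  apply: (hasE_le (tame_hasE x b (pcov_tame v v)) (hasE_cst I _)) => g.
  by rewrite !CT add0r mulr_ge0 ?mass_ge0// sumr_ge0// => i _; rewrite divr_ge0 ?sqr_ge0.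
set v' := fun t => _.
pose c := wmean v' b.
have Et t := hasEZ (expR (b t)) (hasE_Lsqr (x t) (c - v t) k).
have := hasE_sum (index_enum T) Et.
move=> h; apply: le_trans (hasE_le (tame_hasE x b (pcov_tame v v)) h _) _ => {h}.
- move=> g; apply: le_trans (pvar_le v _ (c + \sum_i k i * g i)) _.
  rewrite le_eqVlt; apply/orP; left; apply/eqP; apply: eq_bigr => t _.
  by rewrite /obs expRD -mulrA; congr (_ * (_ * _)); ring.
- under eq_bigr do rewrite mulrDr.
  rewrite big_split/= -mulr_suml -/(mass b) lerD2r.
  have := @pcov_sqrE R T t0 v' b c; rewrite subrr expr0n mulr0 addr0 => <-.
  rewrite le_eqVlt; apply/orP; left; apply/eqP; apply: eq_bigr => t _.
  by congr (_ * _); rewrite /v'; ring.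
Qed.

End information.

(** * A lower bound on mutual information *)

Section stages.
Context {R : realType}.
Local Notation vec := (@vec R).
Implicit Types I J T : finType.

Lemma ntameD T (Phi Psi : vec T -> R) : ntame Phi -> ntame Psi -> ntame (fun b => Phi b + Psi b).
Proof. by move=> [c1 p1] [c2 p2]; split; [exact: tameD|move=> b; exact: addr_ge0]. Qed.

Lemma ntameZ T (Phi : vec T -> R) k : 0 <= k -> ntame Phi -> ntame (fun b => k * Phi b).
Proof. by move=> k0 [c1 p1]; split; [exact: tameZ|move=> b; exact: mulr_ge0]. Qed.

Lemma ntame_sum T (K : finType) (Phi : K -> vec T -> R) : (forall k, ntame (Phi k)) ->
  ntame (fun b => \sum_k Phi k b).
Proof.
move=> h; split; first by apply: tame_sum => k; case: (h k).
by move=> b; apply: sumr_ge0 => k _; exact: (h k).2.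
Qed.

Section iterated.
Variables (T I : finType) (z : T -> vec I).

Definition Opn (s : nat) (Phi : vec T -> R) : vec T -> R := iter s (Op z) Phi.

Lemma Opn_ntame s Phi : ntame Phi -> ntame (Opn s Phi).
Proof. by move=> h; elim: s => //= s IH; exact: Op_ntame. Qed.

Lemma OpnD s Phi Psi : ntame Phi -> ntame Psi ->
  Opn s (fun b => Phi b + Psi b) = fun b => Opn s Phi b + Opn s Psi b.
Proof.
move=> h1 h2; elim: s => //= s; rewrite /Opn /= => ->.
by apply/funext => b; rewrite OpD//; exact: (Opn_ntame s _).1.
Qed.

Lemma OpnZ s k Phi : ntame Phi -> Opn s (fun b => k * Phi b) = fun b => k * Opn s Phi b.
Proof.
move=> h1; elim: s => //= s; rewrite /Opn /= => ->.
by apply/funext => b; rewrite OpZ//; exact: (Opn_ntame s _).1.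
Qed.

Lemma Opn_sum s (K : finType) (Phi : K -> vec T -> R) : (forall k, ntame (Phi k)) ->
  Opn s (fun b => \sum_k Phi k b) = fun b => \sum_k Opn s (Phi k) b.
Proof.
move=> h1; elim: s => //= s; rewrite /Opn /= => ->.
by apply/funext => b; rewrite Op_sum// => k; exact: (Opn_ntame s _).1.
Qed.

Lemma Opn_mass s : Opn s (@mass R T) = @mass R T.
Proof. by elim: s => //= s; rewrite /Opn /= => ->; apply/funext => b; rewrite Op_mass. Qed.

Lemma Opn_le s Phi Psi : ntame Phi -> ntame Psi -> (forall b, Phi b <= Psi b) ->
  forall b, Opn s Phi b <= Opn s Psi b.
Proof.
move=> h1 h2 le; elim: s => //= s IH b.
by apply: Op_le => //; exact: (Opn_ntame s _).1.
Qed.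

End iterated.

Lemma Op_stages T I (y : T -> vec I) (q : nat) Phi : ntame Phi ->
  Opn (fun t i => y t i / Num.sqrt 2 ^+ q) (2 ^ q) Phi = Op y Phi.
Proof.
move=> nP; elim: q => [|q IH].
  rewrite /Opn /=; congr (Op _ Phi); apply/funext => t; apply/funext => i.
  by rewrite expr0 divr1.
pose z : T -> vec I := fun t i => y t i / Num.sqrt 2 ^+ q.
have e : (fun t i => y t i / Num.sqrt 2 ^+ q.+1) =
    (fun t i => z t i / Num.sqrt 2) :> (T -> vec I).
  by apply/funext => t; apply/funext => i; rewrite /z exprSr invfM mulrA.
rewrite -IH expnS mul2n e -/z; elim: (2 ^ q)%N => // m; rewrite /Opn doubleS /= => ->.
by apply/funext => b; rewrite [RHS]Op_half//; exact: Opn_ntame.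
Qed.

(** A discrete Riccati inequality. Over one step [1 - s * d * e s] shrinks at most by the factor
    [1 + d * e s], whose logarithm is at most [d * e s]. The induction keeps the bound in terms of
    the final error, the quantity known later. *)
Lemma stage_sum_bound (d : R) (N : nat) (e : nat -> R) : 0 <= d ->
  (forall s, 0 <= e s) -> (forall s, e s.+1 * (1 + d * e s) <= e s) ->
  N%:R * d * e N < 1 /\ - ln (1 - N%:R * d * e N) <= \sum_(s < N) d * e s.
Proof.
move=> d0 e0 he; elim: N => [|N [IH1 IH2]].
  by rewrite big_ord0 !mul0r subr0 ln1 oppr0.
rewrite big_ord_recr /=.
have p0 : 0 < 1 + d * e N by rewrite ltr_pwDl// mulr_ge0.
have N0 : 0 <= N%:R :> R by rewrite ler0n.
have key : (1 - N%:R * d * e N) <= (1 + d * e N) * (1 - N.+1%:R * d * e N.+1).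
  rewrite mulrBr mulr1.
  have : N.+1%:R * d * (e N.+1 * (1 + d * e N)) <= N.+1%:R * d * e N.
    by rewrite ler_wpM2l// mulr_ge0.
  rewrite -natr1 => h; apply: le_trans (_ : 1 + d * e N - (N%:R + 1) * d * e N <= _); first by lra.
  by rewrite lerD2l lerN2; apply: le_trans h; lra.
have q0 : 0 < 1 - N.+1%:R * d * e N.+1.
  have : 0 < (1 + d * e N) * (1 - N.+1%:R * d * e N.+1) by apply: lt_le_trans key; rewrite subr_gt0.
  by rewrite pmulr_rgt0.
split; first by rewrite -subr_gt0.
have : ln (1 - N%:R * d * e N) <= ln ((1 + d * e N) * (1 - N.+1%:R * d * e N.+1)).
  by rewrite ler_ln ?posrE ?mulr_gt0// subr_gt0.
rewrite lnM ?posrE// => h.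
have := ln_le_sub1 p0.
by move: IH2 h; lra.
Qed.

Lemma pcov_scale T (a : R) (v : T -> R) (b : vec T) :
  pcov (fun t => a * v t) (fun t => a * v t) b = a ^+ 2 * pcov v v b.
Proof.
rewrite /pcov mulrBr; congr (_ - _).
  by rewrite mulr_sumr; apply: eq_bigr => t _; ring.
have -> : \sum_t expR (b t) * (a * v t) = a * \sum_t expR (b t) * v t.
  by rewrite mulr_sumr; apply: eq_bigr => t _; ring.
by ring.
Qed.

Lemma wmean_scale T (a : R) (v : T -> R) (b : vec T) :
  wmean (fun t => v t * a) b = wmean v b * a.
Proof.
rewrite /wmean mulrAC; congr (_ / _); rewrite mulr_suml.
by apply: eq_bigr => t _; rewrite mulrA.
Qed.

(** The bound does not depend on [b]: the weak-signal estimate has to hold for every posterior met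
    along the stages. *)
Lemma wmean_dev T (v : T -> R) (b : vec T) t : `|v t - wmean v b| <= 2 * \sum_s `|v s|.
Proof.
have S0 := mass_gt0 t b.
apply: le_trans (ler_normB _ _) _; rewrite mulr_natl mulr2n; apply: lerD.
  by rewrite (bigD1 t)//= lerDl; apply: sumr_ge0.
by rewrite /wmean normrM normfV (gtr0_norm S0) ler_pdivrMr// wsum_le.
Qed.

(** Stage gains telescope. Each stage loses order [c ^+ 4], so when [N * c ^+ 2 = 1] the total loss
    is of order [c ^+ 2] and vanishes as the stages multiply. *)
Lemma stage_entr T I (y : T -> vec I) (b : vec T) (c B : R) (N : nat) :
  (forall b t s, `|2 * \sum_i (y t i - wmean (y^~ i) b) * (y s i - wmean (y^~ i) b)| <= B) ->
  c ^+ 2 * B <= 2^-1 ->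
  let z := (fun t i => y t i * c) : T -> vec I in
  Opn z N (@entr R T) b + \sum_(s < N) c ^+ 2 * \sum_i Opn z s (pcov (y^~ i) (y^~ i)) b
  <= entr b + N%:R * (2 * (c ^+ 2 * B) ^+ 2) * mass b.
Proof.
move=> hB hc /=; set z : T -> vec I := fun t i => y t i * c; set bet := c ^+ 2 * B.
have step (b' : vec T) : Op z (@entr R T) b' + c ^+ 2 * \sum_i pcov (y^~ i) (y^~ i) b'
    <= entr b' + 2 * bet ^+ 2 * mass b'.
  have -> : c ^+ 2 * \sum_i pcov (y^~ i) (y^~ i) b' = \sum_i pcov (z^~ i) (z^~ i) b'.
    rewrite mulr_sumr; apply: eq_bigr => i _; rewrite -pcov_scale.
    by congr (pcov _ _ b'); apply/funext => t; rewrite mulrC.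
  apply: entr_small_snr => // t s.
  have -> : 2 * \sum_i (z t i - wmean (z^~ i) b') * (z s i - wmean (z^~ i) b') =
     c ^+ 2 * (2 * \sum_i (y t i - wmean (y^~ i) b') * (y s i - wmean (y^~ i) b')).
    rewrite !mulr_sumr; apply: eq_bigr => i _; rewrite !wmean_scale /z; ring.
  rewrite normrM ger0_norm ?sqr_ge0// ler_wpM2l ?sqr_ge0//; exact: hB.
have nV i : ntame (pcov (y^~ i) (y^~ i)) := pvar_ntame _.
have nH : ntame (@entr R T) := @entr_ntame R T.
have nS : ntame (@mass R T) := @mass_ntame R T.
have c20 : 0 <= c ^+ 2 by exact: sqr_ge0.
elim: N => [|N IH]; first by rewrite big_ord0 addr0 !mul0r addr0.
rewrite big_ord_recr /=.
have b20 : 0 <= 2 * bet ^+ 2 by rewrite mulr_ge0 ?sqr_ge0.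
have nO := Op_ntame z nH; have nC := ntame_sum nV.
have := @Opn_le T I z N _ _ (ntameD nO (ntameZ c20 nC)) (ntameD nH (ntameZ b20 nS)) step b.
rewrite (OpnD z N nO (ntameZ c20 nC)) (OpnD z N nH (ntameZ b20 nS)).
rewrite (OpnZ z N _ nC) (OpnZ z N _ nS) (Opn_sum z N nV) Opn_mass.
have -> : Opn z N (Op z (@entr R T)) b = Op z (Opn z N (@entr R T)) b.
  by rewrite /Opn -iterSr.
move: IH; rewrite -natr1; set S1 := \sum_(s < N) _; set S2 := \sum_i _.
move: (mass b) => S IH h; lra.
Qed.

Lemma stage_pvar T I (y : T -> vec I) (b : vec T) (c k : R) (s : nat) (i : I) :
  let z := (fun t i => y t i * c) : T -> vec I in
  Opn z s.+1 (pcov (y^~ i) (y^~ i)) b <=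
  (1 - k * c) ^+ 2 * Opn z s (pcov (y^~ i) (y^~ i)) b + k ^+ 2 / 2 * mass b.
Proof.
rewrite /=; set z : T -> vec I := fun t i => y t i * c; have nV : ntame (pcov (y^~ i) (y^~ i)) := pvar_ntame _.
have nS : ntame (@mass R T) := @mass_ntame R T.
have a0 : 0 <= (1 - k * c) ^+ 2 by exact: sqr_ge0.
have k0 : 0 <= k ^+ 2 / 2 by rewrite divr_ge0 ?sqr_ge0.
have := @Opn_le T I z s (Op z (pcov (y^~ i) (y^~ i)))
  (fun b => (1 - k * c) ^+ 2 * pcov (y^~ i) (y^~ i) b + k ^+ 2 / 2 * mass b).
rewrite OpnD ?OpnZ//; [|exact: ntameZ|exact: ntameZ].
rewrite Opn_mass {1}/Opn -iterSr; apply; first exact: Op_ntame.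
  by apply: ntameD; exact: ntameZ.
move=> b'; apply: le_trans (Op_pvar_le z (y^~ i) (fun j => if j == i then k else 0) b') _.
rewrite -pcov_scale le_eqVlt; apply/orP; left; apply/eqP; congr (_ + _).
  have e t : y t i - \sum_j (if j == i then k else 0) * z t j = (1 - k * c) * y t i.
    rewrite (bigD1 i)//= eqxx big1 ?addr0; first by rewrite /z; ring.
    by move=> j /negbTE ->; rewrite mul0r.
  by congr (pcov _ _ b'); apply/funext => t; rewrite e.
rewrite mulrC; congr (_ * _); rewrite (bigD1 i)//= eqxx big1 ?addr0//.
by move=> j /negbTE ->; rewrite expr0n mul0r.
Qed.

(* The channel is split into 2^q weak stages. The linear estimator shows that the error [e]
   obeys [e s.+1 * (1 + d * e s) <= e s], and each stage gains [d * e s] up to O(d^2). *)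
Lemma mutual_info_lower_bound (U M K : finType) (n : nat)
    (y : U -> M -> vec ('I_n * K * bool)%type) (b : U -> vec M) :
  (0 < n)%N -> \sum_u mass (b u) = 1 ->
  let e j := n%:R^-1 * \sum_(i < n) \sum_(a : bool) \sum_u
       Op (y u) (pcov ((y u)^~ (i, j, a)) ((y u)^~ (i, j, a))) (b u) in
  (forall j, e j < 1) /\
  n%:R * \sum_j - ln (1 - e j) <= \sum_u (entr (b u) - Op (y u) (@entr R M) (b u)).
Proof.
move=> n0 Sb e.
have n0' : 0 < n%:R :> R by rewrite ltr0n.
pose V u i j a : vec M -> R := pcov ((y u)^~ (i, j, a)) ((y u)^~ (i, j, a)).
pose D u i : R := 2 * \sum_s `|y u s i|.
(* Summing over [u] is a crude way to get one constant for all primary messages and all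
   posteriors. *)
pose B := \sum_u 2 * \sum_i D u i ^+ 2.
have B0 : 0 <= B.
  apply: sumr_ge0 => u _; rewrite mulr_ge0//; apply: sumr_ge0 => i _; exact: sqr_ge0.
have hB u c t s : `|2 * \sum_i (y u t i - wmean ((y u)^~ i) c) * (y u s i - wmean ((y u)^~ i) c)| <= B.
  apply: le_trans (_ : 2 * \sum_i D u i ^+ 2 <= _); last first.
    rewrite /B [leRHS](bigD1 u)//= lerDl; apply: sumr_ge0 => v _.
    by rewrite mulr_ge0//; apply: sumr_ge0 => i _; exact: sqr_ge0.
  rewrite normrM ger0_norm// ler_wpM2l//.
  apply: le_trans (ler_norm_sum _ _ _) _; apply: ler_sum => i _.
  by rewrite normrM expr2; apply: ler_pM => //; exact: wmean_dev.
have main (q : nat) : B / 2 ^+ q <= 2^-1 -> (forall j, e j < 1) /\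
   n%:R * \sum_j - ln (1 - e j) <= \sum_u (entr (b u) - Op (y u) (@entr R M) (b u)) + 2 * B ^+ 2 / 2 ^+ q.
  move=> hq.
  (* The amplitude left after [q] halvings; the [2 ^ q] stages then satisfy [N * c ^+ 2 = 1]. *)
  pose c : R := (Num.sqrt 2 ^+ q)^-1.
  have c2 : c ^+ 2 = (2 ^+ q)^-1 by rewrite /c exprVn -exprM mulnC exprM sqr_sqrtr.
  have p20 : 0 < 2 ^+ q :> R by rewrite exprn_gt0.
  have N1 : (2 ^ q)%:R * c ^+ 2 = 1 by rewrite c2 natrX mulfV// gt_eqF.
  pose z u t i := y u t i * c.
  pose E j s := n%:R^-1 * \sum_(i < n) \sum_(a : bool) \sum_u Opn (z u) s (V u i j a) (b u).
  have EN j : E j (2 ^ q)%N = e j.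
    rewrite /E /e; congr (_ * _); apply: eq_bigr => i _; apply: eq_bigr => a _.
    apply: eq_bigr => u _; congr (_ (b u)); apply: Op_stages; exact: pvar_ntame.
  have E0 j s : 0 <= E j s.
    rewrite mulr_ge0 ?invr_ge0 ?ler0n//; apply: sumr_ge0 => i _; apply: sumr_ge0 => a _.
    by apply: sumr_ge0 => u _; exact: (Opn_ntame _ _ (pvar_ntame _)).2.
  have Erec0 j s k : E j s.+1 <= (1 - k * c) ^+ 2 * E j s + k ^+ 2.
    have -> : (1 - k * c) ^+ 2 * E j s + k ^+ 2 = n%:R^-1 * \sum_(i < n) \sum_(a : bool) \sum_u
       ((1 - k * c) ^+ 2 * Opn (z u) s (V u i j a) (b u) + k ^+ 2 / 2 * mass (b u)).
      transitivity (n%:R^-1 * \sum_(i < n) ((1 - k * c) ^+ 2 *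
          (\sum_(a : bool) \sum_u Opn (z u) s (V u i j a) (b u)) + k ^+ 2)).
        rewrite big_split/= sumr_const card_ord -mulr_sumr mulrDr /E -[X in _ = _ + _ * X]mulr_natl.
        by field; rewrite gt_eqF.
      congr (_ * _); apply: eq_bigr => i _.
      transitivity (\sum_(a : bool) ((1 - k * c) ^+ 2 *
          (\sum_u Opn (z u) s (V u i j a) (b u)) + k ^+ 2 / 2)).
        by rewrite big_split/= -mulr_sumr; congr (_ + _); rewrite big_bool/= -splitr.
      apply: eq_bigr => a _; rewrite big_split/= -mulr_sumr -[X in _ = _ + X]mulr_sumr.
      by rewrite Sb mulr1.
    rewrite ler_wpM2l ?invr_ge0 ?ler0n//; apply: ler_sum => i _; apply: ler_sum => a _.
    by apply: ler_sum => u _; exact: stage_pvar.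
  have Erec j s : E j s.+1 * (1 + c ^+ 2 * E j s) <= E j s.
    have p0 : 0 < 1 + c ^+ 2 * E j s by rewrite ltr_pwDl// mulr_ge0 ?sqr_ge0.
    (* This slope minimises [(1 - k * c) ^+ 2 * E j s + k ^+ 2], with minimum
       [E j s / (1 + c ^+ 2 * E j s)]; the term [k ^+ 2] is [k ^+ 2 / 2] for each of the two real
       components. *)
    rewrite -ler_pdivlMr//; apply: le_trans (Erec0 j s (c * E j s / (1 + c ^+ 2 * E j s))) _.
    rewrite le_eqVlt; apply/orP; left; apply/eqP; field; by rewrite gt_eqF.
  have hs j := @stage_sum_bound (c ^+ 2) (2 ^ q)%N (E j) (sqr_ge0 _) (E0 j) (Erec j).
  split; first by move=> j; have [] := hs j; rewrite N1 mul1r EN.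
  have hH u := @stage_entr M _ (y u) (b u) c B (2 ^ q)%N (hB u).
  have hH2 : \sum_(s < 2 ^ q) c ^+ 2 * (n%:R * \sum_j E j s) <=
      \sum_u (entr (b u) - Op (y u) (@entr R M) (b u)) + 2 * B ^+ 2 / 2 ^+ q.
    have -> : 2 * B ^+ 2 / 2 ^+ q = \sum_u (2 ^ q)%:R * (2 * (c ^+ 2 * B) ^+ 2) * mass (b u).
      rewrite -mulr_sumr Sb mulr1.
      transitivity (((2 ^ q)%:R * c ^+ 2) * (2 * c ^+ 2 * B ^+ 2)); last by ring.
      by rewrite N1 c2; ring.
    rewrite -big_split/=.
    have -> : \sum_(s < 2 ^ q) c ^+ 2 * (n%:R * \sum_j E j s) =
       \sum_u \sum_(s < 2 ^ q) c ^+ 2 * \sum_i Opn (z u) s (pcov ((y u)^~ i) ((y u)^~ i)) (b u).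
      rewrite [RHS]exchange_big/=; apply: eq_bigr => s _; rewrite -[RHS]mulr_sumr; congr (_ * _).
      rewrite [RHS]exchange_big/= mulr_sumr.
      transitivity (\sum_j \sum_(i < n) \sum_(a : bool) \sum_u Opn (z u) s (V u i j a) (b u)).
        by apply: eq_bigr => j _; rewrite /E mulrA mulfV ?mul1r// gt_eqF.
      rewrite exchange_big/= pair_big/= pair_big/=.
      by apply: eq_bigr => -[[i j] a] _.
    apply: ler_sum => u _.
    have hq' : c ^+ 2 * B <= 2^-1 by rewrite c2 mulrC.
    have /= := hH u hq'; rewrite -(Op_stages (y u) q (@entr_ntame R M)).
    rewrite -/c -/(z u); lra.
  apply: le_trans hH2; rewrite -mulr_sumr -[X in _ <= c ^+ 2 * X]mulr_sumr.
  rewrite mulrCA ler_wpM2l ?ler0n// exchange_big/= mulr_sumr; apply: ler_sum => j _.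
  by have [_] := hs j; rewrite N1 mul1r EN -mulr_sumr.
have big (eps : R) : 0 < eps -> exists q : nat, B / 2 ^+ q <= 2^-1 /\ 2 * B ^+ 2 / 2 ^+ q <= eps.
  move=> eps0; pose C := 2 * B + 2 * B ^+ 2 / eps.
  have C0 : 0 <= C by rewrite addr_ge0 ?divr_ge0 ?mulr_ge0 ?sqr_ge0// ltW.
  exists (Num.truncn C).+1.
  have p20 : 0 < 2 ^+ (Num.truncn C).+1 :> R by rewrite exprn_gt0.
  have hC : C <= 2 ^+ (Num.truncn C).+1.
    apply: le_trans (ltW (truncnS_gt C)) _; rewrite -natrX ler_nat.
    by apply: ltnW; exact: ltn_expl.
  have h1 : 0 <= 2 * B ^+ 2 / eps by rewrite divr_ge0 ?mulr_ge0 ?sqr_ge0// ltW.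
  move: p20 hC; rewrite /C; move: (2 ^+ _) => X X0 hC.
  split; first by rewrite ler_pdivrMr//; lra.
  rewrite ler_pdivrMr// -ler_pdivrMl// mulrC; lra.
split; first by have [q [/main[]]] := big 1 ltr01.
apply/ler_addgt0Pr => eps eps0; have [q [/main[_ h1] h2]] := big eps eps0.
by apply: le_trans h1 _; rewrite lerD2l.
Qed.

End stages.

(** * Hermitian matrices and the outer region *)

Section hermitian.
Context {R : rcfType}.
Local Notation C := R[i].

Lemma ctrM m n p (A : 'M[C]_(m, n)) (B : 'M[C]_(n, p)) : ctr (A *m B) = ctr B *m ctr A.
Proof. by rewrite /ctr map_mxM trmx_mul. Qed.

Lemma ctrK m n (A : 'M[C]_(m, n)) : ctr (ctr A) = A.
Proof. by apply/matrixP => i j; rewrite !mxE conjcK. Qed.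

Lemma ctrD m n (A B : 'M[C]_(m, n)) : ctr (A + B) = ctr A + ctr B.
Proof. by rewrite /ctr map_mxD linearD. Qed.

Lemma ctrN m n (A : 'M[C]_(m, n)) : ctr (- A) = - ctr A.
Proof. by rewrite /ctr map_mxN linearN. Qed.

Lemma ctrB m n (A B : 'M[C]_(m, n)) : ctr (A - B) = ctr A - ctr B.
Proof. by rewrite ctrD ctrN. Qed.

Lemma ctr1 n : ctr (1%:M : 'M[C]_n) = 1%:M.
Proof. by rewrite /ctr map_mx1 trmx1. Qed.

Lemma ctr0 m n : ctr (0 : 'M[C]_(m, n)) = 0.
Proof. by rewrite /ctr map_mx0 trmx0. Qed.

Lemma ctr_inv n (A : 'M[C]_n) : ctr (invmx A) = invmx (ctr A).
Proof. by rewrite /ctr map_invmx trmx_inv. Qed.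

Lemma ctr_row m n1 n2 (A : 'M[C]_(m, n1)) (B : 'M[C]_(m, n2)) :
  ctr (row_mx A B) = col_mx (ctr A) (ctr B).
Proof. by rewrite /ctr map_row_mx tr_row_mx. Qed.

Lemma ctr_col m1 m2 n (A : 'M[C]_(m1, n)) (B : 'M[C]_(m2, n)) :
  ctr (col_mx A B) = row_mx (ctr A) (ctr B).
Proof. by rewrite /ctr map_col_mx tr_col_mx. Qed.

Lemma ctr_block m1 m2 n1 n2 (A : 'M[C]_(m1, n1)) (B : 'M[C]_(m1, n2))
    (D : 'M[C]_(m2, n1)) (E : 'M[C]_(m2, n2)) :
  ctr (block_mx A B D E) = block_mx (ctr A) (ctr D) (ctr B) (ctr E).
Proof. by rewrite /ctr map_block_mx tr_block_mx. Qed.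

Lemma det_ctr n (A : 'M[C]_n) : \det (ctr A) = conjc (\det A).
Proof. by rewrite /ctr det_tr det_map_mx. Qed.

Lemma psdD n (A B : 'M[C]_n) : psd A -> psd B -> psd (A + B).
Proof.
move=> [hA pA] [hB pB]; split; first by rewrite ctrD hA hB.
by move=> x; rewrite mulmxDr mulmxDl mxE addr_ge0.
Qed.

Lemma psd_conj m n (A : 'M[C]_(m, n)) (Q : 'M[C]_n) : psd Q -> psd (A *m Q *m ctr A).
Proof.
move=> [hQ pQ]; split; first by rewrite !ctrM ctrK hQ mulmxA.
move=> x; have := pQ (ctr A *m x).
by rewrite ctrM ctrK !mulmxA.
Qed.

Lemma sqnorm_ge0 n (x : 'cV[C]_n) : 0 <= (ctr x *m x) 0 0.
Proof.
rewrite mxE; apply: sumr_ge0 => i _; rewrite !mxE mulrC; exact: mul_conjC_ge0.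
Qed.

Lemma psd1 n : psd (1%:M : 'M[C]_n).
Proof. by split => [|x]; rewrite ?ctr1 ?mulmx1 ?sqnorm_ge0. Qed.

Lemma psd0 n : psd (0 : 'M[C]_n).
Proof. by split => [|x]; rewrite ?ctr0 // mulmx0 mul0mx mxE. Qed.

Lemma psd_gram m n (A : 'M[C]_(m, n)) : psd (A *m ctr A).
Proof. by have := psd_conj A (psd1 n); rewrite mulmx1. Qed.

Lemma diag_entry n (l : 'I_n -> R) (i : 'I_n) (D : 'M[C]_n) :
  D = diag_mx (\row_j rc (l j)) -> D i i = rc (l i).
Proof. by move=> ->; rewrite !mxE eqxx mulr1n. Qed.

Lemma herm_diag n (A : 'M[C]_n) : ctr A = A ->
  exists (V : 'M[C]_n) (l : 'I_n -> R),
    [/\ V *m ctr V = 1%:M, ctr V *m V = 1%:M & V *m A *m ctr V = diag_mx (\row_j rc (l j))].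
Proof.
move=> hA.
have hAh : A \is hermsymmx.
  by apply/is_hermitianmxP; rewrite expr0 scale1r -[LHS]hA /ctr map_trmx.
have /hermitian_normalmx/orthomx_spectralP e := hAh.
have uV := spectral_unitarymx A.
have /mxOverP rl := hermitian_spectral_diag_real hAh.
have cV : ctr (spectralmx A) = invmx (spectralmx A).
  by rewrite invmx_unitary// /ctr map_trmx.
exists (spectralmx A), (fun j => complex.Re (spectral_diag A 0 j)).
rewrite cV mulmxV ?mulVmx ?spectral_unit//; split => //.
rewrite {2}e !mulmxA mulmxV ?spectral_unit// mul1mx -mulmxA mulmxV ?spectral_unit// mulmx1.
congr diag_mx; apply/rowP => j; rewrite mxE /rc.
by have := rl 0 j; case: (spectral_diag A 0 j) => a b; rewrite complex_real /= => /eqP ->.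
Qed.

Lemma psd_diag n (A V : 'M[C]_n) (l : 'I_n -> R) : psd A ->
  V *m A *m ctr V = diag_mx (\row_j rc (l j)) -> forall j, 0 <= l j.
Proof.
move=> [_ pA] hV j.
have := pA (ctr V *m delta_mx j 0); rewrite ctrM ctrK !mulmxA.
have -> : ctr (delta_mx j 0 : 'cV[C]_n) = delta_mx 0 j.
  by apply/matrixP => a c; rewrite !mxE andbC; case: (_ && _); rewrite /= ?oppr0.
rewrite -!mulmxA (mulmxA A) (mulmxA V) (mulmxA V) hV mulmxA -rowE -colE !mxE eqxx mulr1n.
by rewrite /rc lecR.
Qed.

(** The sign [s] serves two matrices: [s = 1] for signal plus noise and [s = -1] for
    [1%:M - G *m E *m ctr G]. *)
Lemma det_shift_diag n (A V : 'M[C]_n) (l : 'I_n -> R) (c s : R) :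
  V *m ctr V = 1%:M -> V *m A *m ctr V = diag_mx (\row_j rc (l j)) ->
  \det ((rc c)%:M + rc s *: A) = rc (\prod_j (c + s * l j)).
Proof.
move=> VV hV.
have dV : \det V * \det (ctr V) = 1 by rewrite -det_mulmx VV det1.
transitivity (\det (V *m ((rc c)%:M + rc s *: A) *m ctr V)).
  by rewrite !det_mulmx mulrAC dV mul1r.
rewrite mulmxDr mulmxDl -scalemxAr -scalemxAl hV.
rewrite mul_mx_scalar -scalemxAl VV.
have -> : rc c *: 1%:M + rc s *: diag_mx (\row_j rc (l j)) =
    diag_mx (\row_j rc (c + s * l j)) :> 'M[C]_n.
  apply/matrixP => i j; rewrite !mxE; case: eqP => _; rewrite ?mulr1n ?mulr0n ?mulr0 ?addr0//.
  by rewrite /rc rmorphD rmorphM mulr1.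
by rewrite det_diag /rc rmorph_prod; apply: eq_bigr => j _; rewrite mxE.
Qed.

Lemma psd_det_ge1 n (A : 'M[C]_n) : psd A -> 1 <= \det (1%:M + A).
Proof.
move=> pA; have [V [l [VV _ hV]]] := herm_diag pA.1.
have l0 := psd_diag pA hV.
have := det_shift_diag 1 1 VV hV; rewrite /rc rmorph1 scale1r => ->.
rewrite -[1]/(1%:C)%C lecR -[leLHS]/(1 : R).
apply: (big_ind (fun z => 1 <= z)) => // [x y x1 y1|j _].
  by rewrite -[1]mulr1 ler_pM.
by rewrite mul1r lerDl.
Qed.

Definition pd n (A : 'M[C]_n) : Prop := psd A /\ A \in unitmx.

Lemma pd1D n (A : 'M[C]_n) : psd A -> pd (1%:M + A).
Proof.
move=> pA; split; first exact: psdD (psd1 n) pA.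
rewrite unitmxE unitfE gt_eqF//; apply: lt_le_trans (psd_det_ge1 pA); exact: ltr01.
Qed.

Lemma pd_sqrt n (A : 'M[C]_n) : pd A -> exists2 L, L \in unitmx & L *m ctr L = A.
Proof.
move=> [pA uA]; have [V [l [VV V'V hV]]] := herm_diag pA.1.
have l0 := psd_diag pA hV.
pose D : 'M[C]_n := diag_mx (\row_j rc (Num.sqrt (l j))).
have cD : ctr D = D.
  apply/matrixP => i j; rewrite !mxE eq_sym; case: eqP => [->|_].
    by rewrite !mulr1n /rc /= oppr0.
  by rewrite !mulr0n rmorph0.
have DD : D *m D = diag_mx (\row_j rc (l j)).
  rewrite mulmx_diag; congr diag_mx; apply/rowP => j; rewrite !mxE /rc -rmorphM -expr2.
  by rewrite sqr_sqrtr.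
have LL : (ctr V *m D) *m ctr (ctr V *m D) = A.
  rewrite ctrM ctrK cD mulmxA -(mulmxA _ D D) DD -hV.
  by rewrite !mulmxA V'V mul1mx -mulmxA V'V mulmx1.
exists (ctr V *m D) => //.
by move: uA; rewrite -LL unitmx_mul => /andP[].
Qed.

Lemma pd_det_gt0 n (A : 'M[C]_n) : pd A -> 0 < \det A.
Proof.
move=> pA; have [L uL <-] := pd_sqrt pA; rewrite det_mulmx det_ctr.
have dL : \det L != 0 by rewrite -unitfE -unitmxE.
by rewrite -[conjc _]/(Num.conj (\det L)) mul_conjC_gt0.
Qed.

Lemma pd_det_le n (A B : 'M[C]_n) : pd A -> psd (B - A) -> \det A <= \det B.
Proof.
move=> pA pBA; have [L uL hL] := pd_sqrt pA.
have e : B = L *m (1%:M + invmx L *m (B - A) *m ctr (invmx L)) *m ctr L.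
  rewrite mulmxDr mulmxDl mulmx1 hL !mulmxA mulmxV// mul1mx -mulmxA -ctrM mulmxV// ctr1 mulmx1.
  by rewrite addrC subrK.
have d1 := psd_det_ge1 (psd_conj (invmx L) pBA).
rewrite [in leRHS]e !det_mulmx mulrAC -det_mulmx hL ler_peMr//.
exact: ltW (pd_det_gt0 pA).
Qed.

Lemma pd_inv_herm n (A : 'M[C]_n) : pd A -> ctr (invmx A) = invmx A.
Proof. by move=> [[hA _] _]; rewrite ctr_inv hA. Qed.

Lemma psd_inv n (A : 'M[C]_n) : pd A -> psd (invmx A).
Proof.
move=> pA; have := psd_conj (invmx A) pA.1; have uA := pA.2.
by rewrite pd_inv_herm// mulVmx// mul1mx.
Qed.

Lemma det_schur m n (A : 'M[C]_m) (B : 'M[C]_(m, n)) (D : 'M[C]_(n, m)) (E : 'M[C]_n) :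
  A \in unitmx -> \det (block_mx A B D E) = \det A * \det (E - D *m invmx A *m B).
Proof.
move=> uA.
have -> : block_mx A B D E =
    block_mx 1%:M 0 (D *m invmx A) 1%:M *m block_mx A B 0 (E - D *m invmx A *m B).
  rewrite mulmx_block !mul1mx !mul0mx !addr0 mulmxKV//; congr block_mx.
  by rewrite addrCA subrr addr0.
by rewrite det_mulmx det_lblock det_ublock !det1 !mul1r.
Qed.

End hermitian.

(** * Whitening, Gaussian errors and the covariance built from the error *)

Section region.
Context {R : realType}.
Local Notation C := R[i].

(** These are the two Schur complements of [Sigmaz Qz]: compressing by [row_mx (- ctr Qz) 1%:M] or
    [row_mx 1%:M (- Qz)] gives semidefiniteness, and the nonzero determinant gives invertibility. *)
Lemma Sigmaz_pd (p c : nat) (Qz : 'M[C]_(p, c)) : admissible Qz ->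
  pd (1%:M - ctr Qz *m Qz) /\ pd (1%:M - Qz *m ctr Qz).
Proof.
move=> [pS dS]; split; split.
- have := psd_conj (row_mx (- ctr Qz) 1%:M) pS.
  rewrite /Sigmaz ctr_row ctr1 ctrN ctrK mul_row_block mul_row_col !mul1mx !mulmx1.
  by rewrite addNr mul0mx add0r mulNmx addrC.
- move: dS; rewrite /Sigmaz det_schur ?unitmx1// det1 mul1r invmx1 mulmx1 => d0.
  by rewrite unitmxE unitfE gt_eqF.
- have := psd_conj (row_mx 1%:M (- Qz)) pS.
  rewrite /Sigmaz ctr_row ctr1 ctrN mul_row_block mul_row_col !mul1mx !mulmx1.
  by rewrite subrr mul0mx addr0 mulNmx.
- move: dS; rewrite /Sigmaz.
  have -> : block_mx 1%:M Qz (ctr Qz) 1%:M =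
     block_mx (1%:M - Qz *m ctr Qz) Qz 0 1%:M *m block_mx 1%:M 0 (ctr Qz) 1%:M.
    by rewrite mulmx_block !mulmx1 ?mulmx0 ?mul0mx !mul1mx !add0r subrK.
  rewrite det_mulmx det_ublock det_lblock !det1 !mulr1 => d0.
  by rewrite unitmxE unitfE gt_eqF.
Qed.

Lemma conj_1D (m k : nat) (T : 'M[C]_m) (F : 'M[C]_(m, k)) (Q : 'M[C]_k) :
  T *m (1%:M + F *m Q *m ctr F) *m ctr T = T *m ctr T + T *m F *m Q *m ctr (T *m F).
Proof. by rewrite mulmxDr mulmxDl mulmx1 ctrM !mulmxA. Qed.

(* Two factorisations of [Sigmaz Qz], one starting from either receiver, differ by a unitary. *)
Lemma whitening (p c k : nat) (Qz : 'M[C]_(p, c)) (G : 'M[C]_(p, k)) (H : 'M[C]_(c, k)) :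
  admissible Qz -> exists (D : 'M[C]_(c, k)) (V : 'M[C]_(p, k)) (O : 'M[C]_(p + c)),
  [/\ O *m ctr O = 1%:M, O *m col_mx V H = col_mx G D &
   forall Q, \det (Sigmaz Qz + col_mx G H *m Q *m ctr (col_mx G H)) =
     \det (Sigmaz Qz) * \det (1%:M + col_mx G D *m Q *m ctr (col_mx G D))].
Proof.
move=> adm; have [/pd_sqrt[L uL hL] /pd_sqrt[L2 uL2 hL2]] := Sigmaz_pd adm.
(* Both triangular factors square to [Sigmaz Qz]. Dividing by [T] leaves the first receiver [G]
   untouched, dividing by [T2] leaves the second receiver [H] untouched. *)
pose T : 'M[C]_(p + c) := block_mx 1%:M 0 (ctr Qz) L.
pose T2 : 'M[C]_(p + c) := block_mx L2 Qz 0 1%:M.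
have TT : T *m ctr T = Sigmaz Qz.
  rewrite /T ctr_block ctr1 ctr0 ctrK mulmx_block !mul1mx !mulmx1 ?mul0mx ?mulmx0 !addr0.
  by rewrite hL addrC subrK.
have TT2 : T2 *m ctr T2 = Sigmaz Qz.
  rewrite /T2 ctr_block ctr1 ctr0 mulmx_block !mul1mx !mulmx1 ?mul0mx ?mulmx0 !add0r.
  by rewrite hL2 subrK.
have uT : T \in unitmx by rewrite unitmxE det_lblock det1 mul1r -unitmxE.
have uT2 : T2 \in unitmx by rewrite unitmxE det_ublock det1 mulr1 -unitmxE.
pose K := col_mx G H; pose F := invmx T *m K; pose F2 := invmx T2 *m K.
have TF : T *m F = K by rewrite /F mulmxA mulmxV// mul1mx.
have TF2 : T2 *m F2 = K by rewrite /F2 mulmxA mulmxV// mul1mx.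
have FE : F = col_mx G (dsubmx F).
  rewrite -[LHS]vsubmxK; congr col_mx.
  move: TF; rewrite -[F in LHS]vsubmxK /T mul_block_col mul1mx mul0mx addr0.
  by move=> /eq_col_mx[].
have F2E : F2 = col_mx (usubmx F2) H.
  rewrite -[LHS]vsubmxK; congr col_mx.
  move: TF2; rewrite -[F2 in LHS]vsubmxK /T2 mul_block_col mul1mx mul0mx add0r.
  by move=> /eq_col_mx[].
exists (dsubmx F), (usubmx F2), (invmx T *m T2); split.
- rewrite ctrM mulmxA -[invmx T *m T2 *m _]mulmxA TT2 -TT.
  by rewrite mulmxA (mulVmx uT) mul1mx -ctrM (mulVmx uT) ctr1.
- by rewrite -F2E -FE -mulmxA TF2.
- move=> Q; rewrite -FE -/K.
  have -> : Sigmaz Qz + K *m Q *m ctr K = T *m (1%:M + F *m Q *m ctr F) *m ctr T.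
    by rewrite conj_1D TT TF.
  by rewrite !det_mulmx mulrAC -det_mulmx TT.
Qed.

Definition mmse_gauss (p k : nat) (G : 'M[C]_(p, k)) (Q : 'M[C]_k) : 'M[C]_k :=
  Q - Q *m ctr G *m invmx (1%:M + G *m Q *m ctr G) *m G *m Q.

(** The chain rule for a Gaussian input: the Schur complement of the [G] block is the covariance of
    the second output given the first. *)
Lemma det_channels (p c k : nat) (G : 'M[C]_(p, k)) (D : 'M[C]_(c, k)) (Q : 'M[C]_k) : psd Q ->
  \det (1%:M + col_mx G D *m Q *m ctr (col_mx G D)) =
  \det (1%:M + G *m Q *m ctr G) * \det (1%:M + D *m mmse_gauss G Q *m ctr D).
Proof.
move=> pQ; have [_ u] := pd1D (psd_conj G pQ).
rewrite mul_col_mx ctr_col mul_col_row scalar_mx_block add_block_mx !add0r (det_schur _ _ _ u).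
congr (_ * \det _); rewrite /mmse_gauss -addrA mulmxBr mulmxBl; congr (_ + (_ - _)).
by rewrite !mulmxA.
Qed.

(** [S *m ctr G *m X] is the optimal linear gain, [X] being the inverse output covariance. The
    identity [X *m X + X *m (G *m S *m ctr G) *m X = X] merges the noise term with the quadratic
    one. *)
Lemma mmse_linear (p k : nat) (G : 'M[C]_(p, k)) (S : 'M[C]_k) (X : 'M[C]_p) :
  ctr X = X -> ctr S = S -> X *m (1%:M + G *m S *m ctr G) = 1%:M ->
  (1%:M - S *m ctr G *m X *m G) *m S *m ctr (1%:M - S *m ctr G *m X *m G)
    + S *m ctr G *m X *m ctr (S *m ctr G *m X) = S - S *m ctr G *m X *m G *m S.
Proof.
move=> cX hS hX.
have : exists M : 'M[C]_(p, k), M = G *m S by exists (G *m S).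
move=> [M hM]; have cM : S *m ctr G = ctr M by rewrite hM ctrM hS.
have cA : ctr (ctr M *m X) = X *m M by rewrite ctrM ctrK cX.
rewrite cM cA ctrB ctr1 ctrM cA -!(mulmxA _ G S) -hM.
have -> : (1%:M - ctr M *m X *m G) *m S = S - ctr M *m X *m M.
  by rewrite mulmxBl mul1mx -(mulmxA _ G S) -hM.
have -> : (S - ctr M *m X *m M) *m (1%:M - ctr G *m (X *m M)) =
    S - ctr M *m X *m M - ctr M *m X *m M + ctr M *m X *m (M *m ctr G) *m (X *m M).
  rewrite mulmxBr mulmx1 mulmxBl opprB (mulmxA S) cM (mulmxA _ X M).
  by rewrite -!addrA; congr (_ + (_ + _)); rewrite addrC !mulmxA.
have hX' : X *m X + X *m (M *m ctr G) *m X = X.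
  transitivity (X *m (1%:M + M *m ctr G) *m X); last by rewrite hM hX mul1mx.
  by rewrite mulmxDr mulmx1 mulmxDl.
rewrite -addrA.
suff -> : ctr M *m X *m (M *m ctr G) *m (X *m M) + ctr M *m X *m (X *m M) = ctr M *m X *m M.
  by rewrite subrK.
by rewrite -[in RHS]hX' mulmxDr mulmxDl addrC !mulmxA.
Qed.

Section candidate.
Variables (p k : nat) (G : 'M[C]_(p, k)) (E S : 'M[C]_k).
Hypotheses (pE : psd E) (pS : psd S) (pN : pd (1%:M - G *m E *m ctr G)).
Hypothesis hE : forall A : 'M[C]_(k, p),
  psd ((1%:M - A *m G) *m S *m ctr (1%:M - A *m G) + A *m ctr A - E).

Let N := 1%:M - G *m E *m ctr G.
Let B := invmx N *m G *m E.

(* The Gaussian input covariance whose MMSE through [G] is exactly [E]. *)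
Definition Qcand : 'M[C]_k := E + E *m ctr G *m B.

Let hEc : ctr E = E := pE.1.
Let uN : N \in unitmx := pN.2.
Let ctr_gain : ctr B = E *m ctr G *m invmx N.
Proof. by rewrite /B !ctrM hEc (pd_inv_herm pN) mulmxA. Qed.

Let NB : N *m B = G *m E.
Proof. by rewrite /B -(mulmxA (invmx N)) (mulmxA N) (mulmxV uN) mul1mx. Qed.

Lemma Qcand_psd : psd Qcand.
Proof.
apply: (psdD pE).
have -> : E *m ctr G *m B = (E *m ctr G) *m invmx N *m ctr (E *m ctr G).
  by rewrite /B ctrM ctrK hEc !mulmxA.
by apply: psd_conj; exact: psd_inv.
Qed.

(** For a Gaussian input of error [E] the optimal gain is [E *m ctr G]. At this gain [hE] would be
    an equality if [S] were [Qcand]; conjugating by [W], the inverse of [1%:M - E *m ctr G *m G],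
    isolates [S] and turns the rest into [- Qcand]. *)
Lemma Qcand_le : psd (S - Qcand).
Proof.
pose W := 1%:M + ctr B *m G.
have WA : W *m (E *m ctr G) = ctr B.
  rewrite /W mulmxDl mul1mx ctr_gain.
  have -> : E *m ctr G *m invmx N *m G *m (E *m ctr G) =
     (E *m ctr G) *m invmx N *m (1%:M - N) by rewrite /N opprB addrCA subrr addr0 !mulmxA.
  by rewrite mulmxBr mulmx1 mulmxKV// addrC subrK.
have WG : W *m (1%:M - E *m ctr G *m G) = 1%:M.
  by rewrite mulmxBr mulmx1 mulmxA WA /W addrK.
have := psd_conj W (hE (E *m ctr G)).
rewrite mulmxBr mulmxBl mulmxDr mulmxDl.
have -> : W *m ((1%:M - E *m ctr G *m G) *m S *m ctr (1%:M - E *m ctr G *m G)) *m ctr W = S.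
  by rewrite !mulmxA WG mul1mx -mulmxA -ctrM WG ctr1 mulmx1.
have -> : W *m (E *m ctr G *m ctr (E *m ctr G)) *m ctr W = ctr B *m B.
  by rewrite (mulmxA W) -mulmxA -ctrM WA ctrK.
have -> : W *m E *m ctr W = Qcand + ctr B *m B.
  have -> : W *m E *m ctr W = E + ctr B *m G *m E + E *m ctr G *m B
      + ctr B *m G *m E *m ctr G *m B.
    by rewrite /W ctrD ctr1 ctrM ctrK mulmxDl mul1mx mulmxDr mulmx1 mulmxDl !mulmxA addrA.
  have e2 : E *m ctr G *m B = ctr B *m N *m B by rewrite ctr_gain (mulmxKV uN).
  have e3 : ctr B *m G *m E *m ctr G *m B = ctr B *m B - ctr B *m N *m B.
    rewrite -mulmxBl -[X in X - _]mulmx1 -mulmxBr.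
    by rewrite /N opprB addrCA subrr addr0 !mulmxA.
  have e1 : ctr B *m G *m E = ctr B *m N *m B by rewrite -[RHS]mulmxA NB mulmxA.
  rewrite e3 e1 e2 /Qcand e2; move: (ctr B *m N *m B) => Y.
  by rewrite -!addrA; congr (_ + (_ + _)); rewrite addrCA subrr addr0.
by rewrite [Qcand + _]addrC addrKA.
Qed.

Let GQ : G *m Qcand = B.
Proof.
have PB : G *m (E *m ctr G *m B) = B - G *m E.
  transitivity ((1%:M - N) *m B); first by rewrite /N opprB addrCA subrr addr0 !mulmxA.
  by rewrite mulmxBl mul1mx NB.
by rewrite /Qcand mulmxDr PB addrC subrK.
Qed.

(** The Woodbury identity. Taking determinants, the Gaussian information of [Qcand] through [G] is
    [- ln |N|], precisely the lower bound available for [I_c] per channel use. *)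
Lemma Qcand_inv : (1%:M + G *m Qcand *m ctr G) *m N = 1%:M.
Proof.
rewrite GQ mulmxDl mul1mx.
have -> : B *m ctr G = invmx N - 1%:M.
  have -> : B *m ctr G = invmx N *m (1%:M - N).
    by rewrite /B /N opprB addrCA subrr addr0 !mulmxA.
  by rewrite mulmxBr mulmx1 mulVmx.
by rewrite mulmxBl mulVmx// mul1mx addrC subrK.
Qed.

Lemma Qcand_det : \det (1%:M + G *m Qcand *m ctr G) * \det N = 1.
Proof. by rewrite -det_mulmx Qcand_inv det1. Qed.

Lemma Qcand_mmse : mmse_gauss G Qcand = E.
Proof.
have inv : invmx (1%:M + G *m Qcand *m ctr G) = N.
  have [u _] := mulmx1_unit Qcand_inv.
  by rewrite -[RHS](mulKmx u) Qcand_inv mulmx1.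
have QG : Qcand *m ctr G = ctr B by rewrite -[in RHS]GQ ctrM Qcand_psd.1.
rewrite /mmse_gauss inv QG -(mulmxA _ G Qcand) GQ ctr_gain (mulmxKV uN) /Qcand addrK.
by [].
Qed.

(** This is [hE] at the gain that is optimal for the covariance [S]. *)
Lemma mmse_gauss_ge : psd (mmse_gauss G S - E).
Proof.
have pS1 := pd1D (psd_conj G pS).
pose X := invmx (1%:M + G *m S *m ctr G).
have cX : ctr X = X := pd_inv_herm pS1.
have hS : ctr S = S := pS.1.
have hX : X *m (1%:M + G *m S *m ctr G) = 1%:M := mulVmx pS1.2.
by have := hE (S *m ctr G *m X); rewrite (mmse_linear cX hS hX).
Qed.

End candidate.

End region.

(** * Logarithms of determinants and convex combinations of rate pairs *)

Section hull.
Context {R : realType}.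
Local Notation C := R[i].

Definition lndet n (M : 'M[C]_n) : R := ln (complex.Re (\det M)).

Lemma logdetE n (M : 'M[C]_n) : logdet M = lndet M / ln 2.
Proof. by []. Qed.

Lemma det_rc n (M : 'M[C]_n) : 0 < \det M ->
  \det M = rc (complex.Re (\det M)) /\ 0 < complex.Re (\det M).
Proof.
by rewrite ltcE /rc; case: (\det M) => a b /= /andP[/eqP -> ->].
Qed.

Lemma lndetM_eq m n p (M : 'M[C]_m) (A : 'M[C]_n) (B : 'M[C]_p) :
  0 < \det A -> 0 < \det B -> \det M = \det A * \det B ->
  0 < \det M /\ lndet M = lndet A + lndet B.
Proof.
move=> A0 B0 h; split; first by rewrite h mulr_gt0.
have [eA a0] := det_rc A0; have [eB b0] := det_rc B0.
rewrite /lndet h eA eB /rc -rmorphM /= lnM ?posrE//.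
Qed.

Lemma lndet_le n (A B : 'M[C]_n) : pd A -> psd (B - A) -> lndet A <= lndet B.
Proof.
move=> pA pB; have := pd_det_le pA pB; have A0 := pd_det_gt0 pA.
have [_ a0] := det_rc A0.
move=> h; have [_ b0] := det_rc (lt_le_trans A0 h).
move: h; rewrite lecE => /andP[_ h].
by rewrite /lndet ler_ln.
Qed.

Lemma lndet_1D_le m n (X : 'M[C]_(m, n)) (A B : 'M[C]_n) : psd A -> psd (B - A) ->
  lndet (1%:M + X *m A *m ctr X) <= lndet (1%:M + X *m B *m ctr X).
Proof.
move=> pA pB; apply: lndet_le; first exact: pd1D (psd_conj _ pA).
by rewrite opprD addrACA subrr add0r -mulmxBl -mulmxBr; exact: psd_conj.
Qed.

Lemma lndet_ge0 n (A : 'M[C]_n) : psd A -> 0 <= lndet (1%:M + A).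
Proof.
move=> pA; have := psd_det_ge1 pA; rewrite lecE /lndet /= => /andP[_ h].
exact: ln_ge0.
Qed.

Lemma frac_exists (r X : R) : 0 <= r -> r <= X -> exists f, [/\ 0 <= f, f <= 1 & f * X = r].
Proof.
move=> r0 rX; exists (r / X); have X0 := le_trans r0 rX; split.
- exact: divr_ge0.
- have [->|Xn0] := eqVneq X 0; first by rewrite invr0 mulr0.
  by rewrite ler_pdivrMr ?mul1r// lt_neqAle eq_sym Xn0.
- have [X00|Xn0] := eqVneq X 0; last by rewrite divfK.
  by rewrite X00 mulr0; apply/esym/eqP; rewrite eq_le r0 andbT -X00.
Qed.

(** [conv2] asks for equality with a convex combination. A dominated pair is reached by scaling the
    first coordinates of both end points by one common factor and the second coordinates by
    another. *)
Lemma conv2_segment (A : set (R * R)) (p1 p2 q1 q2 th r1 r2 : R) :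
  (forall f1 f2, 0 <= f1 <= 1 -> 0 <= f2 <= 1 -> A (f1 * p1, f2 * q1)) ->
  (forall f1 f2, 0 <= f1 <= 1 -> 0 <= f2 <= 1 -> A (f1 * p2, f2 * q2)) ->
  0 <= th <= 1 -> 0 <= r1 -> 0 <= r2 ->
  r1 <= (1 - th) * p1 + th * p2 -> r2 <= (1 - th) * q1 + th * q2 ->
  conv2 A (r1, r2).
Proof.
move=> h1 h2 /andP[th0 th1] r10 r20 hr1 hr2.
have [f1 [f10 f11 e1]] := frac_exists r10 hr1.
have [f2 [f20 f21 e2]] := frac_exists r20 hr2.
exists 2%N, (fun i : 'I_2 => if i == ord0 then 1 - th else th),
  (fun i : 'I_2 => if i == ord0 then (f1 * p1, f2 * q1) else (f1 * p2, f2 * q2)).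
split; first by move=> i; case: ifP => _ //; rewrite subr_ge0.
split; first by rewrite !big_ord_recl big_ord0/= addr0 subrK.
split.
  by move=> i; case: ifP => _; [apply: h1|apply: h2]; apply/andP.
rewrite !big_ord_recl !big_ord0/= !addr0 -e1 -e2.
by congr pair; ring.
Qed.

Lemma segment_num (a0 a1 ld th iota : R) : th * (a1 - a0) = iota - a0 ->
  a1 - iota = (1 - th) * (a1 - a0) /\ iota + ld = (1 - th) * (a0 + ld) + th * (a1 + ld).
Proof. by move=> h; split; lra. Qed.

(* Time sharing between the inputs attaining [a0] and [a1], in the proportion that yields [iota]. *)
Lemma conv2_tradeoff (A : set (R * R)) (a0 a1 ld b1 iota r1 r2 l2 : R) :
  0 < l2 -> 0 <= a0 -> 0 <= ld -> a0 <= a1 -> a1 + ld <= b1 -> a0 <= iota -> iota <= a1 ->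
  (forall x y, 0 <= x -> 0 <= y -> x <= (a1 - a0) / l2 -> y <= (a0 + ld) / l2 -> A (x, y)) ->
  (forall y, 0 <= y -> y <= b1 / l2 -> A (0, y)) ->
  0 <= r1 -> 0 <= r2 -> r1 * l2 <= a1 - iota -> r2 * l2 <= iota + ld -> conv2 A (r1, r2).
Proof.
move=> l20 a00 ld0 a01 ab h0 h1 hA1 hA2 r10 r20 hr1 hr2.
have [th [th0 th1 thE]] : exists th, [/\ 0 <= th, th <= 1 & th * (a1 - a0) = iota - a0].
  by apply: frac_exists; rewrite ?subr_ge0 ?lerD2r.
have [e1 e2] := segment_num ld thE.
apply: (@conv2_segment A ((a1 - a0) / l2) 0 ((a0 + ld) / l2) (b1 / l2) th) => //.
- move=> f1 f2 /andP[f10 f11] /andP[f20 f21]; apply: hA1.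
  + by rewrite mulr_ge0// divr_ge0 ?subr_ge0// ltW.
  + by rewrite mulr_ge0// divr_ge0 ?addr_ge0// ltW.
  + by rewrite ler_piMl// divr_ge0 ?subr_ge0// ltW.
  + by rewrite ler_piMl// divr_ge0 ?addr_ge0// ltW.
- move=> f1 f2 /andP[f10 f11] /andP[f20 f21]; rewrite mulr0.
  have b10 : 0 <= b1 by lra.
  have b0 : 0 <= b1 / l2 by rewrite divr_ge0// ltW.
  by apply: hA2; [rewrite mulr_ge0|rewrite ler_piMl].
- by rewrite th0.
- by rewrite mulr0 addr0 mulrA ler_pdivlMr// -e1.
- rewrite !mulrA -mulrDl ler_pdivlMr//; apply: le_trans hr2 _; rewrite e2.
  by rewrite lerD2l ler_wpM2l.
Qed.

Lemma Rout_conv (npt nct npr ncr : nat)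
  (Hpp : 'M[C]_(npr, npt)) (Hcp : 'M[C]_(npr, nct)) (Hcc : 'M[C]_(ncr, nct))
  (Pp Pc alpha : R) (Qz : 'M[C]_(npr, ncr)) (D : 'M[C]_(ncr, npt + nct))
  (E S : 'M[C]_(npt + nct)) (iota r1 r2 : R)
  (G := Galpha Hpp Hcp alpha) (K := Kbar Hpp Hcp Hcc alpha) :
  (forall Q, \det (Sigmaz Qz + K *m Q *m ctr K) =
     \det (Sigmaz Qz) * \det (1%:M + col_mx G D *m Q *m ctr (col_mx G D))) ->
  0 < \det (Sigmaz Qz) -> psd E -> psd S -> pd (1%:M - G *m E *m ctr G) ->
  (forall A, psd ((1%:M - A *m G) *m S *m ctr (1%:M - A *m G) + A *m ctr A - E)) ->
  complex.Re (\tr S) <= Pp + alpha * Pc ->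
  - lndet (1%:M - G *m E *m ctr G) <= iota -> iota <= lndet (1%:M + G *m S *m ctr G) ->
  0 <= r1 -> 0 <= r2 ->
  r1 * ln 2 <= lndet (1%:M + G *m S *m ctr G) - iota ->
  r2 * ln 2 <= iota + lndet (1%:M + D *m E *m ctr D) ->
  conv2 (Rout_pre Hpp Hcp Hcc Pp Pc alpha Qz) (r1, r2).
Proof.
move=> hK dS pE pS pN hE trS hi1 hi2 r10 r20 hr1 hr2.
have ln20 : 0 < ln 2 :> R by rewrite ln_gt0// ltr1n.
pose Q := Qcand G E.
have pQ : psd Q := Qcand_psd pE pN.
have pSQ : psd (S - Q) := Qcand_le pE pN hE.
pose a1 := lndet (1%:M + G *m S *m ctr G).
pose a0 := lndet (1%:M + G *m Q *m ctr G).
pose ld := lndet (1%:M + D *m E *m ctr D).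
have dpos n (A : 'M[C]_n) : psd A -> 0 < \det (1%:M + A).
  by move=> pA; exact: pd_det_gt0 (pd1D pA).
have a0E : a0 = - lndet (1%:M - G *m E *m ctr G).
  have := Qcand_det pN; rewrite -/Q => h.
  (* The value 1 in [Qcand_det] is presented as the determinant of a 1 by 1 identity to fit
     [lndetM_eq]. *)
  have [] := @lndetM_eq _ _ _ (1%:M : 'M[C]_1) _ _ (dpos _ _ (psd_conj G pQ)) (pd_det_gt0 pN).
    by rewrite det1 h.
  by rewrite {1}/lndet det1 /= ln1 => _ /eqP; rewrite eq_sym addr_eq0 => /eqP.
have ld0 : 0 <= ld by apply: lndet_ge0; exact: psd_conj.
have a00 : 0 <= a0 by apply: lndet_ge0; exact: psd_conj.
have JE Q' : psd Q' -> psd (mmse_gauss G Q') -> lndet (Sigmaz Qz + K *m Q' *m ctr K) - lndet (Sigmaz Qz) =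
   lndet (1%:M + G *m Q' *m ctr G) + lndet (1%:M + D *m mmse_gauss G Q' *m ctr D).
  move=> pQ' pM.
  have [d1 e1] := lndetM_eq (dpos _ _ (psd_conj G pQ')) (dpos _ _ (psd_conj D pM))
    (det_channels G D pQ').
  by have [_ ->] := lndetM_eq dS d1 (hK Q'); rewrite e1 addrAC subrr add0r.
have JQ : lndet (Sigmaz Qz + K *m Q *m ctr K) - lndet (Sigmaz Qz) = a0 + ld.
  have mQ : mmse_gauss G Q = E := Qcand_mmse pE pN.
  by rewrite JE ?mQ.
have pmS : psd (mmse_gauss G S).
  by have := psdD (mmse_gauss_ge pS hE) pE; rewrite subrK.
(* The Gaussian input of covariance [S] leaves an error above [E], so it conveys at least [ld]
   through [D] once the output of [G] is known. *)
have JS : a1 + ld <= lndet (Sigmaz Qz + K *m S *m ctr K) - lndet (Sigmaz Qz).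
  rewrite (JE S pS pmS); apply: lerD; first exact: lexx.
  exact: lndet_1D_le pE (mmse_gauss_ge pS hE).
have a01 : a0 <= a1 := lndet_1D_le G pQ pSQ.
apply: (conv2_tradeoff ln20 a00 ld0 a01 JS) hi2 _ _ r10 r20 hr1 hr2; first by rewrite a0E.
- move=> x y x0 y0 hx hy; split => //; split => //.
  exists (S - Q), Q; split => //; split => //; split; first by rewrite -mxtraceD subrK.
  split.
    rewrite !logdetE -mulrBl -/G.
    have -> : 1%:M + G *m (S - Q) *m ctr G + G *m Q *m ctr G = 1%:M + G *m S *m ctr G.
      by rewrite -addrA -mulmxDl -mulmxDr subrK.
    exact: hx.
  by rewrite !logdetE -mulrBl -/K JQ; exact: hy.
- move=> y y0 hy; split => //; split => //.
  exists 0, S; split; first exact: psd0.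
  split => //; split; first by rewrite mxtrace0 add0r.
  split; first by rewrite !logdetE -mulrBl -/G mulmx0 mul0mx addr0 subrr mul0r.
  by rewrite !logdetE -mulrBl -/K; exact: hy.
Qed.

End hull.

(** * Complex signals and covariance matrices *)

Section complexsignals.
Context {R : realType}.
Local Notation vec := (@vec R).
Local Notation C := R[i].

(* time, antenna, and real ([true]) or imaginary part *)
Definition ind (n q : nat) : finType := ('I_n * 'I_q * bool)%type.

Definition flat (n q : nat) (Y : 'I_n -> 'cV[C]_q) : vec (ind n q) :=
  fun k => cpart k.2 (Y k.1.1 k.1.2 0).

Definition unflat (n q : nat) (f : vec (ind n q)) : 'I_n -> 'cV[C]_q :=
  fun i => \col_j (f (i, j, true) +i* f (i, j, false))%C.

Lemma flatK (n q : nat) : cancel (@flat n q) (@unflat n q).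
Proof.
move=> Y; apply/funext => i; apply/matrixP => j l; rewrite !mxE /flat /=.
by rewrite ord1; case: (Y i j 0).
Qed.

Lemma unflatK (n q : nat) : cancel (@unflat n q) (@flat n q).
Proof. by move=> f; apply/funext => -[[i j] []]; rewrite /flat /= mxE. Qed.

Lemma cpartD b (x y : C) : cpart b (x + y) = cpart b x + cpart b y.
Proof. by case: b; case: x; case: y. Qed.

Lemma cpartN b (x : C) : cpart b (- x) = - cpart b x.
Proof. by case: b; case: x. Qed.

Lemma cpartB b (x y : C) : cpart b (x - y) = cpart b x - cpart b y.
Proof. by rewrite cpartD cpartN. Qed.

Lemma cpart_sum b (I : finType) (F : I -> C) : cpart b (\sum_i F i) = \sum_i cpart b (F i).
Proof.
by apply: (big_morph (cpart b)) => [x y|]; [exact: cpartD|case: b].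
Qed.

Lemma normc_sqr (z : C) : z * conjc z = rc (\sum_(b : bool) cpart b z ^+ 2).
Proof.
by rewrite big_bool/=; case: z => a b; simpc; rewrite /rc; congr (_ +i* _)%C; ring.
Qed.

Lemma sqn_flat (n q : nat) (Y : 'I_n -> 'cV[C]_q) :
  rc (sqn (flat Y)) = \sum_i (ctr (Y i) *m Y i) 0 0.
Proof.
have -> : sqn (flat Y) = \sum_(i < n) \sum_(j < q) \sum_(b : bool) cpart b (Y i j 0) ^+ 2.
  by rewrite pair_big/= pair_big/=; apply: eq_bigr => -[[i j] b] _.
rewrite /rc rmorph_sum; apply: eq_bigr => i _; rewrite mxE rmorph_sum; apply: eq_bigr => j _.
by rewrite !mxE mulrC normc_sqr.
Qed.

Definition mxact (n q : nat) (V : 'M[C]_q) (f : vec (ind n q)) : vec (ind n q) :=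
  flat (fun i => V *m unflat f i).

Lemma measurable_mxact (n q : nat) (V : 'M[C]_q) : measurable_fun setT (@mxact n q V).
Proof.
apply: measurable_vec => -[[i j] b].
have -> : (fun f : vec (ind n q) => mxact V f (i, j, b)) = fun f =>
    \sum_r (cpart b (V j r) * f (i, r, true) + cpart b (V j r * 'i%C) * f (i, r, false)).
  apply/funext => f; rewrite /mxact /flat /= mxE cpart_sum; apply: eq_bigr => r _.
  rewrite mxE; case: (V j r) => x y; case: b; simpc => /=; ring.
apply: measurable_sum => r.
by apply: measurable_funD; apply: measurable_funM => //; exact: measurable_coord.
Qed.

Lemma mxactB (n q : nat) (V : 'M[C]_q) (f g : vec (ind n q)) :
  mxact V (fun k => f k - g k) = fun k => mxact V f k - mxact V g k.
Proof.
apply/funext => k; rewrite /mxact /flat -cpartB; congr (cpart _ _).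
have -> : unflat (fun k => f k - g k) k.1.1 = unflat f k.1.1 - unflat g k.1.1.
  by apply/matrixP => j l; rewrite !mxE; simpc.
by rewrite mulmxBr !mxE.
Qed.

Lemma mxactK (n q : nat) (V W : 'M[C]_q) : W *m V = 1%:M ->
  cancel (@mxact n q V) (@mxact n q W).
Proof.
move=> WV f; rewrite /mxact flatK -[RHS]unflatK; congr flat; apply/funext => i.
by rewrite mulmxA WV mul1mx.
Qed.

Lemma mxact_sqn (n q : nat) (V : 'M[C]_q) (f : vec (ind n q)) : ctr V *m V = 1%:M ->
  sqn (mxact V f) = sqn f.
Proof.
move=> VV; have h := sqn_flat (fun i => V *m unflat f i).
have h2 := sqn_flat (unflat f); rewrite unflatK in h2.
have : rc (sqn (mxact V f)) = rc (sqn f).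
  rewrite h h2; apply: eq_bigr => i _.
  by rewrite ctrM mulmxA -(mulmxA _ (ctr V)) VV mulmx1.
by move=> [].
Qed.

Section sig.
Variables (T : finType) (n k : nat) (X : T -> 'I_n -> 'cV[C]_k).

Definition sig (q : nat) (H : 'M[C]_(q, k)) (t : T) : vec (ind n q) :=
  flat (fun i => H *m X t i).

Lemma sig_unitary (q : nat) (V : 'M[C]_q) (H : 'M[C]_(q, k)) t :
  sig (V *m H) t = mxact V (sig H t).
Proof. by rewrite /mxact /sig flatK; congr flat; apply/funext => i; rewrite mulmxA. Qed.

(** A unitary matrix acts isometrically on the real coordinates, so [Op_rot] applies; this is the
    circular symmetry of the noise. *)
Lemma Op_unitary (q : nat) (V : 'M[C]_q) (H : 'M[C]_(q, k)) Phi b :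
  V *m ctr V = 1%:M -> ntame Phi -> Op (sig (V *m H)) Phi b = Op (sig H) Phi b.
Proof.
move=> VV nP; have V'V := mulmx1C VV.
have -> : sig (V *m H) = fun t => mxact V (sig H t) by apply/funext => t; rewrite sig_unitary.
apply: (@Op_rot R T _ (sig H) (mxact V) (mxact (ctr V))) => //.
- exact: measurable_mxact.
- exact: measurable_mxact.
- exact: mxactB.
- exact: mxactB.
- exact: mxactK.
- exact: mxactK.
- by move=> f; exact: mxact_sqn.
Qed.

End sig.

Lemma is_gauss_reindex (J K : finType) (h : J -> K) (h' : K -> J) :
  cancel h h' -> cancel h' h ->
  is_gauss (@gauss R K) (fun f : vec K => (fun j => f (h j)) : vec J).
Proof.
move=> hK h'K; split; first by apply: measurable_vec => j; exact: measurable_coord.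
move=> B mB.
have -> : (fun f : vec K => (fun j => f (h j)) : vec J) @^-1` box B = box (fun k => B (h' k)).
  apply/seteqP; split => f /= H i; first by have := H (h' i); rewrite h'K.
  by have := H (h i); rewrite hK.
rewrite [LHS]((gaussP K).2 (fun k => B (h' k)) (fun k => mB (h' k))); congr (_%:E).
rewrite [RHS](reindex h')//; exists h => i _; [exact: h'K|exact: hK].
Qed.

Lemma Op_reindex (T J K : finType) (h : J -> K) (h' : K -> J) (y : T -> vec K) Phi b :
  cancel h h' -> cancel h' h -> ntame Phi ->
  Op (fun t => (fun j => y t (h j)) : vec J) Phi b = Op y Phi b.
Proof.
move=> hK h'K [cP P0]; have [mP _] := cP.
apply: EFin_inj; rewrite -(OpE _ b cP) -(OpE y b cP).
rewrite -(is_gauss_integral (is_gauss_reindex hK h'K)); last 2 first.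
- by apply/measurable_EFinP; exact: measurableT_comp mP (measurable_obs _ b).
- by move=> f; rewrite lee_fin.
apply: eq_integral => f _; congr (Phi _)%:E; apply/funext => t; rewrite /obs; congr (_ + _).
rewrite /llr [RHS](reindex h)//; exists h' => i _; [exact: hK|exact: h'K].
Qed.

Lemma Op_col_mx (T : finType) (n k p c : nat) (X : T -> 'I_n -> 'cV[C]_k)
    (A : 'M[C]_(p, k)) (B : 'M[C]_(c, k)) Phi b : ntame Phi ->
  Op (sig X (col_mx A B)) Phi b = Op (sig X A) (Op (sig X B) Phi) b.
Proof.
move=> nP; rewrite -Op_join//.
pose h (x : ind n (p + c)) : (ind n p + ind n c)%type :=
  match fintype.split x.1.2 with inl j => inl (x.1.1, j, x.2) | inr j => inr (x.1.1, j, x.2) end.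
pose h' (y : (ind n p + ind n c)%type) : ind n (p + c) :=
  match y with inl x => (x.1.1, lshift c x.1.2, x.2) | inr x => (x.1.1, rshift p x.1.2, x.2) end.
have hK : cancel h h'.
  move=> [[i j] a]; rewrite /h /=; case: (fintype.splitP j) => l e /=; congr (_, _, _); exact: val_inj.
have h'K : cancel h' h.
  move=> [[[i j] a]|[[i j] a]]; rewrite /h /h' /=.
    by rewrite (unsplitK (inl j)).
  by rewrite (unsplitK (inr j)).
rewrite -[RHS](Op_reindex _ _ hK h'K nP); congr (Op _ Phi b).
apply/funext => t; apply/funext => -[[i j] a]; rewrite /sig /flat /h /= mul_col_mx mxE.
by case: (fintype.split j) => l.
Qed.

End complexsignals.

(** * Covariance matrices of an abstract bilinear form *)

Section covmatrix.
Context {R : realType}.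
Local Notation C := R[i].
Variables (W : Type) (e : (W -> R) -> (W -> R) -> R).
Hypotheses (eD : forall f g h, e (fun w => f w + g w) h = e f h + e g h)
  (eZ : forall c f h, e (fun w => c * f w) h = c * e f h)
  (eS : forall f g, e f g = e g f) (eP : forall f, 0 <= e f f).

Local Notation re F := (fun w => complex.Re (F w)).
Local Notation im F := (fun w => complex.Im (F w)).

(** The Hermitian extension of the real form [e], linear in its first argument. Keeping [e] abstract
    serves two forms at once: [vcov], the covariance under the prior, and [ecov], the expected
    covariance after an observation. *)
Definition ec (F G : W -> C) : C :=
  ((e (re F) (re G) + e (im F) (im G)) +i* (e (im F) (re G) - e (re F) (im G)))%C.

Lemma ecD F G K : ec (fun w => F w + G w) K = ec F K + ec G K.
Proof.
have rD : re (fun w => F w + G w) = fun w => complex.Re (F w) + complex.Re (G w).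
  by apply/funext => w; case: (F w); case: (G w).
have iD : im (fun w => F w + G w) = fun w => complex.Im (F w) + complex.Im (G w).
  by apply/funext => w; case: (F w); case: (G w).
by rewrite /ec rD iD !eD; simpc; congr (_ +i* _)%C; ring.
Qed.

Lemma ecZ z F K : ec (fun w => z * F w) K = z * ec F K.
Proof.
set G := (X in ec X K).
have rZ : re G = fun w => complex.Re z * complex.Re (F w) + (- complex.Im z) * complex.Im (F w).
  by apply/funext => w; rewrite /G; clear; case: z (F w) => a b [c d] /=; ring.
have iZ : im G = fun w => complex.Re z * complex.Im (F w) + complex.Im z * complex.Re (F w).
  by apply/funext => w; rewrite /G; clear; case: z (F w) => a b [c d] /=; ring.
rewrite /ec rZ iZ !eD !eZ; clear; case: z => a b /=; simpc; congr (_ +i* _)%C; ring.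
Qed.

Lemma ec_conj F G : ec G F = conjc (ec F G).
Proof.
rewrite /ec /= (eS (re G)) (eS (im G) (im F)) (eS (im G) (re F)) (eS (re G) (im F)).
by congr (_ +i* _)%C; ring.
Qed.

Lemma ec_suml (I : finType) (z : I -> C) (F : I -> W -> C) K :
  ec (fun w => \sum_i z i * F i w) K = \sum_i z i * ec (F i) K.
Proof.
have e0 : ec (fun=> 0) K = 0.
  by have := ecZ 0 (fun=> 0) K; rewrite !mul0r.
have : forall s : seq I, ec (fun w => \sum_(i <- s) z i * F i w) K = \sum_(i <- s) z i * ec (F i) K.
  elim=> [|i s IH].
    by rewrite big_nil -e0; congr ec; apply/funext => w; rewrite big_nil.
  rewrite big_cons -IH -ecZ -ecD; congr ec; apply/funext => w; by rewrite big_cons.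
exact.
Qed.

Lemma ec_sumr (I : finType) (z : I -> C) (F : I -> W -> C) K :
  ec K (fun w => \sum_i z i * F i w) = \sum_i conjc (z i) * ec K (F i).
Proof.
rewrite ec_conj ec_suml rmorph_sum; apply: eq_bigr => i _.
by rewrite [in RHS]ec_conj rmorphM.
Qed.

Lemma ec_diag F : ec F F = rc (\sum_(a : bool) e (fun w => cpart a (F w)) (fun w => cpart a (F w))).
Proof. by rewrite big_bool /ec /rc /cpart /= (eS (im F)) subrr. Qed.

Definition covm (n k : nat) (X : W -> 'I_n -> 'cV[C]_k) : 'M[C]_k :=
  \matrix_(r, s) (rc n%:R^-1 * \sum_i ec (fun w => X w i r 0) (fun w => X w i s 0)).

Lemma covm_conj (n k q : nat) (X : W -> 'I_n -> 'cV[C]_k) (H : 'M[C]_(q, k)) :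
  H *m covm X *m ctr H = covm (fun w i => H *m X w i).
Proof.
apply/matrixP => j l; rewrite !mxE.
under eq_bigr => s _ do rewrite !mxE mulr_suml.
transitivity (rc n%:R^-1 * \sum_i \sum_s \sum_r
   H j r * (conjc (H l s) * ec (fun w => X w i r 0) (fun w => X w i s 0))).
  rewrite [in RHS]exchange_big/= mulr_sumr; apply: eq_bigr => s _.
  rewrite [in RHS]exchange_big/= mulr_sumr; apply: eq_bigr => r _.
  rewrite !mxE -!mulr_sumr; ring.
congr (_ * _); apply: eq_bigr => i _.
have -> : (fun w => (H *m X w i) j 0) = fun w => \sum_r H j r * X w i r 0.
  by apply/funext => w; rewrite mxE.
have -> : (fun w => (H *m X w i) l 0) = fun w => \sum_s H l s * X w i s 0.
  by apply/funext => w; rewrite mxE.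
rewrite (ec_suml (H j) (fun r w => X w i r 0)) exchange_big/=.
apply: eq_bigr => r _; rewrite (ec_sumr (H l) (fun s w => X w i s 0)) mulr_sumr.
by [].
Qed.

Lemma covm_diag (n k : nat) (X : W -> 'I_n -> 'cV[C]_k) j :
  covm X j j = rc (n%:R^-1 * \sum_i \sum_(a : bool)
     e (fun w => cpart a (X w i j 0)) (fun w => cpart a (X w i j 0))).
Proof.
rewrite mxE /rc rmorphM; congr (_ * _); rewrite rmorph_sum; apply: eq_bigr => i _.
by rewrite ec_diag.
Qed.

Lemma covm_herm (n k : nat) (X : W -> 'I_n -> 'cV[C]_k) : ctr (covm X) = covm X.
Proof.
apply/matrixP => r s; rewrite !mxE rmorphM rmorph_sum; congr (_ * _).
  by rewrite /rc /= oppr0.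
by apply: eq_bigr => i _; rewrite [in RHS]ec_conj.
Qed.

Lemma covm_quad (n k : nat) (X : W -> 'I_n -> 'cV[C]_k) (x : 'cV[C]_k) :
  (ctr x *m covm X *m x) 0 0 = rc (n%:R^-1 * \sum_i \sum_(a : bool)
     e (fun w => cpart a ((ctr x *m X w i) 0 0)) (fun w => cpart a ((ctr x *m X w i) 0 0))).
Proof. by have := covm_conj X (ctr x); rewrite ctrK => ->; rewrite covm_diag. Qed.

Lemma covm_psd (n k : nat) (X : W -> 'I_n -> 'cV[C]_k) : psd (covm X).
Proof.
split => [|x]; first exact: covm_herm.
rewrite covm_quad /rc lecR mulr_ge0 ?invr_ge0 ?ler0n//.
by apply: sumr_ge0 => i _; apply: sumr_ge0 => a _; exact: eP.
Qed.

End covmatrix.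

(** * Matrix forms of the information bounds *)

Section infobounds.
Context {R : realType}.
Local Notation C := R[i].
Local Notation vec := (@vec R).
Implicit Types T I : finType.

Lemma pcovD T (f g h : T -> R) (b : vec T) :
  pcov (fun t => f t + g t) h b = pcov f h b + pcov g h b.
Proof.
rewrite /pcov.
under eq_bigr do rewrite mulrDl mulrDr.
under [X in _ - X * _ / _]eq_bigr do rewrite mulrDr.
rewrite !big_split/=; ring.
Qed.

Lemma pcovZ T c (f h : T -> R) (b : vec T) : pcov (fun t => c * f t) h b = c * pcov f h b.
Proof.
rewrite /pcov.
under eq_bigr do rewrite -mulrA mulrCA.
under [X in _ - X * _ / _]eq_bigr do rewrite mulrCA.
by rewrite -!mulr_sumr mulrBr !mulrA.
Qed.

Lemma pcovC T (f g : T -> R) (b : vec T) : pcov f g b = pcov g f b.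
Proof.
rewrite /pcov [X in _ = _ - X * _]mulrC; congr (_ - _).
by apply: eq_bigr => t _; rewrite [f t * _]mulrC.
Qed.

Lemma Op_void T I (x : T -> vec I) Phi b : #|I| = 0%N -> Op x Phi b = Phi b.
Proof.
move=> I0; rewrite /Op; have -> : (fun g : vec I => Phi (obs x b g)) = fun=> Phi b.
  apply/funext => g; congr Phi; apply/funext => t; rewrite /obs /llr big_pred0 ?addr0// => i.
  by have := fintype0 i I0.
exact: (hasE_cst I _).2.
Qed.

(** The expected conditional covariance. The weights [b u] are not normalised separately for each
    [u], so the sum is already weighted by the probability of [u]. *)
Definition ecov (U M I : finType) (y : U -> M -> vec I) (b : U -> vec M)
    (f g : U * M -> R) : R :=
  \sum_u Op (y u) (pcov (fun m => f (u, m)) (fun m => g (u, m))) (b u).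

Section ecov.
Variables (U M I : finType) (y : U -> M -> vec I) (b : U -> vec M).
Local Notation e := (ecov y b).

Lemma ecovD f g h : e (fun w => f w + g w) h = e f h + e g h.
Proof.
rewrite /ecov -big_split; apply: eq_bigr => u _ /=.
rewrite -OpD; [|exact: pcov_tame|exact: pcov_tame].
by congr Op; apply/funext => b'; rewrite pcovD.
Qed.

Lemma ecovZ c f h : e (fun w => c * f w) h = c * e f h.
Proof.
rewrite /ecov mulr_sumr; apply: eq_bigr => u _.
rewrite -OpZ; last exact: pcov_tame.
by congr Op; apply/funext => b'; rewrite pcovZ.
Qed.

Lemma ecovC f g : e f g = e g f.
Proof. by apply: eq_bigr => u _; congr Op; apply/funext => b'; rewrite pcovC. Qed.

Lemma ecov_ge0 f : 0 <= e f f.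
Proof. by apply: sumr_ge0 => u _; exact: (Op_ntame (y u) (pvar_ntame _)).2. Qed.

End ecov.

Lemma ctr_diag_rc q (l : 'I_q -> R) :
  ctr (diag_mx (\row_j rc (l j))) = diag_mx (\row_j rc (l j)).
Proof.
apply/matrixP => i j; rewrite !mxE eq_sym; case: eqP => [->|_].
  by rewrite !mulr1n /rc /= oppr0.
by rewrite !mulr0n rmorph0.
Qed.

Lemma lndet_diag q (A V : 'M[C]_q) (l : 'I_q -> R) (s : R) :
  V *m ctr V = 1%:M -> V *m A *m ctr V = diag_mx (\row_j rc (l j)) ->
  (forall j, 0 < 1 + s * l j) -> lndet (1%:M + rc s *: A) = \sum_j ln (1 + s * l j).
Proof.
move=> VV hV h; rewrite /lndet -[1%:M]/((rc (1:R))%:M) (det_shift_diag 1 s VV hV) /=.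
suff [] : 0 < \prod_j (1 + s * l j) /\ ln (\prod_j (1 + s * l j)) = \sum_j ln (1 + s * l j) by [].
elim: (index_enum _) => [|j r [p0 IH]]; first by rewrite !big_nil ln1.
by rewrite !big_cons lnM ?posrE// IH; split => //; exact: mulr_gt0.
Qed.

Section bounds.
Variables (U M I : finType) (y : U -> M -> vec I) (b : U -> vec M).
Variables (n k q : nat) (X : U * M -> 'I_n -> 'cV[C]_k) (H : 'M[C]_(q, k)).
Hypotheses (n0 : (0 < n)%N) (Sb : \sum_u mass (b u) = 1).
Local Notation Xu u := (fun m => X (u, m)).

(** The unitary [V] decorrelates the antennas on time average, so that the coordinatewise bounds see
    exactly the eigenvalues. *)
Lemma covm_ecov_diag (V : 'M[C]_q) (l : 'I_q -> R) j :
  V *m (H *m covm (ecov y b) X *m ctr H) *m ctr V = diag_mx (\row_j rc (l j)) ->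
  \sum_(i < n) \sum_(a : bool) \sum_u
    Op (y u) (pcov ((sig (Xu u) (V *m H))^~ (i, j, a)) ((sig (Xu u) (V *m H))^~ (i, j, a))) (b u)
  = n%:R * l j.
Proof.
rewrite covm_conj; [|exact: ecovD|exact: ecovZ|exact: ecovC].
rewrite covm_conj; [|exact: ecovD|exact: ecovZ|exact: ecovC].
move=> h; have := diag_entry j h; rewrite covm_diag; last exact: ecovC.
move=> /complexI <-; rewrite mulrA divff ?pnatr_eq0 -?lt0n// mul1r.
apply: eq_bigr => i _; apply: eq_bigr => a _; apply: eq_bigr => u _.
have -> : (sig (Xu u) (V *m H))^~ (i, j, a) = fun m => cpart a ((V *m (H *m X (u, m) i)) j 0).
  by apply/funext => m; rewrite /sig /flat /= mulmxA.
by [].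
Qed.

(** In [entr_gauss_bound] the parameters are frozen at the eigenvalues of the averaged covariance.
    The bound is then affine in the posterior covariance, a tangent line to the logarithm, and its
    correction term averages to zero. *)
Lemma info_upper_bound :
  \sum_u (Op (y u) (@entr R M) (b u) - Op (y u) (Op (sig (Xu u) H) (@entr R M)) (b u))
  <= n%:R * lndet (1%:M + H *m covm (ecov y b) X *m ctr H).
Proof.
set A := H *m _ *m _.
have pA : psd A.
  apply: psd_conj; apply: covm_psd;
  [exact: ecovD|exact: ecovZ|exact: ecovC|exact: ecov_ge0].
have [V [l [VV _ hV]]] := herm_diag pA.1.
have l0 := psd_diag pA hV.
have ll j : 0 < 1 + l j by rewrite ltr_pwDl.
have -> : lndet (1%:M + A) = \sum_j ln (1 + l j).
  have := @lndet_diag _ _ _ _ 1 VV hV.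
  rewrite scale1r => ->; first by apply: eq_bigr => j _; rewrite mul1r.
  by move=> j; rewrite mul1r.
pose c (u : U) (kk : ind n q) : vec M -> R :=
  pcov ((sig (Xu u) (V *m H))^~ kk) ((sig (Xu u) (V *m H))^~ kk).
have step u : Op (y u) (@entr R M) (b u) <= Op (y u) (Op (sig (Xu u) H) (@entr R M)) (b u) +
   \sum_(kk : ind n q) ((1 + l kk.1.2)^-1 * Op (y u) (c u kk) (b u) +
     (ln (1 + l kk.1.2) / 2 - l kk.1.2 / 2 / (1 + l kk.1.2)) * mass (b u)).
  pose d (kk : ind n q) := ln (1 + l kk.1.2) / 2 - l kk.1.2 / 2 / (1 + l kk.1.2).
  pose Psi (b' : vec M) := Op (sig (Xu u) H) (@entr R M) b' +
    \sum_(kk : ind n q) ((1 + l kk.1.2)^-1 * c u kk b' + d kk * mass b').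
  have c1 kk : tame (fun b' : vec M => (1 + l kk.1.2)^-1 * c u kk b').
    by apply: tameZ; exact: pcov_tame.
  have c2 (kk : ind n q) : tame (fun b' : vec M => d kk * mass b').
    by apply: tameZ; exact: (@mass_ntame R M).1.
  have c3 : tame (Op (sig (Xu u) H) (@entr R M)) := (Op_ntame _ (@entr_ntame R M)).1.
  have c4 : tame (fun b' : vec M => \sum_(kk : ind n q) ((1 + l kk.1.2)^-1 * c u kk b' + d kk * mass b')).
    by apply: tame_sum => kk; exact: tameD.
  have -> : Op (y u) (Op (sig (Xu u) H) (@entr R M)) (b u) +
   \sum_(kk : ind n q) ((1 + l kk.1.2)^-1 * Op (y u) (c u kk) (b u) + d kk * mass (b u))
     = Op (y u) Psi (b u).
    rewrite /Psi OpD// Op_sum; last by move=> kk; exact: tameD.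
    congr (_ + _); apply: eq_bigr => kk _.
    have e1 := OpZ (y u) ((1 + l kk.1.2)^-1) (b u) (pcov_tame ((sig (Xu u) (V *m H))^~ kk) ((sig (Xu u) (V *m H))^~ kk)).
    have e2 := OpZ (y u) (d kk) (b u) (@mass_ntame R M).1.
    rewrite Op_mass in e2.
    by rewrite -e2 -e1 -(OpD (y u) (b u) (c1 kk) (c2 kk)).
  apply: Op_le; [exact: (@entr_ntame R M).1|exact: tameD|move=> b'].
  rewrite /Psi -(Op_unitary _ _ _ VV (@entr_ntame R M)).
  apply: le_trans (entr_gauss_bound (l := fun kk : ind n q => l kk.1.2 / 2) (sig (Xu u) (V *m H)) b' _) _.
    by move=> kk; rewrite divr_ge0.
  rewrite lerD2l; apply: ler_sum => kk _; rewrite -/(c u kk) /d.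
  have -> : 1 + 2 * (l kk.1.2 / 2) = 1 + l kk.1.2 by rewrite mulrCA divff ?mulr1// pnatr_eq0.
  by rewrite le_eqVlt; apply/orP; left; apply/eqP; ring.
apply: (@le_trans _ _ (\sum_u \sum_(kk : ind n q) ((1 + l kk.1.2)^-1 * Op (y u) (c u kk) (b u) +
     (ln (1 + l kk.1.2) / 2 - l kk.1.2 / 2 / (1 + l kk.1.2)) * mass (b u)))).
  by apply: ler_sum => u _; rewrite lerBlDl; exact: step.
rewrite exchange_big/=.
under eq_bigr => kk _ do rewrite big_split/= -!mulr_sumr Sb mulr1.
rewrite -(pair_bigA _ (fun p a => (1 + l p.2)^-1 * (\sum_u Op (y u) (c u (p, a)) (b u))
    + (ln (1 + l p.2) / 2 - l p.2 / 2 / (1 + l p.2)))) /=.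
rewrite -(pair_bigA _ (fun i j => \sum_(a : bool) ((1 + l j)^-1 * (\sum_u Op (y u) (c u (i, j, a)) (b u))
    + (ln (1 + l j) / 2 - l j / 2 / (1 + l j))))) /= exchange_big/= mulr_sumr.
apply: ler_sum => j _.
under eq_bigr => i _ do rewrite big_split/= -mulr_sumr big_const card_bool iterS/= addr0.
rewrite big_split/= -mulr_sumr (covm_ecov_diag j hV) sumr_const card_ord -mulr_natl.
by rewrite le_eqVlt; apply/orP; left; apply/eqP; field; rewrite gt_eqF.
Qed.

End bounds.

(** After rotation by the diagonalising [V], the eigenvalues of [G *m E *m ctr G] are the errors of
    [mutual_info_lower_bound]; as these lie below 1, the complement is positive definite. *)
Lemma info_lower_bound (U M : finType) (b : U -> vec M) (n k q : nat)
    (X : U * M -> 'I_n -> 'cV[C]_k) (G : 'M[C]_(q, k))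
    (E := covm (ecov (fun u m => sig (fun m => X (u, m)) G m) b) X) :
  (0 < n)%N -> \sum_u mass (b u) = 1 ->
  pd (1%:M - G *m E *m ctr G) /\
  - (n%:R * lndet (1%:M - G *m E *m ctr G)) <=
  \sum_u (entr (b u) - Op (sig (fun m => X (u, m)) G) (@entr R M) (b u)).
Proof.
move=> n0 Sb; set A := G *m E *m ctr G.
have pA : psd A.
  apply: psd_conj; apply: covm_psd;
  [exact: ecovD|exact: ecovZ|exact: ecovC|exact: ecov_ge0].
have [V [l [VV VV' hV]]] := herm_diag pA.1.
pose z u m := sig (fun m => X (u, m)) (V *m G) m.
have eE j : n%:R^-1 * (\sum_(i < n) \sum_(a : bool) \sum_u
       Op (z u) (pcov ((z u)^~ (i, j, a)) ((z u)^~ (i, j, a))) (b u)) = l j.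
  apply: (@mulfI _ n%:R); first by rewrite pnatr_eq0 -lt0n.
  rewrite mulrA divff ?pnatr_eq0 -?lt0n// mul1r -(covm_ecov_diag n0 j hV).
  apply: eq_bigr => i _; apply: eq_bigr => a _; apply: eq_bigr => u _.
  exact: (Op_unitary (fun m => X (u, m)) G (b u) VV (pvar_ntame _)).
have [h1 h2] := mutual_info_lower_bound z n0 Sb.
have l1 j : l j < 1 by rewrite -eE; exact: h1.
have AE : 1%:M - A = ctr V *m diag_mx (\row_j rc (1 - l j)) *m V.
  have -> : diag_mx (\row_j rc (1 - l j)) = 1%:M - V *m A *m ctr V.
    by rewrite hV -diag_const_mx -raddfB/=; congr diag_mx; apply/rowP => j; rewrite !mxE /rc rmorphB.
  by rewrite mulmxBr mulmxBl mulmx1 VV' !mulmxA VV' mul1mx -mulmxA VV' mulmx1.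
have dE : lndet (1%:M - A) = \sum_j ln (1 - l j).
  have := @lndet_diag _ _ _ _ (-1) VV hV.
  rewrite /rc rmorphN1 scaleN1r => ->; first by apply: eq_bigr => j _; rewrite mulN1r.
  by move=> j; rewrite mulN1r subr_gt0.
split.
  split.
    rewrite AE.
    have -> : diag_mx (\row_j rc (1 - l j)) =
        diag_mx (\row_j rc (Num.sqrt (1 - l j))) *m ctr (diag_mx (\row_j rc (Num.sqrt (1 - l j)))).
      rewrite ctr_diag_rc mulmx_diag; congr diag_mx; apply/rowP => j; rewrite !mxE /rc -rmorphM/=.
      by rewrite -expr2 sqr_sqrtr// subr_ge0 ltW.
    by have := psd_conj (ctr V) (psd_gram (diag_mx (\row_j rc (Num.sqrt (1 - l j))))); rewrite ctrK.
  rewrite unitmxE unitfE.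
  have := @det_shift_diag _ _ _ _ _ 1 (-1) VV hV.
  rewrite /rc rmorphN1 scaleN1r => ->.
  rewrite fmorph_eq0 prodf_seq_neq0; apply/allP => j _ /=.
  by rewrite mulN1r subr_eq0 gt_eqF.
rewrite dE -mulrN -sumrN.
apply: le_trans (le_trans h2 _).
  by rewrite ler_wpM2l ?ler0n//; apply: ler_sum => j _; rewrite eE.
apply: ler_sum => u _; rewrite lerD2l lerN2.
by rewrite (Op_unitary (fun m => X (u, m)) G (b u) VV (entr_ntame _)).
Qed.

End infobounds.

(** * Linear estimation and the power constraint *)

Section mmse.
Context {R : realType}.
Local Notation C := R[i].
Local Notation vec := (@vec R).

Lemma sum_pair (A B : finType) (F : A * B -> R) : \sum_p F p = \sum_a \sum_c F (a, c).
Proof. by rewrite pair_bigA; apply: eq_bigr => -[a c] _. Qed.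

(** The law of total variance without the variance of the conditional means: centring each slice at
    the global mean can only increase its second moment. *)
Lemma pcov_total (U M : finType) (f : U * M -> R) (b : vec (U * M)%type) :
  \sum_u pcov (fun m => f (u, m)) (fun m => f (u, m)) (fun m => b (u, m)) <= pcov f f b.
Proof.
case: (pickP (@predT (U * M)%type)) => [t0 _|T0]; last first.
  have -> : pcov f f b = 0 by rewrite /pcov !big_pred0 ?mul0r ?subr0// => t; have := T0 t.
  rewrite big1// => u _.
  by rewrite /pcov !big_pred0 ?mul0r ?subr0// => m; have := T0 (u, m).
have := pcov_sqrE t0 f b (wmean f b); rewrite subrr expr0n mulr0 addr0 => <-.
rewrite sum_pair.
by apply: ler_sum => u _; exact: pvar_le.
Qed.

Lemma mass_pair (U M : finType) (b : vec (U * M)%type) :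
  \sum_u mass (fun m => b (u, m)) = mass b.
Proof. by rewrite /mass sum_pair. Qed.

(** Expresses a part of a complex product as a real linear form in the parts of [w], the shape in
    which [Op_pvar_le] takes its slope. *)
Lemma cpart_mul (a : bool) (z w : C) :
  cpart a (z * w) = \sum_(c : bool) cpart a (z * (if c then 1 else 'i%C)) * cpart c w.
Proof. by rewrite big_bool/=; case: z => x y; case: w => x' y'; case: a => /=; ring. Qed.

Lemma cpart_mul_sqr (a : bool) (z : C) :
  \sum_(c : bool) cpart a (z * (if c then 1 else 'i%C)) ^+ 2 = \sum_(c : bool) cpart c z ^+ 2.
Proof. by rewrite !big_bool/=; case: z => x y; case: a => /=; ring. Qed.

Definition vcov (W : finType) (b : vec W) (f g : W -> R) : R := pcov f g b.

Section vcov.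
Variables (W : finType) (b : vec W).

Lemma vcov_covm (n k : nat) (X : W -> 'I_n -> 'cV[C]_k) :
  covm (vcov b) X =
  covm (ecov (fun (_ : unit) _ => (fun=> 0) : vec void) (fun=> b)) (fun w => X w.2).
Proof.
apply/matrixP => r s; rewrite !mxE; congr (_ * _); apply: eq_bigr => i _.
have h f g : ecov (fun (_ : unit) _ => (fun=> 0) : vec void) (fun=> b) f g =
    vcov b (fun w => f (tt, w)) (fun w => g (tt, w)).
  rewrite /ecov (big_pred1 tt); last by case.
  by rewrite Op_void ?card_void.
by rewrite /ec !h.
Qed.

Lemma vcovD f g h : vcov b (fun w => f w + g w) h = vcov b f h + vcov b g h.
Proof. exact: pcovD. Qed.

Lemma vcovZ c f h : vcov b (fun w => c * f w) h = c * vcov b f h.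
Proof. exact: pcovZ. Qed.

Lemma vcovC f g : vcov b f g = vcov b g f.
Proof. exact: pcovC. Qed.

Lemma vcov_ge0 f : 0 <= vcov b f f.
Proof. exact: pvar_ge0. Qed.

(** The case of [info_upper_bound] with a single primary message and a prior observation that has no
    coordinates. *)
Lemma info_upper_bound0 (n k q : nat) (X : W -> 'I_n -> 'cV[C]_k) (H : 'M[C]_(q, k)) :
  (0 < n)%N -> mass b = 1 ->
  entr b - Op (sig X H) (@entr R W) b <= n%:R * lndet (1%:M + H *m covm (vcov b) X *m ctr H).
Proof.
move=> n0 Sb; rewrite vcov_covm.
have := @info_upper_bound R unit W void (fun (_ : unit) _ => (fun=> 0) : vec void) (fun=> b)
  n k q (fun w => X w.2) H n0.
do 2 (rewrite (big_pred1 tt); last by case).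
by rewrite !(Op_void _ _ _ card_void); apply.
Qed.

End vcov.

(** Tested against a vector [x], the claim compares the posterior error of [ctr x *m X w i] with
    that of the linear estimator [ctr x *m A] applied to the output, at each time and for each real
    component. Dropping the knowledge of [u] then only increases the estimator's error. *)
Lemma covm_mmse (U M : finType) (b : vec (U * M)%type) (n k q : nat)
    (X : U * M -> 'I_n -> 'cV[C]_k) (G : 'M[C]_(q, k))
    (E := covm (ecov (fun u m => sig (fun m => X (u, m)) G m) (fun u m => b (u, m))) X)
    (A : 'M[C]_(k, q)) :
  (0 < n)%N -> mass b = 1 ->
  psd ((1%:M - A *m G) *m covm (vcov b) X *m ctr (1%:M - A *m G) + A *m ctr A - E).
Proof.
move=> n0 Sb.
have [hS pS] : psd (covm (vcov b) X).
  by apply: covm_psd; [exact: vcovD|exact: vcovZ|exact: vcovC|exact: vcov_ge0].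
have [hE _] : psd E.
  by apply: covm_psd; [exact: ecovD|exact: ecovZ|exact: ecovC|exact: ecov_ge0].
split.
  by rewrite ctrB ctrD !ctrM !ctrK hS hE mulmxA.
move=> x; set B := 1%:M - A *m G.
have -> : ctr x *m (B *m covm (vcov b) X *m ctr B + A *m ctr A - E) *m x =
    ctr (ctr B *m x) *m covm (vcov b) X *m (ctr B *m x) + (ctr x *m A) *m ctr (ctr x *m A)
    - ctr x *m E *m x.
  by rewrite !ctrM !ctrK mulmxBr mulmxDr !mulmxA mulmxBl mulmxDl.
set eta := ctr x *m A.
(* The real slope of the estimator at time [i]: it reads the chosen part of [eta] times the output
   at that time and ignores all other times. Its squared norm is that of [eta]. *)
pose kap (i : 'I_n) (a : bool) : vec (ind n q) := fun kk =>
  if kk.1.1 == i then cpart a (eta 0 kk.1.2 * (if kk.2 then 1 else 'i%C)) else 0.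
pose v i (a : bool) (w : U * M) : R := cpart a ((ctr x *m X w i) 0 0).
pose v' i (a : bool) (w : U * M) : R := cpart a ((ctr (ctr B *m x) *m X w i) 0 0).
pose N := \sum_(j < q) \sum_(c : bool) cpart c (eta 0 j) ^+ 2.
have kapN i a : \sum_kk kap i a kk ^+ 2 = N.
  rewrite sum_pair sum_pair.
  rewrite (bigD1 i)//= [X in _ + X]big1 ?addr0; last first.
    move=> i' /negbTE ii; rewrite big1// => j _; rewrite big1// => c _.
    by rewrite /kap /= ii expr0n.
  apply: eq_bigr => j _; rewrite -(cpart_mul_sqr a); apply: eq_bigr => c _.
  by rewrite /kap /= eqxx.
have kapE i a u m : v i a (u, m) - \sum_kk kap i a kk * sig (fun m => X (u, m)) G m kk =
    v' i a (u, m).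
  rewrite sum_pair sum_pair.
  rewrite (bigD1 i)//= [X in _ - (_ + X)]big1 ?addr0; last first.
    move=> i' /negbTE ii; rewrite big1// => j _; rewrite big1// => c _.
    by rewrite /kap /= ii mul0r.
  have -> : \sum_(j < q) \sum_(c : bool) kap i a (i, j, c) * sig (fun m => X (u, m)) G m (i, j, c)
     = cpart a ((eta *m (G *m X (u, m) i)) 0 0).
    rewrite [in RHS]mxE cpart_sum; apply: eq_bigr => j _; rewrite cpart_mul; apply: eq_bigr => c _.
    by rewrite /kap /= eqxx.
  rewrite /v /v' -cpartB; congr (cpart _ _).
  have -> : ctr (ctr B *m x) *m X (u, m) i = ctr x *m X (u, m) i - eta *m (G *m X (u, m) i).
    by rewrite ctrM ctrK /B mulmxBr mulmx1 mulmxBl /eta !mulmxA.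
  by move: (ctr x *m _) (eta *m _) => P1 P2; rewrite !mxE.
have key i a : ecov (fun u m => sig (fun m => X (u, m)) G m) (fun u m => b (u, m)) (v i a) (v i a)
    <= vcov b (v' i a) (v' i a) + N / 2.
  apply: le_trans (lerD (pcov_total (v' i a) b) (lexx (N / 2))).
  have -> : N / 2 = \sum_u mass (fun m => b (u, m)) * (N / 2).
    by rewrite -mulr_suml mass_pair Sb mul1r.
  rewrite -big_split/=; apply: ler_sum => u _.
  apply: le_trans (Op_pvar_le _ _ (kap i a) _) _.
  rewrite -mulr_suml kapN.
  by under [fun m => v i a (u, m) - _]eq_fun => m do rewrite kapE.
have qS := covm_quad (@vcovD _ b) (@vcovZ _ b) (@vcovC _ b) X (ctr B *m x).
have qE := covm_quad (@ecovD R U M _ (fun u m => sig (fun m => X (u, m)) G m) (fun u m => b (u, m)))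
  (@ecovZ R U M _ _ _) (@ecovC R U M _ _ _) X x.
have qA : (eta *m ctr eta) 0 0 = rc N.
  rewrite mxE /N /rc rmorph_sum; apply: eq_bigr => j _; rewrite !mxE.
  by rewrite normc_sqr.
have -> (P Q S : 'M[C]_1) : (P + Q - S) 0 0 = P 0 0 + Q 0 0 - S 0 0 by rewrite !mxE.
rewrite qS qA -/E qE /rc -rmorphD -rmorphB lecR.
have nn : n%:R != 0 :> R by rewrite pnatr_eq0 -lt0n.
have -> : N = n%:R^-1 * \sum_(i < n) \sum_(a : bool) N / 2.
  have -> : \sum_(i < n) \sum_(a : bool) N / 2 = n%:R * N.
    by rewrite sumr_const card_ord mulr_natl big_bool/= -splitr.
  by rewrite mulrA mulVf// mul1r.
rewrite -mulrDr -mulrBr mulr_ge0 ?invr_ge0 ?ler0n// subr_ge0 -big_split/=.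
apply: ler_sum => i _; rewrite -big_split/=; apply: ler_sum => a _.
exact: key.
Qed.

Lemma trace_cov (T : finType) (k : nat) (x : T -> 'cV[C]_k) :
  complex.Re (\tr (cov_mx x)) = #|T|%:R^-1 * \sum_t \sum_r \sum_(a : bool)
    (cpart a (x t r 0) - cpart a (mean_vec x r 0)) ^+ 2.
Proof.
rewrite /cov_mx linearZ/= raddf_sum/=.
have -> : \sum_t \tr ((x t - mean_vec x) *m ctr (x t - mean_vec x)) =
    rc (\sum_t \sum_r \sum_(a : bool) (cpart a (x t r 0) - cpart a (mean_vec x r 0)) ^+ 2).
  rewrite /rc rmorph_sum; apply: eq_bigr => t _; rewrite rmorph_sum; apply: eq_bigr => r _.
  rewrite mxE big_ord1; set d := x t - _.
  have -> : ctr d 0 r = conjc (d r 0) by rewrite !mxE.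
  rewrite normc_sqr; congr (rc _); apply: eq_bigr => a _; congr (_ ^+ 2).
  by rewrite /d !mxE cpartB.
have -> : #|T|%:R^-1 = rc #|T|%:R^-1 :> C by rewrite /rc fmorphV/= rmorph_nat.
by rewrite /rc -rmorphM.
Qed.

Definition unif (T : finType) : vec T := fun=> - ln #|T|%:R.

Lemma expR_unif (T : finType) (t : T) : expR (unif t) = #|T|%:R^-1.
Proof. by rewrite expRN lnK// posrE ltr0n; apply/card_gt0P; exists t. Qed.

Lemma mass_unif (T : finType) : (0 < #|T|)%N -> mass (@unif T) = 1.
Proof.
move=> T0; rewrite /mass; under eq_bigr do rewrite expR_unif.
by rewrite sumr_const -[LHS]mulr_natl divff// pnatr_eq0 -lt0n.
Qed.

Lemma covm_trace (W : Type) (e : (W -> R) -> (W -> R) -> R) (n k : nat) (X : W -> 'I_n -> 'cV[C]_k) :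
  (forall f g, e f g = e g f) ->
  complex.Re (\tr (covm e X)) = n%:R^-1 * \sum_i \sum_r \sum_(a : bool)
    e (fun w => cpart a (X w i r 0)) (fun w => cpart a (X w i r 0)).
Proof.
move=> eC; rewrite exchange_big/= mulr_sumr.
have -> : \tr (covm e X) = rc (\sum_r n%:R^-1 * \sum_i \sum_(a : bool)
    e (fun w => cpart a (X w i r 0)) (fun w => cpart a (X w i r 0))).
  by rewrite /rc rmorph_sum; apply: eq_bigr => r _; rewrite covm_diag.
by [].
Qed.

Lemma cpart_rcM (a : bool) (c : R) (z : C) : cpart a (rc c * z) = c * cpart a z.
Proof. by case: z => x y; case: a => /=; ring. Qed.

(** The trace does not see the correlation between the two transmitters. The scaling by the square
    root of [alpha] multiplies the cognitive power by [alpha], and averaging over [M] leaves the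
    primary codeword unchanged. *)
Lemma covm_trace_le (U M : finType) (n k l : nat) (Ep : U -> 'I_n -> 'cV[C]_k)
    (Ec : U -> M -> 'I_n -> 'cV[C]_l) (alpha Pp Pc : R)
    (X := fun (w : U * M) i => col_mx (Ep w.1 i) (rc (Num.sqrt alpha) *: Ec w.1 w.2 i)) :
  (0 < n)%N -> (0 < #|U|)%N -> (0 < #|M|)%N -> 0 < alpha ->
  \sum_(i < n) complex.Re (\tr (cov_mx (fun u => Ep u i))) <= n%:R * Pp ->
  \sum_(i < n) complex.Re (\tr (cov_mx (fun w : U * M => Ec w.1 w.2 i))) <= n%:R * Pc ->
  complex.Re (\tr (covm (vcov (@unif (U * M)%type)) X)) <= Pp + alpha * Pc.
Proof.
move=> n0 U0 M0 a0 hp hc.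
have n0' : 0 < n%:R :> R by rewrite ltr0n.
rewrite covm_trace; last exact: vcovC.
rewrite -(ler_pM2l n0') mulrA divff ?gt_eqF// mul1r.
have -> : n%:R * (Pp + alpha * Pc) = n%:R * Pp + alpha * (n%:R * Pc) by ring.
apply: le_trans (lerD hp (ler_wpM2l (ltW a0) hc)).
rewrite mulr_sumr -big_split/=; apply: ler_sum => i _.
rewrite big_split_ord/=; apply: lerD.
  rewrite trace_cov [in leRHS]exchange_big/= mulr_sumr; apply: ler_sum => r _.
  rewrite [in leRHS]exchange_big/= mulr_sumr; apply: ler_sum => a _.
  apply: le_trans (pvar_le _ _ (cpart a (mean_vec (fun u => Ep u i) r 0))) _.
  rewrite sum_pair [in leRHS]mulr_sumr; apply: ler_sum => u _.
  under eq_bigr => m _ do rewrite expR_unif /X col_mxEu /=.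
  rewrite sumr_const -[leLHS]mulr_natl mulrA card_prod natrM.
  have -> : #|M|%:R * (#|U|%:R * #|M|%:R)^-1 = #|U|%:R^-1 :> R.
    by rewrite invfM mulrCA divff ?mulr1// pnatr_eq0 -lt0n.
  exact: lexx.
rewrite trace_cov [in leRHS]exchange_big/= 2!mulr_sumr; apply: ler_sum => r _.
rewrite [in leRHS]exchange_big/= 2!mulr_sumr; apply: ler_sum => a _.
apply: le_trans (pvar_le _ _ (Num.sqrt alpha * cpart a (mean_vec (fun w : U * M => Ec w.1 w.2 i) r 0))) _.
rewrite 2!mulr_sumr; apply: ler_sum => w _.
rewrite expR_unif /X col_mxEd mxE cpart_rcM -mulrBr exprMn (sqr_sqrtr (ltW a0)) [leLHS]mulrCA.
exact: lexx.
Qed.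

End mmse.

(** * Decoding *)

Section fano.
Context {R : realType}.
Local Notation C := R[i].
Local Notation vec := (@vec R).

Lemma prod_pair (A B : finType) (F : A * B -> R) : \prod_p F p = \prod_a \prod_c F (a, c).
Proof. by rewrite pair_bigA; apply: eq_bigr => -[a c] _. Qed.

Lemma cn_iid_gauss d (Omega : measurableType d) (P : probability Omega R) (n k : nat)
    (Z : nat -> Omega -> 'cV[C]_k) :
  cn_iid P Z -> is_gauss P (fun w => flat (fun i : 'I_n => Z i w)).
Proof.
move=> [mZ hZ]; split.
  by apply: measurable_vec => -[[i j] b]; exact: mZ.
move=> B mB.
have := hZ n (fun i j b => B (i, j, b)) (fun i j b => mB _).
have -> : [set w | forall (i : 'I_n) (j : 'I_k) (b : bool), B (i, j, b) (cpart b (Z i w j 0))] =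
   (fun w => flat (fun i : 'I_n => Z i w)) @^-1` box B.
  by apply/seteqP; split => w h => [[[i j] b]|i j b]; [exact: h|exact: (h (i, j, b))].
move=> ->; congr (_%:E); rewrite prod_pair prod_pair.
by [].
Qed.

Lemma borel_decoder_measurable (n k M : nat) (D : ('I_n -> 'cV[C]_k) -> 'I_M)
    (c : 'I_n -> 'cV[C]_k) (m : 'I_M) :
  borel_decoder D -> measurable [set y : vec (ind n k) | D (fun i => unflat y i + c i) != m].
Proof.
move=> bD.
pose phi (y : vec (ind n k)) : 'I_n -> 'cV[C]_k := fun i => unflat y i + c i.
have -> : [set y : vec (ind n k) | D (fun i => unflat y i + c i) != m] =
    ~` (phi @^-1` (D @^-1` [set m])).
  by apply/seteqP; split => y /= /eqP.
apply: measurableC.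
have : <<s @blk_gen R n k >> `<=` [set A | measurable (phi @^-1` A)]; last by apply; exact: bD.
apply: smallest_sub.
  split => [|A mA|F mF] /=.
  - by rewrite preimage_set0.
  - by rewrite setTD preimage_setC; exact: measurableC.
  - by rewrite preimage_bigcup; apply: bigcup_measurable => i _; exact: mF.
move=> _ [i [j [a [r ->]]]] /=.
have -> : phi @^-1` [set y | cpart a (y i j 0) < r] =
   (fun y : vec (ind n k) => y (i, j, a) + cpart a (c i j 0)) @^-1` `]-oo, r[%classic.
  apply/seteqP; split => y /=; rewrite in_itv/= /phi mxE cpartD.
    by move=> h; move: h; rewrite mxE; case: a.
  by rewrite mxE; case: a.
rewrite -[X in measurable X]setTI; apply: (measurable_funD (measurable_coord _) (measurable_cst _)) => //.
Qed.

Lemma hasE_prob d (Omega : measurableType d) (P : probability Omega R) (I : finType)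
    (g : Omega -> vec I) (f : vec I -> bool) (x : vec I) :
  is_gauss P g -> measurable [set y | f y] ->
  hasE (fun y => (f y)%:R * expR (llr x y)) (fine (P [set w | f (fun i => g w i + x i)])).
Proof.
move=> Pg mf; have [mg _] := Pg.
have mS : measurable_fun setT (fun y : vec I => (fun i => y i + x i) : vec I).
  by apply: measurable_vec => i; apply: measurable_funD => //; exact: measurable_coord.
pose A := [set y | f y].
pose B := (fun y : vec I => (fun i => y i + x i) : vec I) @^-1` A.
have mB : measurable B by rewrite -[B]setTI; exact: mS.
have fE y : (f y)%:R = \1_A y :> R by rewrite indicE mem_setE.
apply: hasE_ge0.
- apply: measurable_funM.
    rewrite (_ : (fun y => _) = \1_A); first exact: measurable_indic.
    by apply/funext => y; rewrite fE.
  by apply: measurableT_comp => //; exact: measurable_llr.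
- by move=> y; rewrite mulr_ge0 ?ler0n ?expR_ge0.
- have -> : [set w | f (fun i => g w i + x i)] = g @^-1` B by [].
  have h := is_gauss_preimage Pg mB; rewrite h fineK; last exact: fin_num_measure.
  rewrite -[B]setIT -(integral_indic (gauss I) measurableT mB).
  have mF : measurable_fun setT (fun y : vec I => (\1_A y)%:E : \bar R).
    by apply/measurable_EFinP; exact: measurable_indic.
  have := gauss_shift x mF (fun y => _ : (0 <= (\1_A y)%:E)%E); move=> -> //.
  by apply: eq_integral => y _; rewrite EFinM fE.
Qed.

(** [p] extracts the part of the message that the decoder must recover. The pointwise bound is taken
    at the guess [dec y] and averaged; the likelihood ratios turn the wrong weights into error
    probabilities. *)
Lemma fano_expect d (Omega : measurableType d) (P : probability Omega R) (T L I : finType)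
    (g : Omega -> vec I) (p : T -> L) (x : T -> vec I) (dec : vec I -> L) (b : vec T)
    (Phi : vec T -> R) :
  is_gauss P g -> (forall l, measurable [set y | dec y != l]) -> tame Phi ->
  (forall b' l, Phi b' <= mass b' * ln 2 + (\sum_(t | l != p t) expR (b' t)) * ln #|L|%:R) ->
  Op x Phi b <= mass b * ln 2 +
    (\sum_t expR (b t) * fine (P [set w | dec (fun i => g w i + x t i) != p t])) * ln #|L|%:R.
Proof.
move=> Pg md cP hP.
have h1 t := hasEZ (expR (b t)) (hasE_prob (x t) Pg (md (p t))).
have h2 := hasED (hasEZ (ln 2) (hasE_mass x b)) (hasEZ (ln #|L|%:R) (hasE_sum (index_enum T) h1)).
rewrite [mass b * _]mulrC [X in _ + X]mulrC.
apply: (hasE_le (tame_hasE x b cP) h2) => y.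
apply: le_trans (hP _ (dec y)) _.
rewrite [mass _ * _]mulrC [X in _ + X <= _]mulrC lerD2l.
rewrite big_mkcond/= le_eqVlt; apply/orP; left; apply/eqP; congr (_ * _); apply: eq_bigr => t _.
by rewrite /obs expRD; case: (dec y != p t); rewrite ?mul1r ?mul0r ?mulr0.
Qed.

Section coarse.
Variables (U M : finType) (m0 : M).
Implicit Types b : vec (U * M)%type.
Local Notation res b u := ((fun m => b (u, m)) : vec M).

Definition coarse b : vec U := fun u => ln (mass (res b u)).

Lemma expR_coarse b u : expR (coarse b u) = mass (res b u).
Proof. by rewrite /coarse lnK// posrE (mass_gt0 m0). Qed.

Lemma mass_coarse b : mass (coarse b) = mass b.
Proof. by rewrite -mass_pair /mass; apply: eq_bigr => u _; rewrite expR_coarse. Qed.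

(** Since [entr] scales with the mass, the entropy of the slice at [u] already carries the
    probability of [u], and conditional entropies simply add up. *)
Lemma entr_chain b : entr b = entr (coarse b) + \sum_u entr (res b u).
Proof.
rewrite /entr mass_coarse -big_split sum_pair; apply: eq_bigr => u _ /=.
rewrite expR_coarse {1}/mass mulr_suml -big_split; apply: eq_bigr => m _ /=.
by rewrite -mulrDr /coarse addrA subrK.
Qed.

Lemma tame_res (Phi : vec M -> R) u : tame Phi -> tame (fun b => Phi (res b u)).
Proof.
move=> [mP [K hK]]; split.
  have mr : measurable_fun setT (fun b => res b u).
    by apply: measurable_vec => m; exact: measurable_coord.
  exact: (measurableT_comp mP mr).
exists `|K| => b; apply: le_trans (hK _) _.
apply: (@le_trans _ _ (`|K| * mass (res b u))).
  by apply: ler_wpM2r; [exact: mass_ge0|exact: ler_norm].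
apply: ler_wpM2l => //; rewrite -mass_pair (bigD1 u)//= lerDl.
by apply: sumr_ge0 => v _; exact: mass_ge0.
Qed.

Lemma tame_coarse : tame (fun b => entr (coarse b)).
Proof.
rewrite (_ : (fun b => _) = fun b => entr b + (-1) * \sum_u entr (res b u)).
  apply: tameD; first exact: (@entr_ntame R _).1.
  by apply: tameZ; apply: tame_sum => u; apply: tame_res; exact: (@entr_ntame R _).1.
by apply/funext => b; rewrite entr_chain mulN1r addrK.
Qed.

Lemma Op_chain (I : finType) (x : U * M -> vec I) b :
  Op x (@entr R _) b = Op x (fun b => entr (coarse b)) b +
    \sum_u Op (fun m => x (u, m)) (@entr R M) (res b u).
Proof.
have -> : @entr R (U * M)%type = fun b => entr (coarse b) + \sum_u entr (res b u).
  by apply/funext => b'; exact: entr_chain.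
have c1 u : tame (fun b => entr (res b u)) by apply: tame_res; exact: (@entr_ntame R _).1.
by rewrite (OpD _ _ tame_coarse (tame_sum c1)) (Op_sum _ _ c1).
Qed.

Lemma entr_coarse_fano b u :
  entr (coarse b) <= mass b * ln 2 + (\sum_(t | u != t.1) expR (b t)) * ln #|U|%:R.
Proof.
apply: le_trans (entr_fano u (coarse b)) _; rewrite mass_coarse expR_coarse.
rewrite le_eqVlt; apply/orP; left; apply/eqP; congr (_ + _ * _).
rewrite big_mkcond/= sum_pair -[mass b]mass_pair (bigD1 u)//= addrAC subrr add0r.
rewrite [RHS](bigD1 u)//= [X in _ = X + _]big1 ?add0r; last by move=> m _; rewrite eqxx.
by apply: eq_bigr => v vu; apply: eq_bigr => m _; rewrite eq_sym vu.
Qed.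

Lemma entr_unif_coarse : (0 < #|U|)%N -> entr (coarse (@unif R (U * M)%type)) = ln #|U|%:R.
Proof.
move=> U0.
have M0 : (0 < #|M|)%N by apply/card_gt0P; exists m0.
have cE u : coarse (@unif R (U * M)%type) u = - ln #|U|%:R.
  rewrite /coarse /mass; under eq_bigr => m _ do rewrite (expR_unif (u, m)).
  rewrite sumr_const -[X in ln X]mulr_natl card_prod natrM invfM mulrCA divff ?pnatr_eq0 -?lt0n//.
  by rewrite mulr1 lnV// posrE ltr0n.
rewrite /entr mass_coarse mass_unif ?card_prod ?muln_gt0 ?U0// ln1.
under eq_bigr => u _ do rewrite cE sub0r opprK expRN lnK ?posrE ?ltr0n//.
by rewrite sumr_const -[LHS]mulr_natl mulrA divff ?mul1r// pnatr_eq0 -lt0n.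
Qed.

End coarse.

Lemma entr_fano_sum (M : finType) (b : vec M) (l : M) :
  entr b <= mass b * ln 2 + (\sum_(t | l != t) expR (b t)) * ln #|M|%:R.
Proof.
apply: le_trans (entr_fano l b) _; rewrite {2}/mass (bigD1 l)//= addrAC subrr add0r.
by under eq_bigl do rewrite eq_sym.
Qed.

Lemma entr_unif_res (U M : finType) : (0 < #|U|)%N -> (0 < #|M|)%N ->
  \sum_u entr (fun m => @unif R (U * M)%type (u, m)) = ln #|M|%:R.
Proof.
move=> U0 M0; have [m0 _] := card_gt0P M0.
have := entr_chain m0 (@unif R (U * M)%type); rewrite (entr_unif_coarse m0 U0).
have -> : entr (@unif R (U * M)%type) = ln #|U|%:R + ln #|M|%:R.
  rewrite /entr mass_unif ?card_prod ?muln_gt0 ?U0// ln1.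
  under eq_bigr => t _ do rewrite sub0r /unif opprK.
  rewrite -mulr_suml -[X in X * _]/(mass (@unif R (U * M)%type)) mass_unif ?card_prod ?muln_gt0 ?U0// mul1r.
  by rewrite natrM lnM// posrE ltr0n.
by move=> /addrI.
Qed.

End fano.

(** * From a code to a point of the region *)

Section converse.
Context {R : realType}.
Local Notation C := R[i].
Local Notation vec := (@vec R).

Lemma unflatD n q (f g : vec (ind n q)) i :
  unflat (fun k => f k + g k) i = unflat f i + unflat g i.
Proof. by apply/matrixP => j l; rewrite !mxE; simpc. Qed.

Lemma unif_sum (Mp Mc : nat) (F : 'I_Mp * 'I_Mc -> R) :
  \sum_w expR (unif w) * F w = (Mp * Mc)%:R^-1 * \sum_(u < Mp) \sum_(m < Mc) F (u, m).
Proof.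
rewrite sum_pair mulr_sumr; apply: eq_bigr => u _; rewrite mulr_sumr; apply: eq_bigr => m _.
by rewrite expR_unif card_prod !card_ord.
Qed.

(* Giving the second receiver the whitened remainder [V] of the first output turns it into the
   pair [G], [D] with independent noises. *)
Lemma side_info_bound (U M : finType) (b : U -> vec M) (n k p c : nat)
    (X : U * M -> 'I_n -> 'cV[C]_k) (G V : 'M[C]_(p, k)) (H D : 'M[C]_(c, k)) (O : 'M[C]_(p + c))
    (E := covm (ecov (fun u m => sig (fun m => X (u, m)) G m) b) X) :
  (0 < n)%N -> \sum_u mass (b u) = 1 -> O *m ctr O = 1%:M -> O *m col_mx V H = col_mx G D ->
  \sum_u (entr (b u) - Op (sig (fun m => X (u, m)) H) (@entr R M) (b u)) <=
  \sum_u (entr (b u) - Op (sig (fun m => X (u, m)) G) (@entr R M) (b u))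
  + n%:R * lndet (1%:M + D *m E *m ctr D).
Proof.
move=> n0 Sb OO OV.
apply: le_trans (lerD (lexx _) (info_upper_bound (fun u m => sig (fun m => X (u, m)) G m) X D n0 Sb)).
rewrite -big_split/=; apply: ler_sum => u _; rewrite addrA subrK lerD2l lerN2.
have nH := @entr_ntame R M.
set Y := fun m => X (u, m).
rewrite -(Op_col_mx Y G D (b u) nH) -OV (Op_unitary Y (col_mx V H) (b u) OO nH).
rewrite (Op_col_mx Y V H (b u) nH) (Op_comm _ _ _ nH).
apply: Op_le; [exact: (Op_ntame _ nH).1|exact: nH.1|exact: Op_entr_le].
Qed.

(** Here [A] is the logarithm of the message count, [h] the entropy left after the output, [v]
    Fano's bound on it, [J] the cognitive information and [L] the Gaussian bound. The hypothesis
    [h <= A] covers the case where the maximum is 0. *)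
Lemma rate_primary (N r L J A h v : R) : 0 < N -> N * r <= Num.max 0 (A - v) -> h <= v -> h <= A ->
  A - h + J <= N * L -> r <= L - J / N.
Proof.
move=> N0 hr hv hA hL; rewrite -(ler_pM2l N0) mulrBr mulrCA divff ?gt_eqF// mulr1.
have : Num.max 0 (A - v) <= A - h by rewrite ge_max subr_ge0 hA lerD2l lerN2.
by move: hr hL; lra.
Qed.

Lemma rate_cognitive (N r L J A h v : R) : 0 < N -> N * r <= Num.max 0 (A - v) -> h <= v -> h <= A ->
  A - h <= J + N * L -> r <= J / N + L.
Proof.
move=> N0 hr hv hA hL; rewrite -(ler_pM2l N0) mulrDr mulrCA divff ?gt_eqF// mulr1.
have : Num.max 0 (A - v) <= A - h by rewrite ge_max subr_ge0 hA lerD2l lerN2.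
by move: hr hL; lra.
Qed.

Section code.
Variables (npt nct npr ncr : nat) (Hpp : 'M[C]_(npr, npt)) (Hcp : 'M[C]_(npr, nct)).
Variables (Hpc : 'M[C]_(ncr, npt)) (Hcc : 'M[C]_(ncr, nct)) (Pp Pc alpha : R).
Variables (d : measure_display) (Omega : measurableType d) (P : probability Omega R).
Variables (Zp : nat -> Omega -> 'cV[C]_npr) (Zc : nat -> Omega -> 'cV[C]_ncr).
Variables (n Mp Mc : nat) (Ep : 'I_Mp -> 'I_n -> 'cV[C]_npt).
Variables (Ec : 'I_Mp -> 'I_Mc -> 'I_n -> 'cV[C]_nct).
Variables (Dp : ('I_n -> 'cV[C]_npr) -> 'I_Mp) (Dc : ('I_n -> 'cV[C]_ncr) -> 'I_Mc).
Hypotheses (a0 : 0 < alpha) (n0 : (0 < n)%N) (Zp_cn : cn_iid P Zp) (Zc_cn : cn_iid P Zc).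
Hypotheses (bDp : borel_decoder Dp) (bDc : borel_decoder Dc).

Local Notation U := 'I_Mp.
Local Notation M := 'I_Mc.
Local Notation b := (@unif R (U * M)%type).
Local Notation bu u := (fun m : M => b (u, m)).
Local Notation G := (Galpha Hpp Hcp alpha).

Definition codeword (w : U * M) (i : 'I_n) : 'cV[C]_(npt + nct) :=
  col_mx (Ep w.1 i) (rc (Num.sqrt alpha) *: Ec w.1 w.2 i).
(* The cognitive receiver after subtracting the interference of the known primary message. *)
Definition Hside : 'M[C]_(ncr, npt + nct) := row_mx 0 (rc (Num.sqrt alpha)^-1 *: Hcc).
Local Notation X := codeword.
Local Notation Xu u := (fun m : M => X (u, m)).

Lemma scale_cancel q (H : 'M[C]_(q, nct)) (x : 'cV[C]_nct) :
  (rc (Num.sqrt alpha)^-1 *: H) *m (rc (Num.sqrt alpha) *: x) = H *m x.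
Proof.
rewrite -scalemxAl -scalemxAr scalerA /rc -rmorphM mulVf ?scale1r//.
by rewrite gt_eqF// sqrtr_gt0.
Qed.

Lemma Galpha_codeword w i : G *m X w i = Hpp *m Ep w.1 i + Hcp *m Ec w.1 w.2 i.
Proof. by rewrite mul_row_col scale_cancel. Qed.

Lemma Hside_codeword w i : Hside *m X w i = Hcc *m Ec w.1 w.2 i.
Proof. by rewrite mul_row_col scale_cancel mul0mx add0r. Qed.

(** A decoder takes values in the message set, so its value at the zero output shows that the set is
    inhabited. *)
Let m0 : M := Dc (fun=> 0).
Let u0 : U := Dp (fun=> 0).
Let Mc0 : (0 < #|M|)%N. Proof. by apply/card_gt0P; exists m0. Qed.
Let Mp0 : (0 < #|U|)%N. Proof. by apply/card_gt0P; exists u0. Qed.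
Let Sb : mass b = 1. Proof. by rewrite mass_unif// card_prod muln_gt0 Mp0. Qed.

Lemma fano_primary :
  Op (sig X G) (fun b => entr (coarse b)) b <= ln 2 +
  err_prob P (fun mp mc w i => Hpp *m Ep mp i + Hcp *m Ec mp mc i + Zp i w)
        (fun mp _ y => Dp y != mp) * ln Mp%:R.
Proof.
have := fano_expect (p := fst) (dec := fun y => Dp (fun i => unflat y i + 0)) (sig X G) b
  (cn_iid_gauss n Zp_cn) (fun l => borel_decoder_measurable (fun=> 0) l bDp)
  (tame_coarse _ m0) (entr_coarse_fano m0).
rewrite Sb mul1r card_ord (unif_sum (fun w => fine (P _))).
congr (_ <= _ + _ * _ * _); apply: eq_bigr => u _; apply: eq_bigr => m _.
congr (fine (P _)); apply/seteqP; split => w /=;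
  rewrite (_ : (fun i => unflat _ i + 0) = fun i => Hpp *m Ep u i + Hcp *m Ec u m i + Zp i w)//;
  by apply/funext => i; rewrite addr0 unflatD !flatK Galpha_codeword addrC.
Qed.

(** For each fixed [u] the decoder is fed the output of [Hside] with the known interference
    [Hpc *m Ep u i] added back, which reproduces the true cognitive output. *)
Lemma fano_cognitive :
  \sum_u Op (sig (Xu u) Hside) (@entr R M) (bu u) <= ln 2 +
  err_prob P (fun mp mc w i => Hpc *m Ep mp i + Hcc *m Ec mp mc i + Zc i w)
        (fun _ mc y => Dc y != mc) * ln Mc%:R.
Proof.
have h u := fano_expect (p := id) (dec := fun y => Dc (fun i => unflat y i + Hpc *m Ep u i))
  (sig (Xu u) Hside) (bu u)
  (cn_iid_gauss n Zc_cn) (fun l => borel_decoder_measurable (fun i => Hpc *m Ep u i) l bDc)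
  (entr_ntame M).1 (@entr_fano_sum R M).
apply: le_trans (ler_sum _ (fun u _ => h u)) _.
rewrite big_split/= -!mulr_suml mass_pair Sb mul1r card_ord lerD2l.
rewrite -(sum_pair (fun w => expR (b w) * fine (P [set w' | Dc (fun i => unflat (fun k =>
   flat (fun i => Zc i w') k + sig (Xu w.1) Hside w.2 k) i + Hpc *m Ep w.1 i) != w.2]))).
rewrite unif_sum le_eqVlt; apply/orP; left; apply/eqP.
congr (_ * _ * _); apply: eq_bigr => u _; apply: eq_bigr => m _.
congr (fine (P _)); apply/seteqP; split => w /=;
  rewrite (_ : (fun i => unflat _ i + _) = fun i => Hpc *m Ep u i + Hcc *m Ec u m i + Zc i w)//;
  by apply/funext => i; rewrite unflatD !flatK Hside_codeword addrC addrA addrAC.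
Qed.

Hypotheses (hPp : \sum_(i < n) complex.Re (\tr (cov_mx (fun u => Ep u i))) <= n%:R * Pp)
  (hPc : \sum_(i < n) complex.Re (\tr (cov_mx (fun w : U * M => Ec w.1 w.2 i))) <= n%:R * Pc).

Lemma code_rates (Qz : 'M[C]_(npr, ncr)) (r1 r2 : R) : admissible Qz -> 0 <= r1 -> 0 <= r2 ->
  n%:R * (r1 * ln 2) <= Num.max 0 (ln Mp%:R - (ln 2 +
  err_prob P (fun mp mc w i => Hpp *m Ep mp i + Hcp *m Ec mp mc i + Zp i w)
        (fun mp _ y => Dp y != mp) * ln Mp%:R)) ->
  n%:R * (r2 * ln 2) <= Num.max 0 (ln Mc%:R - (ln 2 +
  err_prob P (fun mp mc w i => Hpc *m Ep mp i + Hcc *m Ec mp mc i + Zc i w)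
        (fun _ mc y => Dc y != mc) * ln Mc%:R)) ->
  conv2 (Rout_pre Hpp Hcp Hcc Pp Pc alpha Qz) (r1, r2).
Proof.
move=> adm r10 r20.
have := fano_primary; have := fano_cognitive.
set ec := err_prob _ _ _ * _; set ep := err_prob _ _ _ * _; set Hc := Op _ _ _; set Hd := \sum_u _.
move=> fc fp hr1 hr2.
have [D [V [Q [OO OV hdet]]]] := whitening G Hside adm.
have Sbu : \sum_u mass (bu u) = 1 by rewrite mass_pair.
have [pN hL] := info_lower_bound X G n0 Sbu.
have hU := info_upper_bound0 X G n0 Sb.
have hS := side_info_bound X n0 Sbu OO OV.
have trS := covm_trace_le n0 Mp0 Mc0 a0 hPp hPc.
have pE := covm_psd (@ecovD R U M _ (fun u m => sig (Xu u) G m) (fun u => bu u))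
  (@ecovZ R U M _ _ _) (@ecovC R U M _ _ _) (@ecov_ge0 R U M _ _ _) X.
have pS := covm_psd (@vcovD R _ b) (@vcovZ R _ b) (@vcovC R _ b) (@vcov_ge0 R _ b) X.
have hE A := covm_mmse X G A n0 Sb.
move: hS hL hU; set Ic := \sum_u (entr (bu u) - Op (sig (Xu u) G) (@entr R M) (bu u)).
(* The information of [G] about both messages splits into [ln Mp%:R - Hc], about the primary
   message, and [Ic], about the cognitive one given the primary. *)
rewrite (Op_chain m0) (entr_chain m0) (entr_unif_coarse m0 Mp0) -/Hc card_ord.
rewrite opprD addrACA -sumrB -/Ic.
rewrite {1}sumrB (entr_unif_res Mp0 Mc0) -/Hd card_ord => hS hL hU.
have Hc_le : Hc <= ln Mp%:R.
  have := Op_le (sig X G) b (tame_coarse U m0) (tameZ (ln #|U|%:R) (@mass_ntame R (U * M)%type).1)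
    (fun b' => _ : entr (coarse b') <= ln #|U|%:R * mass b').
  rewrite (OpZ _ _ _ (@mass_ntame R (U * M)%type).1) Op_mass Sb mulr1 card_ord; apply => b'.
  by rewrite -(mass_coarse m0) -[X in ln X%:R](card_ord Mp); exact: entr_le.
have Hd_le : Hd <= ln Mc%:R.
  have := entr_unif_res Mp0 Mc0; rewrite card_ord => <-.
  by apply: ler_sum => u _; exact: Op_entr_le.
have n0' : 0 < n%:R :> R by rewrite ltr0n.
(* [hdet] fits because the block matrix [Kbar] unfolds to [Galpha] stacked on [Hside]. *)
apply: (@Rout_conv R npt nct npr ncr Hpp Hcp Hcc Pp Pc alpha Qz D
   (covm (ecov (fun u m => sig (Xu u) G m) (fun u => bu u)) X) (covm (vcov b) X) (Ic / n%:R)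
   r1 r2 hdet adm.2 pE pS pN hE trS _ _ r10 r20).
- by rewrite ler_pdivlMr// mulrC mulrN; exact: hL.
- rewrite ler_pdivrMr// mulrC; apply: le_trans hU; rewrite lerDr subr_ge0; exact: Hc_le.
- exact: rate_primary n0' hr1 fp Hc_le hU.
- exact: rate_cognitive n0' hr2 fc Hd_le hS.
Qed.

End code.

End converse.

(** * Passage to vanishing error probability *)

Section closure.
Context {R : realType}.

Lemma rate_approx (delta r N eps : R) : 0 < delta -> 0 <= r -> 0 <= eps -> eps * r < delta / 2 ->
  2 / delta < N -> `|r - Num.max 0 ((1 - eps) * r - N^-1)| < delta.
Proof.
move=> d0 r0 e0 er hN.
have N0 : 0 < N by apply: lt_trans hN; exact: divr_gt0.
have iN0 : 0 < N^-1 by rewrite invr_gt0.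
have hN' : N^-1 < delta / 2 by rewrite -invf_div ltf_pV2// posrE divr_gt0.
have er0 : 0 <= eps * r by exact: mulr_ge0.
have eE : (1 - eps) * r = r - eps * r by rewrite mulrBl mul1r.
rewrite eE ltr_norml; apply/andP; split.
  have : Num.max 0 (r - eps * r - N^-1) <= r by rewrite ge_max r0/=; lra.
  by lra.
have : r - eps * r - N^-1 <= Num.max 0 (r - eps * r - N^-1) by rewrite le_max lexx orbT.
by lra.
Qed.

(** Fano's inequality costs the factor [1 - eps] and one bit per block, hence [N^-1]; the truncation
    at 0 keeps the pair in the nonnegative quadrant. *)
Lemma rate_code (N r eps M err : R) : 0 < N -> 0 <= r -> eps <= 1 -> err <= eps ->
  2 `^ (N * r) <= M ->
  N * (Num.max 0 ((1 - eps) * r - N^-1) * ln 2) <= Num.max 0 (ln M - (ln 2 + err * ln M)).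
Proof.
move=> N0 r0 e1 he hM.
have p0 : 0 < 2 `^ (N * r) :> R by apply: powR_gt0.
have hl : N * r * ln 2 <= ln M.
  by rewrite -ln_powR ler_ln// posrE//; exact: lt_le_trans hM.
have l2 : 0 < ln 2 :> R by rewrite ln_gt0// ltr1n.
have l0 : 0 <= ln M by apply: le_trans hl; rewrite !mulr_ge0// ltW.
have [h|h] := leP ((1 - eps) * r - N^-1) 0.
  by rewrite mul0r mulr0 le_max lexx.
rewrite le_max; apply/orP; right.
have -> : N * (((1 - eps) * r - N^-1) * ln 2) = (1 - eps) * (N * r * ln 2) - ln 2.
  by field; rewrite gt_eqF.
apply: (@le_trans _ _ ((1 - eps) * ln M - ln 2)).
  by rewrite lerD2r ler_wpM2l// subr_ge0.
have : err * ln M <= eps * ln M by rewrite ler_wpM2r.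
by rewrite mulrBl mul1r; lra.
Qed.

End closure.

Theorem theorem2 (R : realType) (npt nct npr ncr : nat)
  (Hpp : 'M[R[i]]_(npr, npt)) (Hcp : 'M[R[i]]_(npr, nct))
  (Hpc : 'M[R[i]]_(ncr, npt)) (Hcc : 'M[R[i]]_(ncr, nct)) (Pp Pc : R)
  (d : measure_display) (Omega : measurableType d) (P : probability Omega R)
  (Zp : nat -> Omega -> 'cV[R[i]]_npr) (Zc : nat -> Omega -> 'cV[R[i]]_ncr) :
  cn_iid P Zp -> cn_iid P Zc ->
  (forall (alpha : R) (Qz : 'M[R[i]]_(npr, ncr)),
     0 < alpha -> admissible Qz ->
     C_MCC Hpp Hcp Hpc Hcc Pp Pc P Zp Zc `<=` Rout Hpp Hcp Hcc Pp Pc alpha Qz) /\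
  C_MCC Hpp Hcp Hpc Hcc Pp Pc P Zp Zc `<=` Rout_all Hpp Hcp Hcc Pp Pc.
Proof.
move=> Zp_cn Zc_cn.
suff main (alpha : R) (Qz : 'M[R[i]]_(npr, ncr)) : 0 < alpha -> admissible Qz ->
     C_MCC Hpp Hcp Hpc Hcc Pp Pc P Zp Zc `<=` Rout Hpp Hcp Hcc Pp Pc alpha Qz.
  by split => // r Cr alpha Qz a0 adm; exact: main Cr.
move=> a0 adm [rp rc] [/= rp0 [rc0 ach]] B /nbhs_ballP[delta /= d0 hB].
(* Makes [delta / s] at most 1 and its product with either rate less than [delta / 2]. *)
pose s := 2 * (1 + rp + rc) + delta.
have s0 : 0 < s by rewrite /s; lra.
pose eps := delta / s.
have eps0 : 0 < eps by exact: divr_gt0.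
have eps1 : eps <= 1 by rewrite ler_pdivrMr// mul1r /s; lra.
have small r : 0 <= r -> r <= rp + rc -> eps * r < delta / 2.
  move=> r0 hr; rewrite /eps mulrAC -mulrA ltr_pM2l// ltr_pdivrMr// /s; lra.
have [N hN] := ach _ eps0.
(* Beyond the threshold [N], and so long that the one bit lost in Fano's inequality costs a rate
   below [delta / 2]. *)
pose n := (N + Num.bound (2 / delta))%N.
have hn : 2 / delta < n%:R.
  apply: lt_le_trans (archi_boundP _) _; first by rewrite divr_ge0// ltW.
  by rewrite ler_nat leq_addl.
have n0' : 0 < n%:R :> R by apply: lt_trans hn; exact: divr_gt0.
have n0 : (0 < n)%N by rewrite -(ltr0n R).
have [Mp [Mc [Ep [Ec [Dp [Dc [hMp [hMc [hPp [hPc [bDp [bDc [ep ec]]]]]]]]]]]]] := hN n (leq_addr _ _).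
exists (Num.max 0 ((1 - eps) * rp - n%:R^-1), Num.max 0 ((1 - eps) * rc - n%:R^-1)); split.
  apply: (code_rates a0 n0 Zp_cn Zc_cn bDp bDc hPp hPc adm).
  - by rewrite le_max lexx.
  - by rewrite le_max lexx.
  - exact: rate_code n0' rp0 eps1 ep hMp.
  - exact: rate_code n0' rc0 eps1 ec hMc.
apply: hB; split => /=.
  by apply: rate_approx => //; [exact: ltW|apply: small => //; lra].
by apply: rate_approx => //; [exact: ltW|apply: small => //; lra].
Qed.
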